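(* Let $A_J$ be the algebra of sections of a smooth one-parameter deformation of locally convex algebras over an open interval $J$. If $P\in M_N(A_J)$ is an idempotent and $U\in M_N(A_J)$ is an invertible, then $$\nabla_{GM}[\mathrm{ch}\,P]=0,\qquad \nabla_{GM}[\mathrm{ch}\,U]=0$$ in $HP_\bullet(A_J)$ (periodic cyclic homology over the ground ring $C^\infty(J)$).
   Context: **Spaces and deformations.** All locally convex spaces are complete, Hausdorff and over $\mathbb{C}$; $J\subseteq\mathbb{R}$ is a nonempty open interval; $C^\infty(J,X)$ has the topology of uniform convergence of all derivatives on compact sets. A smooth one-parameter deformation of algebras is a collection of associative continuous linear maps $\{m_t:X\widehat\otimes X\to X\}_{t\in J}$ such that $m_t=\epsilon_t\circ\widetilde m$ for some continuous linear $\widetilde m:X\widehat\otimes X\to C^\infty(J,X)$ ($\epsilon_t$ evaluation at $t$, $\widehat\otimes$ completed projective tensor product). $A_J=C^\infty(J,X)$ with product $(a_1a_2)(t)=m_t(a_1(t),a_2(t))$ is a locally convex $C^\infty(J)$-algebra. **Periodic cyclic complex over $R=C^\infty(J)$.** For a locally convex $R$-algebra $A$, let $A_+=A\oplus R$ be its unitization with unit $e$ (formed even if $A$ is unital), $C_0(A)=A$, $C_n(A)=A_+\widehat\otimes_RA^{\widehat\otimes_Rn}$ for $n\ge 1$, $$b(a_0,\dots,a_n)=\sum_{j=0}^{n-1}(-1)^j(a_0,\dots,a_ja_{j+1},\dots,a_n)+(-1)^n(a_na_0,a_1,\dots,a_{n-1}),$$ $$B(a_0,\dots,a_n)=\sum_{j=0}^n(-1)^{jn}(e,a_j,\dots,a_n,a_0,\dots,a_{j-1})\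 (a_0\in A),\qquad B(e,a_1,\dots,a_n)=0.$$ $C_{\mathrm{per}}(A)=\prod_nC_{2n}(A)\oplus\prod_nC_{2n+1}(A)$ with differential $b+B$; its even/odd homology is $HP_0(A),HP_1(A)$. **Gauss–Manin connection.** Let $\nabla$ be a connection on $A_J$: a continuous $\mathbb{C}$-linear map with $\nabla(fa)=f'a+f\nabla a$ (e.g. $d/dt$). Let $E(a_1,a_2)=\nabla(a_1)a_2+a_1\nabla(a_2)-\nabla(a_1a_2)$ (this is $C^\infty(J)$-bilinear). With $\nabla e=0$ put $L_\nabla(a_0,\dots,a_n)=\sum_i(a_0,\dots,\nabla a_i,\dots,a_n)$. Put $I_E=\iota_E+S_E$, where $\iota_E(a_0,\dots,a_n)=-(a_0E(a_1,a_2),a_3,\dots,a_n)$ (zero for $n<2$), $S_E(e,a_1,\dots,a_n)=0$, and for $a_0\in A_J$ $$S_E(a_0,\dots,a_n)=\sum_{i=1}^{n-1}\sum_{j=0}^{n-i-1}(-1)^{i+j(n-1)}(e,a_{n-j+1},\dots,a_n,a_0,\dots,a_{i-1},E(a_i,a_{i+1}),a_{i+2},\dots,a_{n-j}).$$ $\nabla_{GM}=L_\nabla-I_E$ commutes with $b+B$ and induces a connection on $HP_\bullet(A_J)$, also denoted $\nabla_{GM}$, which does not depend on $\nabla$. **Chern character.** For an idempotent $P$ in an $R$-algebra $A$, $\mathrm{ch}\,P\in C_{\mathrm{even}}(A)=\prod_nC_{2n}(A)$ has components $(\mathrm{ch}\,P)_0=P$ and $(\mathrm{ch}\,P)_{2n}=(-1)^n\frac{(2n)!}{n!}\bigl(P^{\otimes(2n+1)}-\tfrac12e\otimes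 P^{\otimes 2n}\bigr)$ for $n\ge1$. For an invertible $U\in A$, $\mathrm{ch}\,U\in C_{\mathrm{odd}}(A)=\prod_nC_{2n+1}(A)$ has components $$(\mathrm{ch}\,U)_{2n+1}=(-1)^nn!\,U^{-1}\otimes U\otimes U^{-1}\otimes\cdots\otimes U^{-1}\otimes U$$ ($2n+2$ tensor factors, alternating). The source takes both to be cycles for $b+B$, with classes $[\mathrm{ch}\,P]\in HP_0(A)$ and $[\mathrm{ch}\,U]\in HP_1(A)$. For an idempotent or invertible in $M_N(A)\cong M_N(\mathbb{C})\otimes A$ one applies these formulas in $M_N(A)$ and then the generalized trace $T:C_\bullet(M_N(A))\to C_\bullet(A)$, $T((u_0\otimes a_0)\otimes\cdots\otimes(u_n\otimes a_n))=\mathrm{tr}(u_0\cdots u_n)\,a_0\otimes\cdots\otimes a_n$ (the unit $e$ of $M_N(A)_+$ being treated as identity matrix $\otimes\,e$).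
   Formalization: ch U as given is not a cycle in the complex with adjoined unit e (its (b+B)-image has terms with a factor 1 or 1−e), so [ch U] is read as the class corresponding to ch U in the normalized complex; such a cycle is shown to exist and ∇_GM of every such cycle is a boundary. *)

(* Defs.v *)
From HB Require Import structures.
From mathcomp Require Import all_boot all_order all_algebra.
From mathcomp Require Import complex.
From mathcomp Require Import all_classical all_reals all_analysis.
Import Order.TTheory GRing.Theory Num.Theory.
Import numFieldNormedType.Exports.
Set Implicit Arguments.
Unset Strict Implicit.
Unset Printing Implicit Defensive.

Local Open Scope classical_set_scope.
Local Open Scope ring_scope.
Local Open Scope complex_scope.

Section TvsLimits.
Variables (R : realType) (X : tvsType R[i]).

Lemma real_complex_cvg0 : (h%:C : R[i]^o) @[h --> (0 : R)^'] --> (0 : R[i]^o).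
Proof.
apply/cvgr0Pnorm_lt => -[e e'] /=; rewrite ltcE /= => /andP[/eqP -> e0].
apply: filterS (dnbhs0_lt e0) => h; rewrite normc_def /= expr0n addr0 sqrtr_sqr.
by rewrite ltcR.
Qed.

Lemma tvs_cvgD (T : Type) (F : set_system T) (FF : Filter F) (f g : T -> X) a b :
  f @ F --> a -> g @ F --> b -> (fun h => f h + g h) @ F --> a + b.
Proof. exact: continuous2_cvg (@add_continuous X (a, b)). Qed.

Lemma tvs_cvgZ (T : Type) (F : set_system T) (FF : Filter F)
    (c : T -> R[i]^o) (f : T -> X) (k : R[i]^o) a :
  c @ F --> k -> f @ F --> a -> (fun h => (c h : R[i]) *: f h) @ F --> (k : R[i]) *: a.
Proof. exact: continuous2_cvg (@scale_continuous R[i] X (k, a)). Qed.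

Definition difference_quotient (f : R -> X) (t h : R) : X :=
  (h%:C)^-1 *: (f (t + h) - f t).

Lemma derivable_continuous (f : R -> X) (t : R) (l : X) :
  difference_quotient f t h @[h --> 0^'] --> l -> {for t, continuous f}.
Proof.
move=> fl; have fc : f (t + h) @[h --> 0^'] --> f t.
  have : (f t + h%:C *: difference_quotient f t h) @[h --> 0^'] --> f t + 0 *: l.
    apply: tvs_cvgD; first exact: cvg_cst.
    exact: (tvs_cvgZ _ real_complex_cvg0 fl).
  rewrite scale0r addr0; apply: cvg_trans; apply: near_eq_cvg.
  near=> h.
  have h0 : (h%:C : R[i]) != 0.
    suff : h != 0 by apply: contraNneq => /complexI ->.
    by near: h; exact: nbhs_dnbhs_neq.
  rewrite /difference_quotient scalerA (mulfV h0) scale1r.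
  by rewrite addrC subrK.
move=> A fA; have fcA := fc A fA.
have near0 : nbhs (0 : R) (fun h => A (f (h + t))).
  rewrite dnbhsE; split; last by move=> h /= ->; rewrite add0r; exact: nbhs_singleton.
  apply: (@filterS _ ((0 : R)^') _ (fun h => A (f (t + h)))); last exact: fcA.
  by move=> h /=; rewrite addrC.
have : \forall s \near t, A (f s).
  by rewrite (near_shift 0); apply: filterS near0 => h /=; rewrite subr0.
exact.
Unshelve. all: by end_near. Qed.
End TvsLimits.

(* The Cauchy condition uses the translation-invariant uniformity: a [tvsType]
   also carries a uniform structure, but only its topology is required to be
   compatible with the vector space operations. *)
Definition complete_tvs (R : realType) (X : tvsType R[i]) : Prop :=
  forall F : set_system X, ProperFilter F ->
    (forall U, nbhs (0 : X) U ->
       exists2 A, F A & forall x y, A x -> A y -> U (x - y)) ->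
    exists l : X, F --> l.

Record open_interval (R : realType) := OpenInterval {
  interval_set :> set R;
  interval_open : open interval_set;
  interval_convex : is_interval interval_set;
  interval_nonempty : interval_set !=set0
}.

Section Smooth.
Variables (R : realType) (J : set R) (X : tvsType R[i]).

(* An element of C^oo(J, X) is the sequence g of all the derivatives of a smooth
   function J -> X, each extended by 0 outside of J. When X is Hausdorff the
   sequence is determined by its first term (see [Cinf_eq]). *)
Definition smooth_jet : {pred nat -> R -> X} := [pred g |
  `[< (forall k t, J t -> difference_quotient (g k) t h @[h --> 0^'] --> g k.+1 t)
   /\ (forall k t, ~ J t -> g k t = 0) >]].

Lemma smooth_jet_submod_closed : submod_closed smooth_jet.
Proof.
split=> [|c f g /asboolP[fd f0] /asboolP[gd g0]]; apply/asboolP; split=> k t Jt //.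
- have -> : difference_quotient ((0 : nat -> R -> X) k) t = fun=> 0.
    by apply/funext => h; rewrite /difference_quotient subrr scaler0.
  exact: cvg_cst.
- have -> : difference_quotient ((c *: f + g) k) t =
    (fun h => (c : R[i]^o) *: difference_quotient (f k) t h + difference_quotient (g k) t h).
    apply/funext => h; rewrite /difference_quotient scalerA mulrC -scalerA -scalerDr.
    by congr (_ *: _); rewrite scalerBr addrACA opprD.
  by apply: tvs_cvgD (gd k t Jt); apply: tvs_cvgZ (fd k t Jt); exact: cvg_cst.
- by rewrite -[LHS]/(c *: f k t + g k t) f0 // g0 // scaler0 addr0.
Qed.
HB.instance Definition _ := GRing.isSubmodClosed.Build R[i] (nat -> R -> X) smooth_jet smooth_jet_submod_closed.

Record Cinf := MkCinf { jet : nat -> R -> X; jetP : jet \in smooth_jet }.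
HB.instance Definition _ := [isSub for jet].
HB.instance Definition _ := [Choice of Cinf by <:].
HB.instance Definition _ := [SubChoice_isSubLmodule of Cinf by <:].

(* Uniform convergence of all derivatives on the compact subsets of J. *)
Definition jet_map (f : Cinf) :
  prod_topology (fun _ : nat => {family [set K | compact K /\ K `<=` J], R -> X}) :=
  jet f.
HB.instance Definition _ := Topological.copy Cinf (initial_topology jet_map).

Lemma jet_deriv (f : Cinf) k t : J t ->
  difference_quotient (jet f k) t h @[h --> 0^'] --> jet f k.+1 t.
Proof. by have /asboolP[+ _] := jetP f; exact. Qed.

Lemma jet_off (f : Cinf) k t : ~ J t -> jet f k t = 0.
Proof. by have /asboolP[_ +] := jetP f; exact. Qed.

Lemma Cinf_eq (f g : Cinf) : hausdorff_space X ->
  (forall t, J t -> jet f 0 t = jet g 0 t) -> f = g.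
Proof.
move=> hX fg; suff fgE : jet f = jet g by exact: val_inj.
apply/funext => k; apply/funext => t.
elim: k t => [|k IH] t; have [Jt|nJt] := pselect (J t).
- exact: fg.
- by rewrite !jet_off.
- have := @jet_deriv f k t Jt; rewrite (_ : jet f k = jet g k); last exact/funext.
  by move=> H; exact: (cvg_unique hX H (@jet_deriv g k t Jt)).
- by rewrite !jet_off.
Qed.

Fact ddt_subproof (f : Cinf) : (fun k => jet f k.+1) \in smooth_jet.
Proof. by apply/asboolP; split=> [k t|k t]; [exact: jet_deriv|exact: jet_off]. Qed.
Definition ddt (f : Cinf) : Cinf := MkCinf (ddt_subproof f).

Lemma constant_jet_smooth (x : X) : open J ->
  (fun k t => if (k == 0%N) && (t \in J) then x else 0) \in smooth_jet.
Proof.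
move=> oJ; apply/asboolP; split=> k t Jt; last first.
  by rewrite memNset// andbF.
suff : \forall h \near 0^', difference_quotient
    (fun t0 => if (k == 0%N) && (t0 \in J) then x else 0) t h = 0.
  by move=> H; apply: cvg_trans (@cvg_cst X 0 R 0^' _); apply: near_eq_cvg;
     apply: filterS H => h ->.
have Jth : \forall h \near (0 : R)^', J (t + h).
  have st : t + h @[h --> (0 : R)^'] --> t.
    by rewrite -[X in _ --> X]addr0; apply: cvgD; [exact: cvg_cst|exact: nbhs_dnbhs].
  by apply: (st J); exact: open_nbhs_nbhs.
apply: filterS Jth => h Jth; rewrite /difference_quotient.
by rewrite !mem_set// subrr scaler0.
Qed.

Hypothesis oJ : open J.

Definition constant_smooth (x : X) : Cinf := MkCinf (constant_jet_smooth x oJ).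

Lemma jet_eval_cvg (T : Type) (F : set_system T) (FF : Filter F)
    (g : T -> Cinf) (s : T -> R) k (f : Cinf) t : J t ->
  g @ F --> f -> s @ F --> t -> (fun z => jet (g z) k (s z)) @ F --> jet f k t.
Proof.
move=> Jt gf st.
have [e /= e0 eJ] : nbhs_ball t J by apply/nbhs_ballP; move: (oJ); rewrite openE; exact.
pose K := `[t - e/2, t + e/2]%classic.
have e2 : 0 < e/2 by rewrite divr_gt0.
have Kt : nbhs t K.
  apply/nbhs_ballP; exists (e/2) => //= x; rewrite -ball_normE /= => tx.
  by rewrite /K /= in_itv /= -ler_distl distrC ltW.
have KJ : K `<=` J.
  move=> x; rewrite /K /= in_itv /= -ler_distl => tx; apply: eJ.
  by rewrite -ball_normE /= distrC (le_lt_trans tx)// ltr_pdivrMr// ltr_pMr// ltr1n.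
have cf : (fun g : Cinf => jet g k : {family [set K | compact K /\ K `<=` J], R -> X}) @ f
    --> (jet f k : {family [set K | compact K /\ K `<=` J], R -> X}).
  apply: (@continuous_comp _ _ _ jet_map (fun g => g k)).
    exact: initial_continuous.
  exact: (@proj_continuous nat (fun=> {family [set K | compact K /\ K `<=` J], R -> X}) k).
move/fam_cvgP: cf => /(_ _ K (conj (@segment_compact _ _ _) KJ)) cf.
have ct : jet f k s @[s --> t] --> jet f k t.
  exact: derivable_continuous (@jet_deriv f k t Jt).
apply/cvg_app_entourageP => A entA.
have [B entB BA] := entourage_split_ex entA.
have /cvg_app_entourageP/(_ _ entB) ct' := ct.
have cf' : \forall g \near f, forall y, K y -> B (jet f k y, jet g k y).
  pose P := [set h : {uniform` K -> X} | forall y, K y -> B (jet f k y, h y)].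
  have nP : nbhs (jet f k : {uniform` K -> X}) P.
    by apply: (iffRL (uniform_nbhs _ _)); exists B; split.
  exact: (cf (fmap_filter _ (nbhs_filter f)) P nP).
have P1 : \forall z \near F, B (jet f k t, jet f k (s z)) := st _ ct'.
have P2 : \forall z \near F, K (s z) := st _ Kt.
have P3 : \forall z \near F, forall y, K y -> B (jet f k y, jet (g z) k y) := gf _ cf'.
apply: (@filterS3 _ F FF _ _ _ _ _ P1 P2 P3) => z B1 Kz B2; apply: BA.
by exists (jet f k (s z)) => //; exact: B2.
Qed.
End Smooth.

Arguments smooth_jet {R} J {X}.

Section Leibniz.
Variables (R : realType) (J : set R) (X Y Z : tvsType R[i]).

(* The k-th derivative of t |-> G 0 (a t) (b t) t. *)
Fixpoint leibniz (k : nat) (G : nat -> X -> Y -> R -> Z)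
    (a : nat -> R -> X) (b : nat -> R -> Y) (t : R) : Z :=
  if k is k'.+1 then
    leibniz k' G (fun i => a i.+1) b t + leibniz k' G a (fun i => b i.+1) t
    + leibniz k' (fun i => G i.+1) a b t
  else G 0 (a 0 t) (b 0 t) t.

(* A smooth family of bilinear maps G 0 _ _ t, with t-derivatives G 1, G 2, ... *)
Definition smooth_bilinear_family (G : nat -> X -> Y -> R -> Z) :=
  [/\ forall i t y, linear (fun x => G i x y t),
      forall i t x, linear (fun y => G i x y t),
      forall i x y t, J t ->
        (fun z : (X * Y) * R => G i z.1.1 z.1.2 z.2) @ (x, y, t) --> G i x y t
    & forall i x y t, J t ->
        difference_quotient (G i x y) t h @[h --> 0^'] --> G i.+1 x y t].

Lemma jet_shift (V : tvsType R[i]) (g : nat -> R -> V) :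
  g \in smooth_jet J -> (fun i => g i.+1) \in smooth_jet J.
Proof. by move=> /asboolP[g1 g2]; apply/asboolP; split=> i s; [exact: g1|exact: g2]. Qed.

Lemma smooth_bilinear_family_shift G :
  smooth_bilinear_family G -> smooth_bilinear_family (fun i => G i.+1).
Proof.
by case=> G1 G2 G3 G4; split=> i; [exact: G1|exact: G2|exact: G3|exact: G4].
Qed.

Lemma linear_subZ (U V : lmodType R[i]) (f : U -> V) : linear f ->
  (forall u v, f (u - v) = f u - f v) /\ (forall c u, f (c *: u) = c *: f u).
Proof.
move=> fl; have f0 : f 0 = 0.
  have := fl 1 0 0; rewrite !scale1r addr0 => /(congr1 (fun z => z - f 0)).
  by rewrite subrr addrK.
split=> [u v|c u]; first by rewrite -[- v]scaleN1r addrC fl scaleN1r addrC.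
by rewrite -[c *: u]addr0 fl f0 addr0.
Qed.

Lemma leibniz_deriv k G a b t : smooth_bilinear_family G ->
  a \in smooth_jet J -> b \in smooth_jet J -> J t ->
  difference_quotient (leibniz k G a b) t h @[h --> 0^'] --> leibniz k.+1 G a b t.
Proof.
elim: k G a b => [|k IH] G a b GG aa bb Jt.
- case: GG => G1 G2 G3 G4.
  have [ad _] := asboolP _ aa; have [bd _] := asboolP _ bb.
  have -> : difference_quotient (leibniz 0 G a b) t = fun h =>
     G 0 (difference_quotient (a 0) t h) (b 0 (t + h)) (t + h)
     + G 0 (a 0 t) (difference_quotient (b 0) t h) (t + h)
     + difference_quotient (G 0 (a 0 t) (b 0 t)) t h.
    apply/funext => h; rewrite /difference_quotient /=.
    have [G1B G1Z] := linear_subZ (G1 0 (t + h) (b 0 (t + h))).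
    have [G2B G2Z] := linear_subZ (G2 0 (t + h) (a 0 t)).
    by rewrite G1Z G1B G2Z G2B -!scalerDr !addrA subrK subrK.
  have st : t + h @[h --> (0:R)^'] --> t.
    rewrite -[X in _ --> X]addr0; apply: cvgD; [exact: cvg_cst|exact: nbhs_dnbhs].
  have bt : b 0 (t + h) @[h --> 0^'] --> b 0 t.
    exact: (cvg_comp _ _ st (derivable_continuous (bd 0 t Jt))).
  have lim u v (x : R -> X) (y : R -> Y) : x @ 0^' --> u -> y @ 0^' --> v ->
      G 0 (x h) (y h) (t + h) @[h --> 0^'] --> G 0 u v t.
    move=> xu yv; apply: (@continuous2_cvg R (X * Y)%type R Z _ _ (fun h => (x h, y h))
      (fun h => t + h) (fun p => G 0 p.1 p.2) (u, v) t (G3 0 u v t Jt) _ st).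
    exact: cvg_pair xu yv.
  apply: tvs_cvgD; first apply: tvs_cvgD.
  + exact: lim (ad 0 t Jt) bt.
  + by apply: lim (bd 0 t Jt); exact: cvg_cst.
  + exact: G4.
- have -> : difference_quotient (leibniz k.+1 G a b) t = fun h =>
     difference_quotient (leibniz k G (fun i => a i.+1) b) t h
     + difference_quotient (leibniz k G a (fun i => b i.+1)) t h
     + difference_quotient (leibniz k (fun i => G i.+1) a b) t h.
    apply/funext => h; rewrite /difference_quotient -!scalerDr; congr (_ *: _) => /=.
    by rewrite !opprD [LHS]addrACA [X in X + _ = _]addrACA.
  by apply: tvs_cvgD; first apply: tvs_cvgD; apply: IH => //;
     [exact: jet_shift|exact: jet_shift|exact: smooth_bilinear_family_shift].
Qed.

Lemma leibniz_smooth G a b : smooth_bilinear_family G ->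
  a \in smooth_jet J -> b \in smooth_jet J ->
  (fun k => leibniz k G a b) \in smooth_jet J.
Proof.
move=> GG aa bb; apply/asboolP; split=> k t; first exact: leibniz_deriv.
move=> nJt; elim: k G a b GG aa bb => [|k IH] G a b GG aa bb /=.
  case: GG => G1 _ _ _; have [_ /(_ 0%N t nJt) ->] := asboolP _ aa.
  by have [_ GZ] := linear_subZ (G1 0%N t (b 0%N t)); rewrite -(scale0r 0) GZ scale0r.
by rewrite !IH ?addr0//; first [exact: jet_shift|exact: smooth_bilinear_family_shift].
Qed.

Definition leibniz_product G (GG : smooth_bilinear_family G)
    (a : Cinf J X) (b : Cinf J Y) : Cinf J Z :=
  MkCinf (leibniz_smooth GG (jetP a) (jetP b)).

End Leibniz.

Section Deformation.
Variables (R : realType) (J : open_interval R) (X : tvsType R[i]).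

Lemma scale_family_smooth : smooth_bilinear_family J
  (fun (i : nat) (c : R[i]^o) (x : X) (_ : R) =>
     if i is 0 then (c : R[i]) *: x else 0).
Proof.
split=> [[|i] t y c u v|[|i] t y c u v|[|i] x y t Jt|[|i] x y t Jt] /=.
- by rewrite scalerDl scalerA.
- by rewrite scaler0 addr0.
- by rewrite scalerDr !scalerA mulrC.
- by rewrite scaler0 addr0.
- apply: (@continuous2_cvg _ _ _ _ _ _ (fun z : (R[i]^o * X) * R => z.1.1)
    (fun z => z.1.2) (fun c x => (c : R[i]) *: x) x y).
  + exact: (@scale_continuous R[i] X (x, y)).
  + by apply: (cvg_comp fst fst); exact: cvg_fst.
  + by apply: (cvg_comp fst snd); [exact: cvg_fst|exact: cvg_snd].
- exact: cvg_cst.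
- rewrite (_ : difference_quotient _ _ = fun=> 0); first exact: cvg_cst.
  by apply/funext => h; rewrite /difference_quotient subrr scaler0.
- rewrite (_ : difference_quotient _ _ = fun=> 0); first exact: cvg_cst.
  by apply/funext => h; rewrite /difference_quotient subrr scaler0.
Qed.

Definition act (f : Cinf J (R[i]^o)) (a : Cinf J X) : Cinf J X :=
  leibniz_product scale_family_smooth f a.

Lemma actE f a (t : R) : jet (act f a) 0 t = (jet f 0 t : R[i]) *: jet a 0 t.
Proof. by []. Qed.

(* By the universal property of the completed projective tensor product, a
   continuous linear map X (x) X -> C^oo(J, X) is a jointly continuous bilinear
   map [mt]; the product m_t on X is [mt] followed by evaluation at t. *)
Record deformation := Deformation {
  mt : X -> X -> Cinf J X;
  mt_linearl : forall y, linear (fun x => mt x y);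
  mt_linearr : forall x, linear (mt x);
  mt_continuous : continuous (fun z : X * X => mt z.1 z.2);
  mt_assoc : forall t x y z, (J : set R) t ->
    jet (mt (jet (mt x y) 0 t) z) 0 t = jet (mt x (jet (mt y z) 0 t)) 0 t
}.

Lemma mt_family_smooth (D : deformation) : smooth_bilinear_family J
  (fun i x y t => jet (mt D x y) i t).
Proof.
split=> [i t y c u v|i t y c u v|i x y t Jt|i x y t Jt].
- by rewrite mt_linearl.
- by rewrite mt_linearr.
- apply: (@jet_eval_cvg R J X (@interval_open R J) _ _ _
    (fun z : (X * X) * R => mt D z.1.1 z.1.2) snd i (mt D x y) t Jt _ cvg_snd).
  apply: (@continuous2_cvg _ _ _ _ _ _ (fun z : (X * X) * R => z.1.1)
    (fun z => z.1.2) (mt D) x y (@mt_continuous D (x, y))).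
  + by apply: (cvg_comp fst fst); exact: cvg_fst.
  + by apply: (cvg_comp fst snd); [exact: cvg_fst|exact: cvg_snd].
- exact: jet_deriv.
Qed.

Definition mulJ (D : deformation) (a b : Cinf J X) : Cinf J X :=
  leibniz_product (mt_family_smooth D) a b.

Lemma mulJE D a b (t : R) :
  jet (mulJ D a b) 0 t = jet (mt D (jet a 0 t) (jet b 0 t)) 0 t.
Proof. by []. Qed.

End Deformation.

Section PeriodicCyclic.
Variables (R : realType) (J : open_interval R) (X : tvsType R[i]).

Notation A := (Cinf J X).
Notation Rg := (Cinf J (R[i]^o)).
Notation Aplus := (Cinf J X * Cinf J (R[i]^o))%type.

(* The pair (a, g) stands for a + g e. *)
Definition unit_e : Aplus := (0, constant_smooth (@interval_open R J) (1 : R[i]^o)).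

Definition act_plus (f : Rg) (a0 : Aplus) : Aplus := (act f a0.1, act f a0.2).

Definition update n (x : 'I_n -> A) (i : 'I_n) (u : A) : 'I_n -> A :=
  fun k => if k == i then u else x k.

(* Maps out of A_+ x A^n that factor through C_n(A). The last clause encodes
   C_0(A) = A, instead of A_+. *)
Definition balanced_form n (Z : tvsType R[i]) (beta : Aplus -> ('I_n -> A) -> Z)
    : Prop :=
  [/\ continuous (fun z : Aplus * {ptws 'I_n -> A} => beta z.1 z.2),
      forall x, linear (fun a0 => beta a0 x),
      forall a0 x i, linear (fun u => beta a0 (update x i u)),
      forall a0 x i f, beta (act_plus f a0) x = beta a0 (update x i (act f (x i)))
    & n = 0%N -> forall g x, beta (0, g) x = 0].

(* C_n(A): the completed projective tensor product A_+ (x)_R A (x)_R ... (x)_R A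
   over R = C^oo(J), given by its universal property among complete Hausdorff
   locally convex spaces. The universal maps are only C-linear, because
   connections are not R-linear. *)
Record tensor_power (n : nat) := TensorPower {
  tensor_space :> tvsType R[i];
  tensor_complete : complete_tvs tensor_space;
  tensor_hausdorff : hausdorff_space tensor_space;
  pure_tensor : Aplus -> ('I_n -> A) -> tensor_space;
  pure_tensor_form : balanced_form pure_tensor;
  tensor_universal : forall (Z : tvsType R[i]) (beta : Aplus -> ('I_n -> A) -> Z),
    complete_tvs Z -> hausdorff_space Z -> balanced_form beta ->
    exists! g : tensor_space -> Z,
      [/\ linear g, continuous g & forall a0 x, g (pure_tensor a0 x) = beta a0 x]
}.

Variable D : deformation J X.

Definition lmul_plus (a0 : Aplus) (x : A) : A := mulJ D a0.1 x + act a0.2 x.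
Definition rmul_plus (x : A) (a0 : Aplus) : A := mulJ D x a0.1 + act a0.2 x.

Variable C : forall n, tensor_power n.

Definition tensor n (a0 : Aplus) (s : seq A) : C n :=
  pure_tensor (C n) a0 (fun i => nth 0 s i).

Definition sgn (k : nat) : R[i] := (-1) ^+ k.

(* The structure maps of the complex are the continuous linear maps with the
   stated values on the elementary tensors a0 (x) s_0 (x) ... (x) s_(n-1), so
   that the factor a_j with j > 0 is [nth 0 s j.-1]. Since B kills e (x) ...,
   only the component in A of a0 matters in [op_BE]; likewise in [op_SE]. *)
Record cyclic_operators := CyclicOperators {
  op_b : forall n, C n.+1 -> C n;
  op_b_linear : forall n, linear (@op_b n);
  op_b_continuous : forall n, continuous (@op_b n);
  op_bE : forall n (a0 : Aplus) (s : seq A), size s = n.+1 ->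
    op_b (tensor n.+1 a0 s) =
      tensor n (lmul_plus a0 (nth 0 s 0), 0) (drop 1 s)
      + \sum_(1 <= j < n.+1) sgn j *:
          tensor n a0 (take j.-1 s ++ mulJ D (nth 0 s j.-1) (nth 0 s j) :: drop j.+1 s)
      + sgn n.+1 *: tensor n (rmul_plus (nth 0 s n) a0, 0) (take n s);
  op_B : forall n, C n -> C n.+1;
  op_B_linear : forall n, linear (@op_B n);
  op_B_continuous : forall n, continuous (@op_B n);
  op_BE : forall n (a0 : Aplus) (s : seq A), size s = n ->
    op_B (tensor n a0 s) =
      \sum_(0 <= j < n.+1) sgn (j * n) *: tensor n.+1 unit_e (rot j (a0.1 :: s))
}.

Record connection := Connection {
  nabla :> A -> A;
  nabla_linear : linear nabla;
  nabla_continuous : continuous nabla;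
  nabla_leibniz : forall f a, nabla (act f a) = act (ddt f) a + act f (nabla a)
}.

(* nabla e = 0, hence nabla (g e) = g' e. *)
Definition nabla_plus (N : connection) (a0 : Aplus) : Aplus := (N a0.1, ddt a0.2).

Definition conn_defect (N : connection) (x y : A) : A :=
  mulJ D (N x) y + mulJ D x (N y) - N (mulJ D x y).

Record gauss_manin_operators (N : connection) := GaussManinOperators {
  op_L : forall n, C n -> C n;
  op_L_linear : forall n, linear (@op_L n);
  op_L_continuous : forall n, continuous (@op_L n);
  op_LE : forall n (a0 : Aplus) (s : seq A), size s = n ->
    op_L (tensor n a0 s) =
      tensor n (nabla_plus N a0) s
      + \sum_(0 <= i < n) tensor n a0 (set_nth 0 s i (N (nth 0 s i)));
  op_iota : forall n, C n.+2 -> C n;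
  op_iota_linear : forall n, linear (@op_iota n);
  op_iota_continuous : forall n, continuous (@op_iota n);
  op_iotaE : forall n (a0 : Aplus) (s : seq A), size s = n.+2 ->
    op_iota (tensor n.+2 a0 s) =
      - tensor n (lmul_plus a0 (conn_defect N (nth 0 s 0) (nth 0 s 1)), 0) (drop 2 s);
  op_S : forall n, C n -> C n;
  op_S_linear : forall n, linear (@op_S n);
  op_S_continuous : forall n, continuous (@op_S n);
  op_SE : forall n (a0 : Aplus) (s : seq A), size s = n ->
    let a := a0.1 :: s in
    op_S (tensor n a0 s) =
      \sum_(1 <= i < n) \sum_(0 <= j < n - i) sgn (i + j * n.-1) *:
        tensor n unit_e
          (drop (n - j).+1 a ++ take i a
           ++ conn_defect N (nth 0 a i) (nth 0 a i.+1) :: drop i.+2 (take (n - j).+1 a))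
}.

(* The product of all C_n: the even part is C_per,0 and the odd part C_per,1. *)
Definition chain := forall n, C n.

Definition has_parity (p : bool) (c : chain) : Prop :=
  forall n, odd n != p -> c n = 0.

Variable Q : cyclic_operators.

Definition bB (c : chain) : chain := fun n =>
  op_b Q (c n.+1) + (if n is m.+1 return C n then op_B Q (c m) else 0).

Definition HP_cycle (c : chain) : Prop := forall n, bB c n = 0.

(* c has class zero in HP_p. *)
Definition HP_zero (p : bool) (c : chain) : Prop :=
  exists2 h : chain, has_parity (~~ p) h & forall n, bB h n = c n.

Definition nabla_GM (N : connection) (G : gauss_manin_operators N) (c : chain)
    : chain := fun n =>
  op_L G (c n) - (op_iota G (c n.+2) + op_S G (c n)).

Definition matrix_mul N (P P' : 'M[A]_N) : 'M[A]_N :=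
  \matrix_(i, j) \sum_(k < N) mulJ D (P i k) (P' k j).

(* The generalized trace of (M0 + g e) (x) M_1 (x) ... (x) M_n, with e read as
   the identity matrix times e: in terms of matrix entries, the sum over
   i_0, ..., i_n of (M0)_(i_0 i_1) (x) (M_1)_(i_1 i_2) (x) ... (x) (M_n)_(i_n i_0). *)
Definition trace_tensor N n (M0 : 'M[A]_N) (g : Rg) (M : seq 'M[A]_N) : C n :=
  \sum_(i : {ffun 'I_n.+1 -> 'I_N})
    pure_tensor (C n)
      (M0 (i ord0) (i (ordS ord0)), if i ord0 == i (ordS ord0) then g else 0)
      (fun k : 'I_n =>
         nth 0 M k (i (lift ord0 k)) (i (ordS (lift ord0 k)))).

Definition ch_idempotent N (P : 'M[A]_N) : chain := fun n =>
  if odd n then 0 else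
  if n == 0%N then trace_tensor n P 0 [::] else
  (sgn n./2 * (n`!%:R / n./2`!%:R)) *:
    (trace_tensor n P 0 (nseq n P) - 2^-1 *: trace_tensor n 0 unit_e.2 (nseq n P)).

(* V is the inverse of U. *)
Definition ch_invertible N (U V : 'M[A]_N) : chain := fun n =>
  if odd n then
    (sgn n./2 * n./2`!%:R) *:
      trace_tensor n V 0 (mkseq (fun k => if odd k then V else U) n)
  else 0.

Definition is_unit (one : A) : Prop :=
  forall a, mulJ D one a = a /\ mulJ D a one = a.

Definition matrix_one N (one : A) : 'M[A]_N :=
  \matrix_(i, j) (if i == j then one else 0).

(* The closed span of the elementary tensors with a factor 1 in a positive
   position, or with first factor 1 - e (in positive degree). *)
Inductive degenerate_generator (one : A) (n : nat) : C n -> Prop :=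
  | Degenerate_inner a0 s : size s = n -> one \in s ->
      degenerate_generator one (tensor n a0 s)
  | Degenerate_first s : size s = n -> (0 < n)%N ->
      degenerate_generator one (tensor n ((one, 0) - unit_e) s).

Definition degenerate (one : A) (n : nat) : set (C n) :=
  closure [set z | exists (m : nat) (c : 'I_m -> R[i]) (g : 'I_m -> C n),
    (forall i, degenerate_generator one (g i)) /\ z = \sum_(i < m) c i *: g i].

(* For unital A the degenerate chains form a contractible subcomplex, so HP(A)
   is also the homology of the quotient by it (the normalized complex, where e
   is identified with 1). The character of an invertible is a cycle only there:
   already the degree 2 component of (b + B)(ch U) contains U^-1 (x) 1 (x) U.
   [represents one p c z] says that the class of z in HP_p(A) is the one whose
   image in the homology of the normalized complex is the class of c. *)
Definition represents (one : A) (p : bool) (c z : chain) : Prop :=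
  [/\ has_parity p z, HP_cycle z
    & exists2 h : chain, has_parity (~~ p) h
        & forall n, degenerate one (z n - c n - bB h n)].

End PeriodicCyclic.

(* Main.v *)
Require Import Defs.
From HB Require Import structures.
From mathcomp Require Import all_boot all_order all_algebra.
From mathcomp Require Import complex.
From mathcomp Require Import all_classical all_reals all_analysis.
From mathcomp Require Import zify ring.
Import Order.TTheory GRing.Theory Num.Theory.
Import numFieldNormedType.Exports.
Local Open Scope classical_set_scope.
Local Open Scope ring_scope.
Local Open Scope complex_scope.
Set Implicit Arguments.
Unset Strict Implicit.
Unset Printing Implicit Defensive.

(* By definition C_n(A) is a balanced quotient of A^(n+1) (+) A^n, the second
   summand being e (x) A^n. Over the ground field C, where nabla is linear, the
   Cartan homotopy formula holds for the operator nabla on the Hochschild complex: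
   contraction and suspension with nabla (instead of the cocycle E) give J_nabla
   with [b + B, J_nabla] = L_nabla - I_E. J_nabla does not descend to C_per(A),
   since nabla is not C^oo(J)-linear, but it does act on finite formal sums of
   words in fixed letters. Hence the class of a cycle whose cyclic relations hold
   already at the level of words, over C, is flat. This applies to ch P, with words
   in the single letter P over M_N(A). It applies to an odd cycle representing
   ch U, with words in x = U - 1 and y = U^-1 - 1, where x y = y x = - (x + y), and
   with components
   (-1)^n n! (y (x) x (x) ... (x) y (x) x + e (x) x (x) y (x) ... (x) x).
   Any two odd cycles representing ch U are homologous, because the degenerate
   complex is b-acyclic (insert 1 at a fixed position), and nabla_GM commutes with
   b + B. *)

(** * Words *)

(** The operators on words are replaced by their transposes, which act on functionals from words to
    arbitrary modules. A formal cycle is one whose relations are seen by every functional additive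
    in each letter. Such functionals are stable under contraction and suspension with nabla, so
    J_nabla can be fed to the cycle relations although it does not descend to C_n(A). By degree,
    [b + B, J_nabla] = L_nabla - I_E splits into [b, contraction] = - iota_E, [b, suspension] +
    [B, contraction] = L_nabla - S_E and [B, suspension] = 0. Since (b + B)^2 = 0, the right side
    commutes with b + B on words; this relation involves only maps that descend, which is why
    nabla_GM is a chain map. The letters x and y replace U and U^-1 because U^-1 U = 1 brings in a
    further letter 1, whereas x y = - (x + y) stays in the span of the letters and makes the sums of
    faces telescope. *)

Lemma sign_parity (S : nzRingType) m n : odd m = odd n -> (-1) ^+ m = (-1) ^+ n :> S.
Proof. by move=> mn; rewrite -signr_odd mn signr_odd. Qed.

Section WordOperations.
Variables (T : Type) (x0 : T).
Implicit Types (w : seq T) (op : T -> T -> T) (f : T -> T).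

Definition upd w p a := take p w ++ a :: drop p.+1 w.
Definition apply_at f p w := upd w p (f (nth x0 w p)).
Definition join_at op q w :=
  take q w ++ op (nth x0 w q) (nth x0 w q.+1) :: drop q.+2 w.

Lemma size_upd w p a : (p < size w)%N -> size (upd w p a) = size w.
Proof. by move=> pw; rewrite size_cat size_takel /= ?size_drop; lia. Qed.

Lemma size_apply_at f p w : (p < size w)%N -> size (apply_at f p w) = size w.
Proof. exact: size_upd. Qed.

Lemma size_join_at op q w : (q.+1 < size w)%N -> size (join_at op q w) = (size w).-1.
Proof. by move=> qw; rewrite size_cat size_takel /= ?size_drop; lia. Qed.

Lemma nth_upd w p a i : (p < size w)%N ->
  nth x0 (upd w p a) i = if i == p then a else nth x0 w i.
Proof.
move=> pw; rewrite nth_cat (size_takel (ltnW pw)).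
case: ltngtP => [ip|ip|->]; first by rewrite nth_take.
  have -> : (i - p = (i - p.+1).+1)%N by lia.
  by rewrite /= nth_drop; congr nth; lia.
by rewrite subnn.
Qed.

Lemma nth_apply_at f p w i : (p < size w)%N ->
  nth x0 (apply_at f p w) i = if i == p then f (nth x0 w p) else nth x0 w i.
Proof. exact: nth_upd. Qed.

Lemma nth_join_at op q w i : (q.+1 < size w)%N ->
  nth x0 (join_at op q w) i =
  if (i < q)%N then nth x0 w i
  else if i == q then op (nth x0 w q) (nth x0 w q.+1) else nth x0 w i.+1.
Proof.
move=> qw; rewrite nth_cat (size_takel (ltnW (ltnW qw))).
case: ltngtP => [iq|iq|->]; first by rewrite nth_take.
  have -> : (i - q = (i - q.+1).+1)%N by lia.
  by rewrite /= nth_drop; congr nth; lia.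
by rewrite subnn.
Qed.

Lemma nth_rotr w j i : (j <= size w)%N -> (i < size w)%N ->
  nth x0 (rotr j w) i =
  if (i < j)%N then nth x0 w (size w - j + i) else nth x0 w (i - j).
Proof.
move=> jw iw; rewrite /rotr /rot nth_cat size_drop.
have -> : (size w - (size w - j))%N = j by lia.
case: ltnP => ij; first by rewrite nth_drop.
by rewrite nth_take//; lia.
Qed.

Lemma size_upd_id w p : (p < size w)%N -> upd w p (nth x0 w p) = w.
Proof. by move=> pw; rewrite /upd -drop_nth// cat_take_drop. Qed.
End WordOperations.

Ltac word_size :=
  first [ lia | rewrite (size_rotr, size_upd, size_apply_at, size_join_at); word_size ].

(** Compares two words letter by letter: every operation becomes a case distinction on the position,
    and [lia] decides the cases. *)
Ltac word_eq x0 :=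
  apply: (@eq_from_nth _ x0);
  [ word_size
  | let i := fresh "i" in move=> i;
    rewrite ?(size_rotr, size_upd, size_apply_at, size_join_at); try word_size;
    let iw := fresh "iw" in move=> iw;
    repeat first
      [ rewrite nth_upd; try word_size; []
      | rewrite nth_apply_at; try word_size; []
      | rewrite nth_join_at; try word_size; []
      | rewrite nth_rotr; try word_size; []
      | rewrite (size_rotr, size_upd, size_apply_at, size_join_at); try word_size; []
      | case: ifP => ?; try lia ];
    try solve [ repeat (f_equal; try lia) | reflexivity ] ].

(** * Commutation rules for rotations, faces and letterwise maps *)

Section Relations.
Variables (T : Type) (x0 : T) (mul : T -> T -> T) (F : T -> T).
Hypothesis mulA : associative mul.
Implicit Types (w : seq T) (op : T -> T -> T).

Notation join_at := (join_at x0).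
Notation mulat := (join_at mul).
Notation Fat := (apply_at x0 F).

Lemma rotr_join_at op j q w : (j + q.+1 < size w)%N ->
  rotr j (join_at op q w) = join_at op (q + j) (rotr j w).
Proof. by move=> jqw; word_eq x0. Qed.

(** The joined pair wraps to the front. There it still counts as two letters, so the word before
    joining turns by one step more. *)
Lemma rotr_join_at_wrap op j q w : (q.+1 < size w)%N -> (j <= (size w).-1)%N ->
  (size w <= j + q.+1)%N ->
  rotr j (join_at op q w) = join_at op (q + j - (size w).-1) (rotr j.+1 w).
Proof. by move=> qw jw jqw; word_eq x0. Qed.

Lemma rotrS j w : (j < size w)%N -> rotr j (rotr 1 w) = rotr j.+1 w.
Proof. by move=> jw; word_eq x0. Qed.

Lemma rotrSr j w : (j < size w)%N -> rotr 1 (rotr j w) = rotr j.+1 w.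
Proof. by move=> jw; word_eq x0. Qed.

Lemma rotr_upd j p w a : (j + p < size w)%N ->
  rotr j (upd w p a) = upd (rotr j w) (p + j) a.
Proof. by move=> jw; word_eq x0. Qed.

Lemma rotr_upd_wrap j p w a : (p < size w)%N -> (j <= size w)%N ->
  (size w <= j + p)%N -> rotr j (upd w p a) = upd (rotr j w) (p + j - size w) a.
Proof. by move=> pw jw jp; word_eq x0. Qed.

Lemma rotr_apply_at j p w : (j + p < size w)%N ->
  rotr j (Fat p w) = Fat (p + j) (rotr j w).
Proof. by move=> jw; word_eq x0. Qed.

Lemma rotr1_apply_at_last w : (0 < size w)%N ->
  rotr 1 (Fat (size w).-1 w) = Fat 0 (rotr 1 w).
Proof. by move=> jw; word_eq x0; rewrite /= addn0 subn1. Qed.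

Lemma apply_join_at_lt op p q w : (p < q)%N -> (q.+1 < size w)%N ->
  Fat p (join_at op q w) = join_at op q (Fat p w).
Proof. by move=> pq qw; word_eq x0. Qed.

Lemma apply_join_at_gt op p q w : (q < p)%N -> (p.+1 < size w)%N ->
  Fat p (join_at op q w) = join_at op q (Fat p.+1 w).
Proof. by move=> pq qw; word_eq x0. Qed.

Lemma join_at_upd_lt op p q w a : (p < q)%N -> (q.+1 < size w)%N ->
  join_at op q (upd w p a) = upd (join_at op q w) p a.
Proof. by move=> pq qw; word_eq x0. Qed.

Lemma join_at_upd_gt op p q w a : (q.+1 < p)%N -> (p < size w)%N ->
  join_at op q (upd w p a) = upd (join_at op q w) p.-1 a.
Proof. by move=> pq qw; word_eq x0. Qed.

Lemma join_at_updl op q w a : (q.+1 < size w)%N ->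
  join_at op q (upd w q a) = upd (join_at op q w) q (op a (nth x0 w q.+1)).
Proof. by move=> qw; word_eq x0. Qed.

Lemma join_at_updr op q w a : (q.+1 < size w)%N ->
  join_at op q (upd w q.+1 a) = upd (join_at op q w) q (op (nth x0 w q) a).
Proof. by move=> qw; word_eq x0. Qed.

Lemma apply_at_upd_neq p q w a : p <> q -> (p < size w)%N -> (q < size w)%N ->
  Fat q (upd w p a) = upd (Fat q w) p a.
Proof. by move=> pq pw qw; word_eq x0. Qed.

Lemma apply_at_upd_eq p w a : (p < size w)%N -> Fat p (upd w p a) = upd w p (F a).
Proof. by move=> pw; word_eq x0. Qed.

(** Two joins at the same place differ in one letter. For the defect, a sum of three letters, this
    lets additivity expand the join. *)
Lemma join_at_joinE op op' q w : (q.+1 < size w)%N ->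
  join_at op q w = upd (join_at op' q w) q (op (nth x0 w q) (nth x0 w q.+1)).
Proof. by move=> qw; word_eq x0. Qed.

(** The simplicial identity for faces; associativity enters when the two joins share a letter. *)
Lemma mulat_comm i j w : (i < j)%N -> (j.+1 < size w)%N ->
  mulat i (mulat j w) = mulat j.-1 (mulat i w).
Proof.
move=> ij jw; word_eq x0.
have -> : j = i.+1 by lia.
by rewrite mulA.
Qed.
End Relations.

(** The usual cancellation behind d d = 0: (i, j) with j < i is matched with (j, i - 1), which
    carries the opposite sign. *)
Lemma simplicial_sum0 (S : nzRingType) (V : lmodType S) n (X : nat -> nat -> V) :
  (forall i j, (j < i)%N -> (i <= n)%N -> X i j = X j i.-1) ->
  \sum_(0 <= i < n.+1) \sum_(0 <= j < n) (-1) ^+ (i + j) *: X i j = 0.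
Proof.
move=> XE; pose Y i j : V := (-1) ^+ (i + j) *: X i j.
have -> : \sum_(0 <= i < n.+1) \sum_(0 <= j < n) (-1) ^+ (i + j) *: X i j =
    \sum_(0 <= i < n.+1) \sum_(0 <= j < n) (if (j < i)%N then Y i j else 0)
  + \sum_(0 <= i < n.+1) \sum_(0 <= j < n) (if (j < i)%N then 0 else Y i j).
  rewrite -big_split; apply: eq_bigr => i _; rewrite -big_split.
  by apply: eq_bigr => j _ /=; case: ifP; rewrite ?addr0 ?add0r.
rewrite big_nat_recl//= big1_eq add0r.
rewrite [X in _ + X]big_nat_recr//= [X in _ + (_ + X)]big1_seq ?addr0; last first.
  by move=> j /=; rewrite mem_index_iota => /andP[_ ->].
rewrite [X in _ + X]exchange_big /= -big_split big1_seq// => i /=.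
rewrite mem_index_iota => /andP[_ iN]; rewrite -big_split big1_seq// => j /=.
rewrite mem_index_iota ltnS => /andP[_ jN]; rewrite leqNgt ltnNge.
case: leqP => ij /=; last by rewrite addr0.
by rewrite /Y addSn exprS mulN1r scaleNr XE//= addnC addNr.
Qed.

Lemma big_nat_shift (V : zmodType) m n (f : nat -> V) :
  \sum_(m <= i < n) f i = \sum_(0 <= i < n - m) f (i + m)%N.
Proof. by rewrite -{1}[m]add0n big_addn. Qed.

Ltac sign_eq := apply: sign_parity; rewrite ?(oddD, oddM) /= ?(oddD, oddM) /=;
  repeat match goal with |- context [odd ?n] => case: (odd n) end; done.

Lemma rotr_full (T : Type) (w : seq T) : rotr (size w) w = w.
Proof. by rewrite /rotr subnn rot0. Qed.

Lemma rotr0 (T : Type) (w : seq T) : rotr 0 w = w.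
Proof. by rewrite /rotr subn0 rot_size. Qed.

(** * Cyclic operators on functionals of words *)

Section Functionals.
Variables (S : nzRingType) (K : zmodType) (mul : K -> K -> K) (F : K -> K).
Hypothesis mulA : associative mul.
Hypothesis mulDl : forall a b c, mul (a + b) c = mul a c + mul b c.
Hypothesis mulDr : forall a b c, mul a (b + c) = mul a b + mul a c.
Variable V : lmodType S.
Implicit Types (w : seq K) (phi psi : seq K -> V) (n : nat).

(* The operators act on words and are written as operations on functionals by
   precomposition. [hoch] and [bar] are b and b' (b on words starting with e),
   [cyc] and [norm] are t and N, [lie] is L_F, [contr], [contr0] and [susp] are
   the contraction and the suspension with F, and [contrE], [contrE0], [suspE]
   those with the defect of the Leibniz rule. *)
Definition defect a b := mul (F a) b + mul a (F b) - F (mul a b).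

Notation sg k := ((-1) ^+ k : S).
Notation mulat := (join_at 0 mul).
Notation Fat := (apply_at 0 F).
Notation Eat := (join_at 0 defect).

Definition cyc phi w := sg (size w).-1 *: phi (rotr 1 w).
Definition norm phi w :=
  \sum_(0 <= j < size w) sg (j * (size w).-1) *: phi (rotr j w).
Definition bar phi w := \sum_(0 <= q < (size w).-1) sg q *: phi (mulat q w).
Definition hoch phi w :=
  bar phi w +
  (if (1 < size w)%N then sg (size w).-1 *: phi (mulat 0 (rotr 1 w)) else 0).
Definition lie phi w := \sum_(0 <= p < size w) phi (Fat p w).
Definition contr phi w := if (1 < size w)%N then phi (mulat 0 (Fat 1 w)) else 0.
Definition contr0 phi w := if (0 < size w)%N then phi (Fat 0 w) else 0.
Definition susp phi w :=
  \sum_(0 <= j < size w) \sum_(j.+1 <= p < size w)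
     sg (j * (size w).-1) *: phi (Fat p (rotr j w)).
Definition contrE phi w := if (2 < size w)%N then phi (mulat 0 (Eat 1 w)) else 0.
Definition contrE0 phi w := if (1 < size w)%N then phi (Eat 0 w) else 0.
Definition suspE phi w :=
  \sum_(0 <= j < (size w).-1) \sum_(j.+1 <= r < (size w).-1)
     sg (r + j * (size w).-1) *: phi (Eat r (rotr j w)).

Definition multiadditive n phi := forall w p a b, size w = n -> (p < n)%N ->
  phi (upd w p (a + b)) = phi (upd w p a) + phi (upd w p b).

Lemma bar_nat n phi w : size w = n.+1 ->
  bar phi w = \sum_(0 <= q < n) sg q *: phi (mulat q w).
Proof. by rewrite /bar => ->. Qed.

Lemma bar_bar phi w : bar (bar phi) w = 0.
Proof.
case wn: (size w) => [|[|n]]; try by rewrite /bar wn big_geq.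
rewrite (bar_nat _ wn).
transitivity (\sum_(0 <= i < n.+1) \sum_(0 <= j < n)
    sg (i + j) *: phi (mulat j (mulat i w))).
  apply: eq_big_nat => i /= iN; rewrite (@bar_nat n); last by rewrite size_join_at wn.
  by rewrite scaler_sumr; apply: eq_bigr => j _; rewrite scalerA -exprD.
apply: (simplicial_sum0 (X := fun i j => phi (mulat j (mulat i w)))) => i j ji iN.
by rewrite mulat_comm// wn; lia.
Qed.

(** Numbering the cyclic face last turns b into an alternating sum of faces, to which
    [simplicial_sum0] applies. *)
Let face i w := if (i < (size w).-1)%N then mulat i w else mulat 0 (rotr 1 w).

Lemma hoch_faces n phi w : size w = n.+2 ->
  hoch phi w = \sum_(0 <= i < n.+2) sg i *: phi (face i w).
Proof.
move=> wn; rewrite /hoch /bar wn /= [RHS]big_nat_recr//= {2}/face wn/= ltnn.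
by congr (_ + _); apply: eq_big_nat => i /= iN; rewrite /face wn /= iN.
Qed.

Lemma size_face n i w : size w = n.+2 -> size (face i w) = n.+1.
Proof.
by move=> wn; rewrite /face; case: ifP => iw; rewrite size_join_at ?size_rotr ?wn; lia.
Qed.

Lemma hoch_small phi w : (size w <= 1)%N -> hoch phi w = 0.
Proof.
move=> w1; rewrite /hoch ifF; last by apply/negbTE; rewrite -leqNgt.
by rewrite addr0 /bar big_geq// -ltnS; case: (size w) w1.
Qed.

Lemma hoch_hoch phi w : hoch (hoch phi) w = 0.
Proof.
case: (ltnP (size w) 2) => w1; first by rewrite hoch_small.
case wn: (size w) w1 => [|[|[|n]]]// _.
  rewrite (hoch_faces _ wn) big1_seq// => i _.
  by rewrite hoch_small ?scaler0// (size_face _ wn).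
rewrite (hoch_faces _ wn).
transitivity (\sum_(0 <= i < n.+3) \sum_(0 <= j < n.+2)
    sg (i + j) *: phi (face j (face i w))).
  apply: eq_big_nat => i /= iN; rewrite (@hoch_faces n); last exact: size_face.
  by rewrite scaler_sumr; apply: eq_bigr => j _; rewrite scalerA -exprD.
apply: (simplicial_sum0 (X := fun i j => phi (face j (face i w)))) => i j ji iN.
congr phi; rewrite {1 3}/face !(size_face _ wn) /=.
have [iE|iN'] := eqVneq i n.+2.
  subst i; rewrite /face wn /= ltnn.
  have jn2 : (j < n.+2)%N by lia.
  rewrite jn2; case: ltnP => jn.
    rewrite ltnn rotr_join_at ?wn; last lia.
    by rewrite addn1 [RHS]mulat_comm// ?size_rotr ?wn; lia.
  (* Both faces on the left are cyclic: the last two letters and the first one are multiplied. *)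
  have -> : j = n.+1 by lia.
  rewrite ltnn rotr_join_at ?size_rotr ?wn//.
  rewrite rotr_join_at_wrap ?wn//= add0n addn1 ?wn subnn (rotrSr 0) ?wn//.
  by rewrite mulat_comm ?size_rotr ?wn.
have iN2 : (i < n.+2)%N by lia.
have jN1 : (j < n.+1)%N by lia.
have iN1 : (i.-1 < n.+1)%N by lia.
have jN2 : (j < n.+2)%N by lia.
by rewrite jN1 iN1 /face wn /= iN2 jN2 mulat_comm// wn; lia.
Qed.

(** The classical b (1 - t) = (1 - t) b', transposed. *)
Lemma hoch_cyc phi w : hoch phi w - cyc (hoch phi) w = bar phi w - bar (cyc phi) w.
Proof.
case wn: (size w) => [|[|n]].
- by rewrite /hoch /cyc /bar size_rotr wn !big_geq//= !addr0 scaler0.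
- by rewrite /hoch /cyc /bar size_rotr wn !big_geq//= !addr0 scaler0.
rewrite /hoch /cyc /bar !size_rotr wn /= -addrA; congr (_ + _).
rewrite big_nat_recl//= expr0 scale1r (rotrSr 0) ?wn// !scalerDr scalerA -exprD.
rewrite (@sign_parity _ (n.+1 + n.+1) 0) ?addnn ?odd_double// scale1r.
rewrite -[X in _ - X]addrA opprD addrA subrr sub0r; congr (- _).
rewrite big_nat_recr//= size_join_at ?wn//= rotr_join_at_wrap ?wn//=.
rewrite addn1 ?wn subnn scalerA -exprD.
rewrite (@sign_parity _ (n + n) 0) ?addnn ?odd_double// scale1r.
congr (_ + _); rewrite scaler_sumr; apply: eq_big_nat => i /= iN.
rewrite size_join_at ?wn/=; last lia.
rewrite rotr_join_at ?wn; last lia.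
rewrite addn1 !scalerA -!exprD; congr (_ *: _).
by apply: sign_parity; rewrite !oddD /=; case: (odd n); case: (odd i).
Qed.

Lemma norm_cyc phi w : norm (cyc phi) w = norm phi w.
Proof.
case wn: (size w) => [|n]; first by rewrite /norm wn !big_geq.
have rw : rotr n.+1 w = w by rewrite -wn rotr_full.
rewrite /norm /cyc wn big_nat_recr//= [RHS]big_nat_recl//= addrC; congr (_ + _).
  rewrite size_rotr (rotrSr 0) ?wn// rw rotr0 scalerA -exprD.
  by congr (_ *: _); sign_eq.
apply: eq_big_nat => j /= jn; rewrite size_rotr wn/= (rotrSr 0) ?wn//; last lia.
by rewrite scalerA -exprD mulSnr.
Qed.

Lemma cyc_norm phi w : cyc (norm phi) w = norm phi w.
Proof.
rewrite -[RHS]norm_cyc /norm /cyc size_rotr scaler_sumr.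
apply: eq_big_nat => j /= jn.
by rewrite size_rotr !scalerA -!exprD addnC (rotrS 0)// (rotrSr 0).
Qed.

(** Composing with t takes the term (j, p) to (j + 1, p + 1), so the double sum telescopes to the
    row j = 0, less the terms whose marked letter wraps round to position 0. Those terms are
    restored by [norm (contr0 phi)]. *)
Lemma homotopy_xx phi w :
  susp phi w - susp (cyc phi) w + norm (contr0 phi) w = lie phi w.
Proof.
case wn: (size w) => [|n].
  by rewrite /susp /norm /lie wn !big_geq// subr0 addr0.
pose X j p : V := sg (j * n) *: phi (Fat p (rotr j w)).
have -> : susp phi w = \sum_(0 <= p < n) X 0%N p.+1
    + \sum_(0 <= j < n) \sum_(j.+2 <= p < n.+1) X j.+1 p.
  by rewrite /susp wn /= big_nat_recl//= big_add1.
have -> : susp (cyc phi) w = \sum_(0 <= j < n) \sum_(j.+2 <= p < n.+1) X j.+1 p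
    + \sum_(0 <= j < n) X j.+1 0%N.
  rewrite /susp wn /= big_nat_recr//= [X in _ + X]big_geq// addr0 -big_split.
  apply: eq_big_nat => j /= jn; rewrite [LHS]big_nat_recr//= [X in _ = X + _]big_add1/=.
  congr (_ + _).
    apply: eq_big_nat => p /andP[jp pn]; rewrite /cyc size_apply_at ?size_rotr ?wn//; last lia.
    rewrite rotr_apply_at ?size_rotr ?wn; last lia.
    rewrite (rotrSr 0) ?wn; last lia.
    by rewrite addn1 scalerA -exprD /X mulSnr.
  rewrite /cyc size_apply_at ?size_rotr ?wn//.
  have -> : n = (size (rotr j w)).-1 by rewrite size_rotr wn.
  rewrite rotr1_apply_at_last ?size_rotr ?wn//= (rotrSr 0) ?wn; last lia.
  by rewrite scalerA -exprD /X mulSnr.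
have -> : norm (contr0 phi) w = X 0%N 0%N + \sum_(0 <= j < n) X j.+1 0%N.
  rewrite /norm wn big_nat_recl//= /contr0 !size_rotr wn /=; congr (_ + _).
  by apply: eq_bigr => j _; rewrite size_rotr wn.
have -> : lie phi w = X 0%N 0%N + \sum_(0 <= p < n) X 0%N p.+1.
  rewrite /lie wn big_nat_recl//= /X mul0n expr0 scale1r rotr0; congr (_ + _).
  by apply: eq_bigr => p _; rewrite scale1r.
by rewrite addrKA [X in _ + X = _]addrC subrKA addrC.
Qed.

(** Rotating first takes (j, p) to (j + 1, p), which adds the diagonal p = j to the range of the
    suspension; [contr0 (norm phi)] consists of the diagonal terms. *)
Lemma homotopy_yy phi w :
  contr0 (norm phi) w + (susp phi w - cyc (susp phi) w) = lie phi w.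
Proof.
case wn: (size w) => [|n].
  by rewrite /susp /cyc /contr0 /lie size_rotr wn !big_geq// scaler0 subr0 addr0.
pose X j p : V := sg (j * n) *: phi (Fat p (rotr j w)).
have -> : susp phi w = \sum_(0 <= p < n) X 0%N p.+1
    + \sum_(0 <= j < n) \sum_(j.+2 <= p < n.+1) X j.+1 p.
  by rewrite /susp wn /= big_nat_recl//= big_add1.
have -> : cyc (susp phi) w = \sum_(0 <= j < n) X j.+1 j.+1
    + \sum_(0 <= j < n) \sum_(j.+2 <= p < n.+1) X j.+1 p.
  rewrite /cyc /susp size_rotr wn /= big_nat_recr//= [X in _ + X]big_geq// addr0.
  rewrite scaler_sumr -big_split; apply: eq_big_nat => j /= jn.
  rewrite scaler_sumr [LHS]big_ltn; last lia.
  have XE p : sg n *: (sg (j * n) *: phi (Fat p (rotr j (rotr 1 w)))) = X j.+1 p.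
    by rewrite scalerA -exprD (rotrS 0) ?wn//; lia.
  by rewrite XE; congr (_ + _); apply: eq_bigr.
have -> : contr0 (norm phi) w = X 0%N 0%N + \sum_(0 <= j < n) X j.+1 j.+1.
  have XE j : (j < n.+1)%N -> sg (j * n) *: phi (rotr j (Fat 0 w)) = X j j.
    by move=> jn; rewrite rotr_apply_at ?wn// addn0.
  rewrite /contr0 wn /norm size_apply_at ?wn//= big_nat_recl//= XE//; congr (_ + _).
  by apply: eq_big_nat => j /= jn; apply: XE.
have -> : lie phi w = X 0%N 0%N + \sum_(0 <= p < n) X 0%N p.+1.
  rewrite /lie wn big_nat_recl//= /X mul0n expr0 scale1r rotr0; congr (_ + _).
  by apply: eq_bigr => p _; rewrite scale1r.
by rewrite [X in _ - X]addrC addrKA addrC [X in _ + X = _]addrC subrKA addrC.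
Qed.

Lemma multiadditive0 n phi w p : multiadditive n phi -> size w = n -> (p < n)%N ->
  phi (upd w p 0) = 0.
Proof.
move=> ma wn pn; have := ma w p 0 0 wn pn; rewrite addr0 => /eqP.
by rewrite -subr_eq subrr eq_sym => /eqP.
Qed.

Lemma multiadditiveN n phi w p a : multiadditive n phi -> size w = n -> (p < n)%N ->
  phi (upd w p (- a)) = - phi (upd w p a).
Proof.
move=> ma wn pn; apply/eqP; rewrite -addr_eq0 -ma// addNr.
by rewrite (multiadditive0 ma).
Qed.

Lemma multiadditive_join op q n phi :
  (forall a b c, op (a + b) c = op a c + op b c) ->
  (forall a b c, op a (b + c) = op a b + op a c) ->
  (q < n)%N -> multiadditive n phi ->
  multiadditive n.+1 (fun w => phi (join_at 0 op q w)).
Proof.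
move=> opl opr qn ma w p a b wn pn /=.
have sj : size (join_at 0 op q w) = n by rewrite size_join_at wn.
case: (ltngtP p q) => [pq|pq|->].
- by rewrite !join_at_upd_lt ?wn// ma//; lia.
- have [->|pq1] := eqVneq p q.+1.
    by rewrite !join_at_updr ?wn// opr ma.
  by rewrite !join_at_upd_gt ?wn// ?ma//; lia.
- by rewrite !join_at_updl ?wn// opl ma.
Qed.

Lemma multiadditive_rotr j n phi : (j <= n)%N -> multiadditive n phi ->
  multiadditive n (fun w => phi (rotr j w)).
Proof.
move=> jn ma w p a b wn pn /=; case: (ltnP (j + p) n) => jp.
  by rewrite !(rotr_upd 0) ?wn// ma ?size_rotr//; lia.
by rewrite !(rotr_upd_wrap 0) ?wn// ma ?size_rotr//; lia.
Qed.

Lemma multiadditive_apply f p n phi : (forall a b, f (a + b) = f a + f b) ->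
  (p < n)%N -> multiadditive n phi ->
  multiadditive n (fun w => phi (apply_at 0 f p w)).
Proof.
move=> fD pn ma w q a b wn qn /=; have [<-|/eqP pq] := eqVneq q p.
  by rewrite !apply_at_upd_eq ?wn// fD ma.
by rewrite !apply_at_upd_neq ?wn// ma ?size_apply_at ?wn.
Qed.

Lemma multiadditive_sum (I : Type) (r : seq I) (P : pred I) n (f : I -> seq K -> V) :
  (forall i, P i -> multiadditive n (f i)) ->
  multiadditive n (fun w => \sum_(i <- r | P i) f i w).
Proof.
move=> fP w p a b wn pn; rewrite -big_split; apply: eq_bigr => i Pi.
exact: fP.
Qed.

Lemma multiadditiveZ c n phi : multiadditive n phi ->
  multiadditive n (fun w => c *: phi w).
Proof. by move=> ma w p a b wn pn; rewrite ma// scalerDr. Qed.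

Lemma multiadditiveD n phi psi : multiadditive n phi -> multiadditive n psi ->
  multiadditive n (fun w => phi w + psi w).
Proof. by move=> ma mb w p a b wn pn; rewrite ma// mb// addrACA. Qed.

Lemma phi_defect n q phi w : multiadditive n phi -> size w = n.+1 -> (q < n)%N ->
  phi (Eat q w) =
  phi (mulat q (Fat q w)) + phi (mulat q (Fat q.+1 w)) - phi (Fat q (mulat q w)).
Proof.
move=> ma wn qn; rewrite (@join_at_joinE _ _ _ mul) ?wn//.
rewrite /apply_at join_at_updl ?join_at_updr ?wn//.
rewrite nth_join_at ?wn// ltnn eqxx.
by rewrite ma ?ma ?(multiadditiveN _ ma) ?size_join_at ?wn.
Qed.

(** The terms that do not cancel in pairs are (a_0 F(a_1)) a_2, (a_0 a_1) F(a_2) and - a_0 F(a_1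
    a_2), which add up to a_0 times the defect. *)
Lemma homotopy_contr n phi w : multiadditive n phi -> size w = n.+2 ->
  contr (hoch phi) w + hoch (contr phi) w = contrE phi w.
Proof.
move=> ma wn.
case: n ma wn => [|n] ma wn.
  rewrite /contr wn /hoch /bar /contrE wn /=.
  rewrite size_join_at ?size_apply_at ?wn//= big_geq// big_nat1 !size_join_at ?size_rotr ?wn//=.
  by rewrite !scaler0 !addr0.
have sF : size (Fat 1 w) = n.+3 by rewrite size_apply_at wn.
have -> : contr (hoch phi) w = \sum_(0 <= q < n.+1) sg q *: phi (mulat q (mulat 0 (Fat 1 w)))
   + sg n.+1 *: phi (mulat 0 (rotr 1 (mulat 0 (Fat 1 w)))).
  by rewrite /contr wn /= /hoch /bar size_join_at sF.
have -> : hoch (contr phi) w = \sum_(0 <= q < n.+2) sg q *: phi (mulat 0 (Fat 1 (mulat q w)))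
   + sg n.+2 *: phi (mulat 0 (Fat 1 (mulat 0 (rotr 1 w)))).
  rewrite /hoch /bar wn /= /contr size_join_at ?size_rotr ?wn//=; congr (_ + _).
  by apply: eq_big_nat => q /= qn; rewrite size_join_at wn.
rewrite addrACA [X in _ + X](_ : _ = 0) ?addr0; last first.
  rewrite rotr_join_at ?size_apply_at ?wn// rotr_apply_at ?wn// add0n addn1.
  rewrite apply_join_at_gt ?size_rotr ?wn// mulat_comm ?size_apply_at ?size_rotr ?wn//=.
  by rewrite [X in _ + X *: _]exprS mulN1r scaleNr subrr.
rewrite big_nat_recl//= [X in _ + X]big_nat_recl//= big_nat_recl//= !expr0 expr1 !scale1r.
have regroup (a s b c t : V) : a + s + (b + (c + t)) = a + b + c + (s + t).
  by rewrite addrACA (addrCA s) addrA.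
rewrite regroup [X in _ + X = _](_ : _ = 0) ?addr0; last first.
  rewrite -big_split big1_seq// => q /=; rewrite mem_index_iota => /andP[_ qn].
  rewrite apply_join_at_lt ?wn; try lia.
  rewrite [mulat 0 (mulat q.+2 _)]mulat_comm ?sF//=.
  by rewrite [X in _ + X *: _]exprS mulN1r scaleNr subrr.
rewrite /contrE wn /=.
have ma' := multiadditive_join mulDl mulDr (ltn0Sn n) ma.
rewrite (phi_defect ma')// scaleN1r apply_join_at_gt ?wn//.
rewrite [phi (mulat 0 (mulat 0 (Fat 1 w)))](_ : _ = phi (mulat 0 (mulat 1 (Fat 1 w)))); last first.
  by rewrite [in RHS]mulat_comm// sF.
rewrite [phi (mulat 0 (mulat 0 (Fat 2 w)))](_ : _ = phi (mulat 0 (mulat 1 (Fat 2 w)))); last first.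
  by rewrite [in RHS]mulat_comm// size_apply_at wn.
by [].
Qed.

(** The same cancellation on words e a_1 ... a_n, where the contraction absorbs e: what survives is
    F(a_1) a_2 + a_1 F(a_2) - F(a_1 a_2). *)
Lemma homotopy_contr0 n phi w : multiadditive n phi -> size w = n.+1 ->
  contr0 (hoch phi) w + (contr phi w - cyc (contr phi) w - bar (contr0 phi) w)
  = contrE0 phi w.
Proof.
move=> ma wn; case: n ma wn => [|n] ma wn.
  rewrite /contr0 /contr /hoch /bar /cyc /contrE0 size_rotr wn /= size_apply_at wn//=.
  by rewrite !big_geq// !scaler0 !subr0 !addr0.
have sF : size (Fat 0 w) = n.+2 by rewrite size_apply_at wn.
have -> : contr0 (hoch phi) w = \sum_(0 <= q < n.+1) sg q *: phi (mulat q (Fat 0 w))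
   + sg n.+1 *: phi (mulat 0 (rotr 1 (Fat 0 w))).
  by rewrite /contr0 wn /hoch /bar sF.
have -> : cyc (contr phi) w = sg n.+1 *: phi (mulat 0 (rotr 1 (Fat 0 w))).
  by rewrite /cyc /contr size_rotr wn /= rotr_apply_at ?wn// add0n.
have -> : bar (contr0 phi) w = \sum_(0 <= q < n.+1) sg q *: phi (Fat 0 (mulat q w)).
  rewrite /bar wn; apply: eq_big_nat => q /= qn.
  by rewrite /contr0 size_join_at wn.
have regroup (a s b c : V) : a + s + (b - s - c) = b + (a - c).
  by rewrite -(addrA b) -opprD addrCA addrKA.
rewrite regroup /contr wn /=.
rewrite -sumrB big_nat_recl//= big1_seq ?addr0; last first.
  move=> q /=; rewrite mem_index_iota => /andP[_ qn].
  by rewrite apply_join_at_lt ?subrr// wn; lia.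
rewrite expr0 !scale1r /contrE0 wn /= (phi_defect ma)//.
by rewrite addrA [X in X - _]addrC.
Qed.

(** A face followed by a rotation by j is a face of the word rotated by j if the joined pair stays
    before the end, and by j + 1 if it passes the end. [theta] depends on j because in the
    suspension the range of p does. *)
Lemma hoch_rot (phi : seq K -> V) (theta : nat -> seq K -> V) n w : size w = n.+1 ->
  (forall v, size v = n ->
     phi v = \sum_(0 <= j < n) sg (j * n.-1) *: theta j (rotr j v)) ->
  hoch phi w = \sum_(0 <= j < n)
    (\sum_(j <= r < n) sg (r + j * n) *: theta j (mulat r (rotr j w)) +
     \sum_(0 <= r < j.+1) sg (r + j.+1 * n) *: theta j (mulat r (rotr j.+1 w))).
Proof.
move=> wn phiE; case: n wn phiE => [|n] wn phiE.
  by rewrite /hoch /bar wn !big_geq// addr0.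
have hE : hoch phi w = \sum_(0 <= j < n.+1)
   (\sum_(0 <= q < n.+1) sg (q + j * n) *: theta j (rotr j (mulat q w))
    + sg (n.+1 + j * n) *: theta j (rotr j (mulat 0 (rotr 1 w)))).
  rewrite /hoch /bar wn big_split /=; congr (_ + _).
    rewrite exchange_big; apply: eq_big_nat => q /= qn.
    rewrite phiE ?size_join_at ?wn// scaler_sumr; apply: eq_bigr => j _.
    by rewrite scalerA -exprD.
  rewrite phiE ?size_join_at ?size_rotr ?wn// scaler_sumr; apply: eq_bigr => j _.
  by rewrite scalerA -exprD.
rewrite hE; apply: eq_big_nat => j /= jn.
rewrite (@big_cat_nat _ _ _ (n.+1 - j)) ?leq_subr//= -addrA; congr (_ + _).
  rewrite [RHS]big_nat_shift; apply: eq_big_nat => q /= qn.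
  rewrite rotr_join_at ?wn; last lia.
  by congr (_ *: _); sign_eq.
rewrite [RHS]big_nat_recr//=; congr (_ + _).
  rewrite big_nat_shift; have -> : (n.+1 - (n.+1 - j))%N = j by lia.
  apply: eq_big_nat => q /= qj.
  rewrite rotr_join_at_wrap ?wn//=; try lia.
  have -> : (q + (n.+1 - j) + j - n.+1)%N = q by lia.
  congr (_ *: _); have -> : (q + (n.+1 - j) + j * n = q + (n.+1 - j + j * n))%N by lia.
  apply: sign_parity; rewrite !oddD oddB ?oddM//=; last lia.
  by case: (odd q); case: (odd j); case: (odd n).
rewrite rotr_join_at ?size_rotr ?wn; last lia.
rewrite (rotrS 0) ?wn; last lia.
by rewrite add0n; congr (_ *: _); sign_eq.
Qed.

(** The classical b' N = N b, transposed. *)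
Lemma norm_bar phi w : norm (bar phi) w = hoch (norm phi) w.
Proof.
case wn: (size w) => [|n].
  by rewrite {1}/norm wn big_geq// /hoch /bar wn big_geq//= addr0.
rewrite (hoch_rot (theta := fun=> phi) wn); last by move=> v vn; rewrite /norm vn.
pose X j r : V := sg (r + j * n) *: phi (mulat r (rotr j w)).
transitivity (\sum_(0 <= j < n.+1) \sum_(0 <= r < n) X j r).
  rewrite /norm wn; apply: eq_bigr => j _; rewrite /bar size_rotr wn scaler_sumr.
  by apply: eq_bigr => r _; rewrite scalerA -exprD addnC.
have shift : \sum_(0 <= j < n) \sum_(0 <= r < j.+1) X j.+1 r
    = \sum_(1 <= j < n.+1) \sum_(0 <= r < j) X j r by rewrite big_add1.
rewrite big_split /= [X in _ + X]shift.
transitivity (\sum_(0 <= j < n.+1) (\sum_(j <= r < n) X j r + \sum_(0 <= r < j) X j r)).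
  apply: eq_big_nat => j /= jn; rewrite addrC -big_cat_nat//; lia.
rewrite big_split /=; congr (_ + _).
  by rewrite big_nat_recr//= [X in _ + X]big_geq// addr0.
by rewrite big_ltn// [X in X + _]big_geq// add0r.
Qed.

(** The one block of the homotopy formula in which faces meet F inside a rotated word; this produces
    the suspension with the defect. *)
Lemma homotopy_xy n phi w : multiadditive n phi -> size w = n.+1 ->
  contr (norm phi) w + hoch (susp phi) w - susp (bar phi) w = - suspE phi w.
Proof.
move=> ma wn.
(* [G] applies F before the face r and [H] after it. Up to a shift of p they agree, except that for
   p = r the map F hits the new product and the defect [E] appears. *)
pose G j p r : V := sg (r + j * n) *: phi (mulat r (Fat p (rotr j w))).
pose H j p r : V := sg (r + j * n) *: phi (Fat p (mulat r (rotr j w))).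
pose E j r : V := sg (r + j * n) *: phi (Eat r (rotr j w)).
have HG1 j p r : (p < r)%N -> (r < n)%N -> H j p r = G j p r.
  by move=> pr rn; rewrite /H apply_join_at_lt// size_rotr wn.
have HG2 j p r : (r < p)%N -> (p < n)%N -> H j p r = G j p.+1 r.
  by move=> pr rn; rewrite /H apply_join_at_gt// size_rotr wn.
have HG3 j r : (r < n)%N -> H j r r = G j r r + G j r.+1 r - E j r.
  move=> rn; rewrite /H /E (phi_defect ma) ?size_rotr// scalerBr scalerDr.
  by rewrite opprB addrC subrK.
have -> : contr (norm phi) w = \sum_(0 <= j < n) G j j.+1 j.
  rewrite /contr /norm wn; case: ltnP => n0; last by rewrite big_geq.
  rewrite size_join_at ?size_apply_at ?wn//=; apply: eq_big_nat => j /= jn.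
  rewrite rotr_join_at ?size_apply_at ?wn//; last lia.
  rewrite rotr_apply_at ?wn; last lia.
  by rewrite add0n add1n /G; congr (_ *: _); apply: sign_parity; rewrite !(oddD, oddM) -subn1 oddB//=; case: (odd j); case: (odd n).
have -> : susp (bar phi) w =
    \sum_(0 <= j < n.+1) \sum_(j.+1 <= p < n.+1) \sum_(0 <= r < n) G j p r.
  rewrite /susp wn; apply: eq_bigr => j _; apply: eq_big_nat => p /andP[_ pn].
  rewrite /bar size_apply_at size_rotr ?wn//= scaler_sumr; apply: eq_bigr => r _.
  by rewrite scalerA -exprD addnC.
have -> : suspE phi w = \sum_(0 <= j < n) \sum_(j.+1 <= r < n) E j r.
  by rewrite /suspE wn.
rewrite (hoch_rot (theta := fun j v => \sum_(j.+1 <= p < n) phi (Fat p v)) wn); last first.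
  by move=> v vn; rewrite /susp vn; apply: eq_bigr => j _; rewrite scaler_sumr.
have -> : \sum_(0 <= j < n)
    (\sum_(j <= r < n) sg (r + j * n) *: (\sum_(j.+1 <= p < n) phi (Fat p (mulat r (rotr j w)))) +
     \sum_(0 <= r < j.+1) sg (r + j.+1 * n) *:
       (\sum_(j.+1 <= p < n) phi (Fat p (mulat r (rotr j.+1 w))))) =
   \sum_(0 <= j < n) \sum_(j <= r < n) \sum_(j.+1 <= p < n) H j p r +
   \sum_(0 <= j < n) \sum_(0 <= r < j.+1) \sum_(j.+1 <= p < n) G j.+1 p.+1 r.
  rewrite -big_split; apply: eq_big_nat => j /= jn; congr (_ + _).
    by apply: eq_bigr => r _; rewrite scaler_sumr.
  apply: eq_big_nat => r /= rj; rewrite scaler_sumr; apply: eq_big_nat => p /andP[jp pn].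
  by rewrite -HG2//; lia.
(* The faces that passed the end are the terms r < j of [susp (bar phi)] and cancel with them. *)
have -> : \sum_(0 <= j < n) \sum_(0 <= r < j.+1) \sum_(j.+1 <= p < n) G j.+1 p.+1 r =
   \sum_(0 <= j < n) \sum_(j.+1 <= p < n.+1) \sum_(0 <= r < j) G j p r.
  case: (n) G {HG1 HG2 HG3} => [|m] G; first by rewrite !big_geq.
  rewrite [RHS]big_nat_recl//= [X in _ = X + _]big1 ?add0r; last first.
    by move=> p _; rewrite big_geq.
  rewrite big_nat_recr//= [X in _ + X]big1 ?addr0; last by move=> r _; rewrite big_geq.
  by apply: eq_bigr => j _; rewrite [RHS]big_add1 exchange_big.
rewrite big_nat_recr//= [X in _ - (_ + X)]big_geq// addr0.
rewrite -!(big_split, sumrB, sumrN) /=; apply: eq_big_nat => j /= jn.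
have -> : \sum_(j.+1 <= p < n.+1) \sum_(0 <= r < n) G j p r =
    \sum_(j.+1 <= p < n.+1) \sum_(0 <= r < j) G j p r +
    \sum_(j.+1 <= p < n.+1) \sum_(j <= r < n) G j p r.
  rewrite -big_split; apply: eq_bigr => p _ /=; rewrite -big_cat_nat//; lia.
rewrite addrA addrKA; apply/eqP; rewrite subr_eq; apply/eqP.
(* For r = j there is no defect, since p > j; the shift of p leaves out p = j + 1, which is the term
   from [contr (norm phi)]. *)
rewrite [X in _ = _ + X]exchange_big /= (big_ltn jn) [X in _ = _ + X](big_ltn jn).
rewrite addrA [RHS]addrCA; congr (_ + _).
  rewrite [RHS]big_ltn; last lia.
  congr (_ + _); rewrite [RHS]big_add1.
  by apply: eq_big_nat => p /andP[jp pn]; exact: HG2.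
(* For r > j the sum over p meets p = r once, and this gives the defect. *)
rewrite -sumrN -big_split; apply: eq_big_nat => r /andP[jr rn] /=.
rewrite (@big_cat_nat _ _ _ r)//=; last lia.
rewrite [X in _ + X]big_ltn// HG3//.
rewrite [in RHS](@big_cat_nat _ _ _ r)//=; try lia.
rewrite [X in _ = _ + (_ + X)]big_ltn; last lia.
rewrite [X in _ = _ + (_ + (_ + X))]big_ltn; last lia.
rewrite [X in _ = _ + (_ + (_ + (_ + X)))]big_add1 /=.
have -> : \sum_(j.+1 <= p < r) H j p r = \sum_(j.+1 <= p < r) G j p r.
  by apply: eq_big_nat => p /andP[jp pr]; exact: HG1.
have -> : \sum_(r.+1 <= p < n) H j p r = \sum_(r.+1 <= p < n) G j p.+1 r.
  by apply: eq_big_nat => p /andP[jp pr]; exact: HG2.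
rewrite [RHS]addrCA; congr (_ + _).
by rewrite [X in X + _ = _]addrC -!addrA.
Qed.
End Functionals.

Lemma subrBB (V : zmodType) (a b c d : V) : a - b - (c - d) = a - c - (b - d).
Proof. by rewrite !opprB [d - c]addrC addrACA [- b + d]addrC. Qed.

(** * The Cartan homotopy formula on words with and without e *)

Section FunctionalPairs.
Variables (S : nzRingType) (K : zmodType) (mul : K -> K -> K) (F : K -> K).
Hypothesis mulA : associative mul.
Hypothesis mulDl : forall a b c, mul (a + b) c = mul a c + mul b c.
Hypothesis mulDr : forall a b c, mul a (b + c) = mul a b + mul a c.
Hypothesis FD : forall a b, F (a + b) = F a + F b.

Section Operators.
Variable V : lmodType S.
Implicit Types (w : seq K) (phi psi : seq K -> V).

Lemma cyc_zmod : zmod_morphism (@cyc S K V).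
Proof. by move=> phi psi; apply/funext => w; rewrite /cyc !fctE scalerBr. Qed.

Lemma norm_zmod : zmod_morphism (@norm S K V).
Proof.
move=> phi psi; apply/funext => w; rewrite /norm !fctE -sumrB.
by apply: eq_bigr => j _; rewrite scalerBr.
Qed.

Lemma bar_zmod : zmod_morphism (@bar S K mul V).
Proof.
move=> phi psi; apply/funext => w; rewrite /bar !fctE -sumrB.
by apply: eq_bigr => j _; rewrite scalerBr.
Qed.

Lemma hoch_zmod : zmod_morphism (@hoch S K mul V).
Proof.
move=> phi psi; apply/funext => w; rewrite /hoch bar_zmod !fctE opprD addrACA.
by congr (_ + _); case: ifP; rewrite ?subr0// scalerBr.
Qed.

Lemma contr_zmod : zmod_morphism (@contr S K mul F V).
Proof.
by move=> phi psi; apply/funext => w; rewrite /contr !fctE; case: ifP; rewrite ?subr0.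
Qed.

Lemma contr0_zmod : zmod_morphism (@contr0 S K F V).
Proof.
by move=> phi psi; apply/funext => w; rewrite /contr0 !fctE; case: ifP; rewrite ?subr0.
Qed.

Lemma susp_zmod : zmod_morphism (@susp S K F V).
Proof.
move=> phi psi; apply/funext => w; rewrite /susp !fctE -sumrB.
apply: eq_bigr => j _; rewrite -sumrB.
by apply: eq_bigr => p _; rewrite scalerBr.
Qed.

(* A pair of functionals of the words a_0 ... a_n and of the words e a_1 ... a_n.
   On the sum of the two spaces of words, b = [b, 1 - t; 0, - b'] and
   B = [0, 0; N, 0]; composing the functionals with them gives [p_hoch] and
   [p_connes]. *)
Definition functional := ((seq K -> V) * (seq K -> V))%type.
HB.instance Definition _ := GRing.Lmodule.on functional.
Implicit Types Phi Psi : functional.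

Definition p_hoch Phi : functional :=
  (hoch mul Phi.1, Phi.1 - cyc Phi.1 - bar mul Phi.2).
Definition p_connes Phi : functional := (norm Phi.2, 0).
Definition p_contr Phi : functional := (contr mul F Phi.1, contr0 F Phi.1).
Definition p_susp Phi : functional := (susp F Phi.2, 0).
Definition p_lie Phi : functional := (lie F Phi.1, lie F Phi.2).
Definition p_contrE Phi : functional := (contrE mul F Phi.1, contrE0 mul F Phi.1).
Definition p_suspE Phi : functional := (suspE mul F Phi.2, 0).
(** The part of nabla_GM that keeps the degree. The other part, - iota_E, lowers it by two and
    corresponds to [p_contrE]. *)
Definition p_even Phi : functional := p_lie Phi - p_suspE Phi.

Lemma p_hoch_zmod : zmod_morphism p_hoch.
Proof.
move=> Phi Psi; congr pair; rewrite /= ?hoch_zmod//.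
by rewrite cyc_zmod bar_zmod (subrBB Phi.1) (subrBB (_ - cyc _)).
Qed.

Lemma p_connes_zmod : zmod_morphism p_connes.
Proof. by move=> Phi Psi; congr pair; rewrite /= ?norm_zmod// subr0. Qed.

Lemma p_contr_zmod : zmod_morphism p_contr.
Proof. by move=> Phi Psi; congr pair; rewrite /= ?contr_zmod// contr0_zmod. Qed.

Lemma p_susp_zmod : zmod_morphism p_susp.
Proof. by move=> Phi Psi; congr pair; rewrite /= ?susp_zmod// subr0. Qed.

HB.instance Definition _ := GRing.isZmodMorphism.Build functional functional p_hoch p_hoch_zmod.
HB.instance Definition _ := GRing.isZmodMorphism.Build functional functional p_connes p_connes_zmod.
HB.instance Definition _ := GRing.isZmodMorphism.Build functional functional p_contr p_contr_zmod.
HB.instance Definition _ := GRing.isZmodMorphism.Build functional functional p_susp p_susp_zmod.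

Definition multi Phi := forall n, multiadditive n Phi.1 /\ multiadditive n Phi.2.

Lemma p_hochK Phi : p_hoch (p_hoch Phi) = 0.
Proof.
congr pair; apply/funext => w; rewrite ?hoch_hoch//=.
rewrite 2!bar_zmod !fctE /= bar_bar// subr0.
by have /eqP := hoch_cyc mul Phi.1 w; rewrite -subr_eq0 => /eqP.
Qed.

Lemma p_connesK Phi : p_connes (p_connes Phi) = 0.
Proof.
congr pair; apply/funext => w /=; rewrite /norm big1// => j _.
by rewrite scaler0.
Qed.

Lemma p_hoch_connes Phi : p_hoch (p_connes Phi) = - p_connes (p_hoch Phi).
Proof.
congr pair; apply/funext => w /=; rewrite ?(norm_zmod, fctE).
  by rewrite norm_cyc norm_bar// subrr sub0r opprK.
rewrite /= cyc_norm subrr sub0r /bar big1 ?oppr0// => j _.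
by rewrite scaler0.
Qed.

Lemma susp0 : susp F (0 : seq K -> V) = 0.
Proof. by rewrite -(subrr (0 : seq K -> V)) susp_zmod !subrr. Qed.

Lemma norm0 : norm (0 : seq K -> V) = 0.
Proof. by rewrite -(subrr (0 : seq K -> V)) norm_zmod !subrr. Qed.

Lemma p_susp_connes Phi : p_susp (p_connes Phi) = 0.
Proof. by rewrite /p_susp /= susp0. Qed.

Lemma p_connes_susp Phi : p_connes (p_susp Phi) = 0.
Proof. by rewrite /p_connes /= norm0. Qed.

(** The part of degree -2 of [b + B, J_nabla] = L_nabla - I_E. *)
Lemma p_contrE_hoch Phi : multi Phi ->
  p_contr (p_hoch Phi) + p_hoch (p_contr Phi) = p_contrE Phi.
Proof.
move=> ma; congr pair; apply/funext => w; rewrite !fctE /=.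
  case wn: (size w) => [|[|n]]; last exact: (homotopy_contr F mulA mulDl mulDr (proj1 (ma n)) wn).
  - by rewrite hoch_small ?wn// /contr /contrE wn addr0.
  - by rewrite hoch_small ?wn// /contr /contrE wn addr0.
rewrite !fctE /=; case wn: (size w) => [|n]; last exact: (homotopy_contr0 mul F (proj1 (ma n)) wn).
by rewrite /contr0 /contr /contrE0 /cyc /bar !size_rotr wn big_geq// scaler0 !subr0 addr0.
Qed.

Let regroup (x n b c h : V) : x + n - (b - (c + h)) = x - b + c + (h + n).
Proof.
rewrite opprB -!addrA; congr (_ + _).
by rewrite [LHS]addrC [RHS]addrC -!addrA [X in _ + (_ + X) = _]addrC.
Qed.

(** The part of degree 0 of the same formula. The first component combines [homotopy_xx] and
    [homotopy_xy], the second one is [homotopy_yy]. *)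
Lemma p_evenE Phi : multi Phi ->
  p_even Phi = p_susp (p_hoch Phi) + p_contr (p_connes Phi)
             + (p_hoch (p_susp Phi) + p_connes (p_contr Phi)).
Proof.
move=> ma; congr pair; apply/funext => w; rewrite !fctE /=.
  rewrite !susp_zmod !fctE /= -homotopy_xx.
  have -> : suspE mul F Phi.2 w =
      susp F (bar mul Phi.2) w - (contr mul F (norm Phi.2) w + hoch mul (susp F Phi.2) w).
    case wn: (size w) => [|n].
      by rewrite hoch_small ?wn// /susp /suspE /contr wn !big_geq// !addr0 subrr.
    apply: oppr_inj; rewrite opprB -(homotopy_xy mul F (proj2 (ma n)) wn).
    by [].
  exact: regroup.
have bar0 : bar mul (0 : seq K -> V) = 0.
  by rewrite -(subrr (0 : seq K -> V)) bar_zmod !subrr.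
rewrite subr0 -(homotopy_yy F Phi.2 w) add0r addr0 bar0 subr0.
by [].
Qed.

Lemma multiadditive_ext n phi psi : (forall w, size w = n -> phi w = psi w) ->
  multiadditive n psi -> multiadditive n phi.
Proof.
move=> phiE ma w p a b wn pn.
by rewrite !phiE ?ma// size_upd ?wn.
Qed.

Lemma multiadditiveB n phi psi : multiadditive n phi -> multiadditive n psi ->
  multiadditive n (phi - psi).
Proof.
by move=> ma mb w p a b wn pn; rewrite !fctE/= ma// mb// opprD addrACA.
Qed.

Lemma multiadditive_sum_nat n m k (f : nat -> seq K -> V) :
  (forall i, (m <= i < k)%N -> multiadditive n (f i)) ->
  multiadditive n (fun w => \sum_(m <= i < k) f i w).
Proof.
move=> fP w p a b wn pn; rewrite -big_split; apply: eq_big_nat => i ik.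
exact: fP.
Qed.

Lemma multiadditive_norm n phi : multiadditive n phi -> multiadditive n (norm phi).
Proof.
move=> ma; pose f w := \sum_(j < n) (-1) ^+ (j * n.-1) *: phi (rotr j w).
apply: (@multiadditive_ext _ _ f).
  by move=> w wn; rewrite /norm wn big_mkord.
apply: multiadditive_sum => j _; apply: multiadditiveZ.
exact: multiadditive_rotr (ltnW (ltn_ord j)) ma.
Qed.

Lemma multiadditive_cyc n phi : multiadditive n phi -> multiadditive n (cyc phi).
Proof.
case: n => [|n] ma; first by move=> w p a b wn.
apply: (@multiadditive_ext _ _ (fun w => (-1) ^+ n *: phi (rotr 1 w))).
  by move=> w wn; rewrite /cyc wn.
by apply: multiadditiveZ; exact: multiadditive_rotr.
Qed.

Lemma multiadditive_bar n phi : (forall n, multiadditive n phi) ->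
  multiadditive n (bar mul phi).
Proof.
move=> ma; case: n => [|n]; first by move=> w p a b wn.
apply: (@multiadditive_ext _ _
  (fun w => \sum_(q < n) (-1) ^+ q *: phi (join_at 0 mul q w))).
  by move=> w wn; rewrite /bar wn big_mkord.
apply: multiadditive_sum => j _; apply: multiadditiveZ.
exact: multiadditive_join.
Qed.

Lemma multiadditive_hoch n phi : (forall n, multiadditive n phi) ->
  multiadditive n (hoch mul phi).
Proof.
move=> ma; apply: multiadditiveD; first exact: multiadditive_bar.
case: n => [|[|n]]; first by move=> w p a b wn.
  by apply: (@multiadditive_ext _ _ (fun=> 0)) => [w ->//|w p a b _ _]; rewrite addr0.
apply: (@multiadditive_ext _ _
  (fun w => (-1) ^+ n.+1 *: phi (join_at 0 mul 0 (rotr 1 w)))).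
  by move=> w ->.
apply: multiadditiveZ.
apply: (@multiadditive_rotr _ _ _ _ _ (fun w => phi (join_at 0 mul 0 w))) => //.
exact: multiadditive_join.
Qed.

Lemma multiadditive_contr n phi : (forall n, multiadditive n phi) ->
  multiadditive n (contr mul F phi).
Proof.
move=> ma; case: n => [|[|n]]; first by move=> w p a b wn.
  by apply: (@multiadditive_ext _ _ (fun=> 0)) => [w|w p a b _ _];
    rewrite ?addr0// /contr => ->.
apply: (@multiadditive_ext _ _
  (fun w => phi (join_at 0 mul 0 (apply_at 0 F 1 w)))).
  by move=> w; rewrite /contr => ->.
apply: (@multiadditive_apply _ _ _ _ _ _ (fun w => phi (join_at 0 mul 0 w))) => //.
exact: multiadditive_join.
Qed.

Lemma multiadditive_contr0 n phi : multiadditive n phi ->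
  multiadditive n (contr0 F phi).
Proof.
move=> ma; case: n ma => [|n] ma; first by move=> w p a b wn.
apply: (@multiadditive_ext _ _ (fun w => phi (apply_at 0 F 0 w))).
  by move=> w; rewrite /contr0 => ->.
exact: multiadditive_apply.
Qed.

Lemma multiadditive_susp n phi : multiadditive n phi -> multiadditive n (susp F phi).
Proof.
move=> ma; apply: (@multiadditive_ext _ _ (fun w =>
  \sum_(0 <= j < n) \sum_(j.+1 <= p < n)
    (-1) ^+ (j * n.-1) *: phi (apply_at 0 F p (rotr j w)))).
  by move=> w; rewrite /susp => ->.
apply: multiadditive_sum_nat => j /andP[_ jn].
apply: multiadditive_sum_nat => p /andP[_ pn].
apply: multiadditiveZ.
apply: (@multiadditive_rotr _ _ _ _ _ (fun w => phi (apply_at 0 F p w))).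
  exact: ltnW.
exact: multiadditive_apply.
Qed.

Lemma multi_hoch Phi : multi Phi -> multi (p_hoch Phi).
Proof.
move=> ma n; split; first by apply: multiadditive_hoch => m; have [] := ma m.
have [ma1 ma2] := ma n; apply: multiadditiveB.
  by apply: multiadditiveB => //; exact: multiadditive_cyc.
by apply: multiadditive_bar => m; have [] := ma m.
Qed.

Lemma multi_connes Phi : multi Phi -> multi (p_connes Phi).
Proof.
move=> ma n; have [_ ma2] := ma n; split; first exact: multiadditive_norm.
by move=> w p a b _ _; rewrite addr0.
Qed.

(** This and [multi_susp] allow the relations of a formal cycle to be applied to functionals
    composed with J_nabla. *)
Lemma multi_contr Phi : multi Phi -> multi (p_contr Phi).
Proof.
move=> ma n; have [ma1 _] := ma n; split; last exact: multiadditive_contr0.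
by apply: multiadditive_contr => m; have [] := ma m.
Qed.

Lemma multi_susp Phi : multi Phi -> multi (p_susp Phi).
Proof.
move=> ma n; have [_ ma2] := ma n; split; first exact: multiadditive_susp.
by move=> w p a b _ _; rewrite addr0.
Qed.

(** With the next two lemmas these are the parts of degree -3, 1 and -1 of [b + B, L_nabla - I_E] =
    0, a formal consequence of the homotopy formula and (b + B)^2 = 0. *)
Lemma p_contrE_hochC Phi : multi Phi ->
  p_contrE (p_hoch Phi) = p_hoch (p_contrE Phi).
Proof.
move=> ma; rewrite -!p_contrE_hoch//; last exact: multi_hoch.
by rewrite raddfD /= !p_hochK raddf0 add0r addr0.
Qed.

Lemma p_even_connes Phi : multi Phi ->
  p_even (p_connes Phi) = p_connes (p_even Phi).
Proof.
move=> ma; rewrite !p_evenE//; last exact: multi_connes.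
have -> : p_susp (p_hoch (p_connes Phi)) = 0.
  by rewrite p_hoch_connes raddfN /= p_susp_connes oppr0.
rewrite p_connesK p_susp_connes !raddf0 !raddfD /= p_connes_susp p_connesK !addr0 !add0r.
suff -> : p_connes (p_hoch (p_susp Phi)) = 0 by rewrite addr0.
by apply: oppr_inj; rewrite -p_hoch_connes p_connes_susp raddf0 oppr0.
Qed.

Lemma p_even_hoch Phi : multi Phi ->
  p_even (p_hoch Phi) + p_contrE (p_connes Phi) =
  p_hoch (p_even Phi) + p_connes (p_contrE Phi).
Proof.
move=> ma; rewrite !p_evenE//; last exact: multi_hoch.
rewrite -!p_contrE_hoch//; last exact: multi_connes.
rewrite !raddfD /= !p_hochK !p_hoch_connes !raddfN /= raddf0 !add0r.
set x := p_contr (p_connes (p_hoch Phi)); set y := p_hoch (p_susp (p_hoch Phi)).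
set z := p_connes (p_contr (p_hoch Phi)); set u := p_hoch (p_contr (p_connes Phi)).
set v := p_connes (p_hoch (p_contr Phi)).
by rewrite [z + v]addrC subrKA [x + _]addrC addrA addrK addrAC.
Qed.

End Operators.

(** * Naturality in the target module *)

Section Naturality.
Variables (V V' : lmodType S) (g : {linear V -> V'}).
Implicit Types (Phi : functional V).

Definition post Phi : functional V' := (g \o Phi.1, g \o Phi.2).

Lemma cyc_post (phi : seq K -> V) : cyc (g \o phi) = g \o cyc phi.
Proof. by apply/funext => w; rewrite /cyc /= linearZ. Qed.

Lemma norm_post (phi : seq K -> V) : norm (g \o phi) = g \o norm phi.
Proof.
apply/funext => w; rewrite /norm /= linear_sum.
by apply: eq_bigr => j _; rewrite linearZ.
Qed.

Lemma bar_post (phi : seq K -> V) : bar mul (g \o phi) = g \o bar mul phi.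
Proof.
apply/funext => w; rewrite /bar /= linear_sum.
by apply: eq_bigr => j _; rewrite linearZ.
Qed.

Lemma hoch_post (phi : seq K -> V) : hoch mul (g \o phi) = g \o hoch mul phi.
Proof.
apply/funext => w; rewrite /hoch bar_post /= linearD; congr (_ + _).
by case: ifP; rewrite ?linear0 ?linearZ.
Qed.

Lemma contr_post (phi : seq K -> V) : contr mul F (g \o phi) = g \o contr mul F phi.
Proof. by apply/funext => w; rewrite /contr /=; case: ifP; rewrite ?linear0. Qed.

Lemma contr0_post (phi : seq K -> V) : contr0 F (g \o phi) = g \o contr0 F phi.
Proof. by apply/funext => w; rewrite /contr0 /=; case: ifP; rewrite ?linear0. Qed.

Lemma susp_post (phi : seq K -> V) : susp F (g \o phi) = g \o susp F phi.
Proof.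
apply/funext => w; rewrite /susp /= linear_sum; apply: eq_bigr => j _.
by rewrite linear_sum; apply: eq_bigr => p _; rewrite linearZ.
Qed.

Lemma lie_post (phi : seq K -> V) : lie F (g \o phi) = g \o lie F phi.
Proof. by apply/funext => w; rewrite /lie /= linear_sum. Qed.

Lemma contrE_post (phi : seq K -> V) : contrE mul F (g \o phi) = g \o contrE mul F phi.
Proof. by apply/funext => w; rewrite /contrE /=; case: ifP; rewrite ?linear0. Qed.

Lemma contrE0_post (phi : seq K -> V) : contrE0 mul F (g \o phi) = g \o contrE0 mul F phi.
Proof. by apply/funext => w; rewrite /contrE0 /=; case: ifP; rewrite ?linear0. Qed.

Lemma suspE_post (phi : seq K -> V) : suspE mul F (g \o phi) = g \o suspE mul F phi.
Proof.
apply/funext => w; rewrite /suspE /= linear_sum; apply: eq_bigr => j _.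
by rewrite linear_sum; apply: eq_bigr => p _; rewrite linearZ.
Qed.

Lemma comp_linearB (phi psi : seq K -> V) : g \o (phi - psi) = (g \o phi) - (g \o psi).
Proof. by apply/funext => w; rewrite /= !fctE /= linearB. Qed.

Lemma comp_linear0 : g \o (0 : seq K -> V) = 0.
Proof. by apply/funext => w; rewrite /= linear0. Qed.

Lemma p_hoch_post Phi : p_hoch (post Phi) = post (p_hoch Phi).
Proof. by rewrite /p_hoch /post /= hoch_post cyc_post bar_post !comp_linearB. Qed.

Lemma p_connes_post Phi : p_connes (post Phi) = post (p_connes Phi).
Proof. by rewrite /p_connes /post /= norm_post comp_linear0. Qed.

Lemma p_contr_post Phi : p_contr (post Phi) = post (p_contr Phi).
Proof. by rewrite /p_contr /post /= contr_post contr0_post. Qed.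

Lemma p_susp_post Phi : p_susp (post Phi) = post (p_susp Phi).
Proof. by rewrite /p_susp /post /= susp_post comp_linear0. Qed.

Lemma p_contrE_post Phi : p_contrE (post Phi) = post (p_contrE Phi).
Proof. by rewrite /p_contrE /post /= contrE_post contrE0_post. Qed.

Lemma p_even_post Phi : p_even (post Phi) = post (p_even Phi).
Proof.
congr pair; rewrite /= !(lie_post, suspE_post) ?comp_linearB//.
by rewrite comp_linear0.
Qed.
End Naturality.
End FunctionalPairs.

(** In S_E the defect is formed at i and the word is then turned by j; in [suspE] the defect is
    formed after turning, at r = i + j. *)
Lemma triangle_sum (V : zmodType) n (f : nat -> nat -> V) :
  \sum_(1 <= i < n) \sum_(0 <= j < n - i) f i j =
  \sum_(0 <= j < n) \sum_(j.+1 <= r < n) f (r - j)%N j.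
Proof.
transitivity (\sum_(1 <= i < n) \sum_(0 <= j < n) if (j < n - i)%N then f i j else 0).
  apply: eq_big_nat => i _; by rewrite -big_mkcond [LHS](big_nat_widen _ _ n) ?leq_subr.
rewrite exchange_big; apply: eq_big_nat => j /= jn.
rewrite [RHS](big_addn 1 n j xpredT (fun r => f (r - j)%N j)) [RHS]/=.
rewrite -big_mkcond [RHS](big_nat_widen _ _ n) ?leq_subr//.
apply: congr_big_nat => // i /andP[i1 iN]; first by rewrite andTb; lia.
by rewrite addnK.
Qed.

(** * The algebra of sections *)

Section Algebra.
Variables (R : realType) (J : open_interval R) (X : tvsType R[i]).
Hypothesis X_hausdorff : hausdorff_space X.
Variable D : deformation J X.
Notation A := (Cinf J X).
Notation Rg := (Cinf J (R[i]^o)).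
Implicit Types (a b c : A) (f g : Rg).

Lemma Cinf_ext a b : (forall t, (J : set R) t -> jet a 0 t = jet b 0 t) -> a = b.
Proof. exact: Cinf_eq. Qed.

Lemma jetD (V : tvsType R[i]) (u v : Cinf J V) k t : jet (u + v) k t = jet u k t + jet v k t.
Proof. by []. Qed.

Lemma jet0 (V : tvsType R[i]) k t : jet (0 : Cinf J V) k t = 0.
Proof. by []. Qed.

Lemma mulJA : associative (mulJ D).
Proof.
by move=> a b c; apply: Cinf_ext => t Jt; rewrite !mulJE mt_assoc.
Qed.

Lemma mulJDl a b c : mulJ D (a + b) c = mulJ D a c + mulJ D b c.
Proof.
apply: Cinf_ext => t Jt; rewrite jetD !mulJE jetD.
have [mB _] := linear_subZ (@mt_linearl _ _ _ D (jet c 0 t)).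
by have := mt_linearl D (jet c 0 t) 1 (jet a 0 t) (jet b 0 t); rewrite !scale1r => ->.
Qed.

Lemma mulJDr a b c : mulJ D a (b + c) = mulJ D a b + mulJ D a c.
Proof.
apply: Cinf_ext => t Jt; rewrite jetD !mulJE jetD.
by have := mt_linearr D (jet a 0 t) 1 (jet b 0 t) (jet c 0 t); rewrite !scale1r => ->.
Qed.

Lemma act0l a : act 0 a = 0.
Proof. by apply: Cinf_ext => t Jt; rewrite actE jet0 scale0r. Qed.

Lemma act0r f : act f (0 : A) = 0.
Proof. by apply: Cinf_ext => t Jt; rewrite actE jet0 scaler0. Qed.

Definition one_smooth : Rg := constant_smooth (@Defs.interval_open R J) (1 : R[i]^o).

Lemma jet_one t : (J : set R) t -> jet one_smooth 0 t = 1.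
Proof. by move=> Jt; rewrite /= mem_set. Qed.

Lemma act1l a : act one_smooth a = a.
Proof. by apply: Cinf_ext => t Jt; rewrite actE jet_one// scale1r. Qed.

Lemma act1r g : act g one_smooth = g.
Proof.
apply: (@Cinf_eq R J (R[i]^o)); first exact: norm_hausdorff.
by move=> t Jt; rewrite actE jet_one//; exact: mulr1.
Qed.

Lemma ddt0 : ddt (0 : Rg) = 0.
Proof. exact: val_inj. Qed.

Lemma ddt_one : ddt one_smooth = 0.
Proof. by apply: val_inj; apply/funext => k; apply/funext => t. Qed.

Section Connection.
Variable N : connection J X.
Lemma connectionD a b : N (a + b) = N a + N b.
Proof. by have := nabla_linear N 1 a b; rewrite !scale1r. Qed.
End Connection.
End Algebra.

(* The words have letters in convertible but syntactically different carriers,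
   which [lia] does not identify. *)
Ltac size_lia w :=
  repeat match goal with
  | H : is_true _ |- _ => revert H
  | H : @eq nat _ _ |- _ => revert H
  end; move: (size w) => ?; lia.

(** * Elementary tensors as functionals of words *)

Section Words.
Variables (R : realType) (J : open_interval R) (X : tvsType R[i]).
Hypothesis X_hausdorff : hausdorff_space X.
Variable D : deformation J X.
Variable C : forall n, tensor_power J X n.
Notation A := (Cinf J X).
Notation Rg := (Cinf J (R[i]^o)).
Notation Aplus := (Cinf J X * Cinf J (R[i]^o))%type.
Notation e := (@unit_e R J X).
Notation S := R[i].
Implicit Types (w s : seq A).

Lemma linear_additive (U V : lmodType S) (f : U -> V) : linear f ->
  forall a b, f (a + b) = f a + f b.
Proof. by move=> fl a b; have := fl 1 a b; rewrite !scale1r. Qed.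

Lemma linear_fun0 (U V : lmodType S) (f : U -> V) : linear f -> f 0 = 0.
Proof. by move=> fl; have := fl (-1) 0 0; rewrite scaler0 add0r scaleN1r addNr. Qed.

Lemma tensorDl n (a b : Aplus) s :
  tensor C n (a + b) s = tensor C n a s + tensor C n b s.
Proof.
have [_ lin _ _ _] := pure_tensor_form (C n).
exact: linear_additive (lin _) a b.
Qed.

Lemma tensor0l n s : tensor C n 0 s = 0.
Proof.
have [_ lin _ _ _] := pure_tensor_form (C n).
exact: linear_fun0 (lin _).
Qed.

Lemma tensor_update n (a0 : Aplus) s p u : size s = n -> (p < n)%N ->
  forall pn : (p < n)%N,
  tensor C n a0 (upd s p u) =
  pure_tensor (C n) a0 (update (fun i : 'I_n => s`_i) (Ordinal pn) u).
Proof.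
move=> sn _ pn; congr pure_tensor; apply/funext => i.
by rewrite nth_upd ?sn// /update -val_eqE.
Qed.

Lemma multiadditive_tensor n (a0 : Aplus) : multiadditive n (tensor C n a0).
Proof.
move=> s p a b sn pn; have [_ _ lin _ _] := pure_tensor_form (C n).
by rewrite !(tensor_update _ _ sn pn pn) (linear_additive (lin _ _ _)).
Qed.

Lemma tensor00 (a0 : Rg) s : tensor C 0 (0, a0) s = 0.
Proof. by have [_ _ _ _ H] := pure_tensor_form (C 0%N); exact: H. Qed.

(** The value 0 on words of any other length makes the identities between [tau] and the operators
    hold for all words, although the operators change lengths. *)
Definition tau_alg n w := if size w == n.+1 then tensor C n (head 0 w, 0) (behead w) else 0.
Definition tau_unit n w := if size w == n then tensor C n e w else 0.
Definition tau n : @functional S A (C n) := (tau_alg n, tau_unit n).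

Lemma tau_algE n a s : size s = n -> tau_alg n (a :: s) = tensor C n (a, 0) s.
Proof. by move=> sn; rewrite /tau_alg /= sn eqxx. Qed.

Lemma tau_unitE n s : size s = n -> tau_unit n s = tensor C n e s.
Proof. by move=> sn; rewrite /tau_unit sn eqxx. Qed.

Lemma tau_alg0 n w : size w != n.+1 -> tau_alg n w = 0.
Proof. by rewrite /tau_alg => /negbTE ->. Qed.

Lemma tau_unit0 n w : size w != n -> tau_unit n w = 0.
Proof. by rewrite /tau_unit => /negbTE ->. Qed.

Lemma multi_tau n : multi (tau n).
Proof.
move=> m; split=> w p a b <- pm /=; last first.
  rewrite /tau_unit !size_upd//; case: eqP => wn; last by rewrite addr0.
  by apply: (@multiadditive_tensor n e w p a b) => //; rewrite -wn.
rewrite /tau_alg !size_upd//; case: eqP => wn; last by rewrite addr0.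
case: w wn pm => [//|x s] [sn]; case: p => [|p] pn /=.
  by rewrite drop0 -tensorDl; congr tensor; congr pair; rewrite ?addr0.
by apply: (@multiadditive_tensor n (x, 0) s p a b); rewrite -?sn.
Qed.

Section CyclicOperators.
Variable Q : cyclic_operators D C.

HB.instance Definition _ n :=
  GRing.isLinear.Build S (C n.+1) (C n) *:%R (op_b Q (n:=n)) (@op_b_linear _ _ _ _ _ Q n).
HB.instance Definition _ n :=
  GRing.isLinear.Build S (C n) (C n.+1) *:%R (op_B Q (n:=n)) (@op_B_linear _ _ _ _ _ Q n).

Lemma lmul_plus_alg a b : lmul_plus D (a, 0) b = mulJ D a b.
Proof. by rewrite /lmul_plus /= act0l// addr0. Qed.

Lemma rmul_plus_alg a b : rmul_plus D b (a, 0) = mulJ D b a.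
Proof. by rewrite /rmul_plus /= act0l// addr0. Qed.

Lemma mulJ0l a : mulJ D 0 a = 0.
Proof.
by apply: (addrI (mulJ D 0 a)); rewrite -mulJDl// addr0 addr0.
Qed.

Lemma mulJ0r a : mulJ D a 0 = 0.
Proof.
by apply: (addrI (mulJ D a 0)); rewrite -mulJDr// addr0 addr0.
Qed.

Lemma lmul_plus_unit b : lmul_plus D e b = b.
Proof. by rewrite /lmul_plus /= mulJ0l add0r act1l. Qed.

Lemma rmul_plus_unit b : rmul_plus D b e = b.
Proof. by rewrite /rmul_plus /= mulJ0r add0r act1l. Qed.

(** On e a_1 ... a_n the first face deletes e, the last one deletes e after a rotation, and the
    inner ones give - b'. *)
Lemma hoch_tau n : p_hoch (mulJ D) (tau n) = post (op_b Q (n:=n)) (tau n.+1).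
Proof.
congr pair; apply/funext => w /=.
  have [wn|wn] := eqVneq (size w) n.+2; last first.
    rewrite tau_alg0// linear0; case: (ltnP 1 (size w)) => w1; last by rewrite hoch_small.
    rewrite /hoch /bar w1 big_nat big1 => [|q qn]; last first.
      by rewrite tau_alg0 ?scaler0// size_join_at//; size_lia w.
    by rewrite tau_alg0 ?scaler0 ?addr0// size_join_at ?size_rotr//; size_lia w.
  case: w wn => [//|x s] [sn]; rewrite (tau_algE _ sn) op_bE// lmul_plus_alg rmul_plus_alg.
  rewrite /hoch /bar /= sn /= big_nat_recl//= expr0 scale1r [in RHS]big_add1 /=.
  congr (_ + _ + _).
  - by rewrite /join_at /= tau_algE// size_drop sn subn1.
  - apply: eq_big_nat => j /= jn; rewrite /join_at /= tau_algE//.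
    by rewrite size_cat size_take /= size_drop sn; case: ifP => ?; lia.
  - congr (_ *: _); case/lastP: s sn => [//|s l]; rewrite size_rcons => -[sn].
    rewrite -rcons_cons rotr1_rcons /join_at /= drop0 nth_rcons sn ltnn eqxx.
    by rewrite tau_algE// -cats1 take_cat sn ltnn subnn take0 cats0.
rewrite !fctE /=.
have [wn|wn] := eqVneq (size w) n.+1; last first.
  rewrite tau_unit0// linear0 /cyc !tau_alg0 ?size_rotr// scaler0 subr0 sub0r.
  rewrite /bar big_nat big1 ?oppr0// => q qn.
  by rewrite tau_unit0 ?scaler0// size_join_at//; size_lia w.
rewrite (tau_unitE wn) op_bE// lmul_plus_unit rmul_plus_unit /bar wn /=.
rewrite [in RHS]big_add1 /= addrAC; congr (_ + _ + _).
- by case: w wn => [//|x s] [sn]; rewrite tau_algE//= drop0.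
- rewrite -sumrN; apply: eq_big_nat => j /= jn.
  rewrite /sgn exprS mulN1r scaleNr tau_unitE//.
  by rewrite size_join_at wn//.
- rewrite /cyc wn /sgn exprS mulN1r scaleNr.
  case/lastP: w wn => [//|s l]; rewrite size_rcons => -[sn].
  rewrite rotr1_rcons tau_algE// nth_rcons sn ltnn eqxx.
  by rewrite -cats1 take_cat sn ltnn subnn take0 cats0.
Qed.

Lemma op_B_norm n (a0 : Aplus) s : size s = n ->
  op_B Q (tensor C n a0 s) = norm (tau_unit n.+1) (a0.1 :: s).
Proof.
move=> sn; rewrite op_BE//; set w := a0.1 :: s.
have wn : size w = n.+1 by rewrite /= sn.
rewrite /norm wn /= big_nat_recl//= [RHS]big_nat_recl//=; congr (_ + _).
  by rewrite rot0 rotr0 tau_unitE.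
(* [op_BE] rotates to the left and [norm] to the right: j corresponds to n + 1 - j. *)
rewrite big_nat_rev /= add0n; apply: eq_big_nat => j /= jn.
rewrite tau_unitE ?size_rotr// /rotr wn.
have -> : (n.+1 - j.+1 = (n - j.+1).+1)%N by lia.
congr (_ *: _); apply: sign_parity; rewrite !oddM /= oddB//=.
by case: (odd n); case: (odd j).
Qed.

Lemma multiadditive_unit n m : multiadditive n (tau_unit m).
Proof. exact: (multi_tau m n).2. Qed.

Lemma connes_tau n : p_connes (tau n.+1) = post (op_B Q (n:=n)) (tau n).
Proof.
congr pair; apply/funext => w /=.
  have [wn|wn] := eqVneq (size w) n.+1; last first.
    rewrite tau_alg0// linear0 /norm big1// => j _.
    by rewrite tau_unit0 ?scaler0 ?size_rotr.
  by case: w wn => [//|x s] [sn]; rewrite tau_algE// op_B_norm.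
have [wn|wn] := eqVneq (size w) n; last by rewrite tau_unit0// linear0.
(* B sees only the component of e in A, which is 0, and a functional additive in each letter
   vanishes on a word with a letter 0. *)
rewrite tau_unitE// op_B_norm//= -[0 :: w](@size_upd_id _ 0 _ 0)//.
rewrite (@multiadditive0 _ _ _ n.+1)//= ?wn//.
by apply: multiadditive_norm; exact: multiadditive_unit.
Qed.

Lemma connes_tau0 : p_connes (tau 0) = 0.
Proof.
congr pair; apply/funext => w /=; rewrite /norm big1_seq// => j /=.
rewrite mem_index_iota => /andP[_ jn]; rewrite tau_unit0 ?scaler0// size_rotr.
by rewrite -lt0n; exact: leq_ltn_trans jn.
Qed.
End CyclicOperators.

Section GaussManin.
Variables (N : connection J X) (G : gauss_manin_operators D C N).

HB.instance Definition _ n :=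
  GRing.isLinear.Build S (C n.+2) (C n) *:%R (op_iota G (n:=n)) (@op_iota_linear _ _ _ _ _ _ G n).

Definition op_even n (z : C n) : C n := op_L G z - op_S G z.
Lemma op_even_linear n : linear (@op_even n).
Proof.
move=> c x y; rewrite /op_even (op_L_linear G) (op_S_linear G) scalerBr opprD.
by rewrite addrACA.
Qed.
HB.instance Definition _ n :=
  GRing.isLinear.Build S (C n) (C n) *:%R (@op_even n) (@op_even_linear n).

Lemma contrE_tau n : p_contrE (mulJ D) N (tau n) = - post (op_iota G (n:=n)) (tau n.+2).
Proof.
congr pair; apply/funext => w; rewrite !fctE /=.
  have [wn|wn] := eqVneq (size w) n.+3; last first.
    rewrite tau_alg0// linear0 oppr0 /contrE; case: ifP => // w2.
    by rewrite tau_alg0// !size_join_at//; size_lia w.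
  case: w wn => [//|x [//|y [//|z s]]] [sn].
  rewrite tau_algE/= ?sn// op_iotaE/= ?sn// opprK lmul_plus_alg.
  by rewrite /contrE /= tau_algE//= ?drop0//.
have [wn|wn] := eqVneq (size w) n.+2; last first.
  rewrite tau_unit0// linear0 oppr0 /contrE0; case: ifP => // w2.
  by rewrite tau_alg0// size_join_at//; size_lia w.
case: w wn => [//|x [//|y s]] [sn].
rewrite tau_unitE/= ?sn// op_iotaE/= ?sn// opprK lmul_plus_unit.
by rewrite /contrE0 /= tau_algE//= drop0.
Qed.

Lemma op_S_susp n (a0 : Aplus) s : size s = n ->
  op_S G (tensor C n a0 s) = suspE (mulJ D) N (tau_unit n) (a0.1 :: s).
Proof.
move=> sn; rewrite op_SE//; set w := a0.1 :: s.
have wn : size w = n.+1 by rewrite /= sn.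
rewrite /suspE wn /= triangle_sum; apply: eq_big_nat => j /= jn.
apply: eq_big_nat => r /andP[jr rn].
(* For r = i + j the two exponents differ by 2 j. *)
have -> : ((-1) ^+ (r + j * n) : S) = sgn R (r - j + j * n.-1).
  apply: sign_parity; rewrite !(oddD, oddM) oddB; last lia.
  rewrite -subn1 oddB; last lia.
  by case: (odd r); case: (odd j); case: (odd n).
have rw : (r.+1 < size (rotr j w))%N by rewrite size_rotr wn.
congr (_ *: _); rewrite tau_unitE; last by rewrite size_join_at// size_rotr wn.
have jr' : (j + (r - j).+1 < size w)%N by rewrite wn; lia.
congr tensor; rewrite -[in RHS](subnK (ltnW jr)) -rotr_join_at//.
have iw : ((r - j).+1 < size w)%N by rewrite wn; lia.
rewrite /rotr size_join_at// wn /= /rot -[drop (n - j) s]/(drop (n - j).+1 w).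
rewrite -[take (n - j) s]/(behead (take (n - j).+1 w)).
rewrite /join_at drop_cat take_cat size_takel; last by rewrite wn; lia.
have -> : (n - j < r - j)%N = false by lia.
have -> : (n - j - (r - j) = (n - r).-1.+1)%N by lia.
rewrite -drop1 drop_drop addn1 [drop _ (_ :: _)]/= [take _ (_ :: _)]/= drop_drop take_drop.
have -> : ((n - r).-1 + (r - j).+1 = n - j)%N by lia.
by [].
Qed.

(** Expresses S_E(e, a_1, ..., a_n) = 0: the first letter is the component of e in A. *)
Lemma suspE_unit0 n s : size s = n -> suspE (mulJ D) N (tau_unit n) (0 :: s) = 0.
Proof.
move=> sn; rewrite -(op_S_susp 0 sn) tensor0l.
exact: linear_fun0 (@op_S_linear _ _ _ _ _ _ G n).
Qed.

Lemma even_tau n : p_even (mulJ D) N (tau n) = post (@op_even n) (tau n).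
Proof.
congr pair; apply/funext => w; rewrite !fctE /=.
  have [wn|wn] := eqVneq (size w) n.+1; last first.
    rewrite tau_alg0// linear0 /lie big_nat big1 => [|p pn]; last first.
      by rewrite tau_alg0// size_apply_at.
    rewrite sub0r /suspE big1 ?oppr0// => j _; rewrite big_nat big1// => r rn.
    by rewrite tau_unit0 ?scaler0// size_join_at ?size_rotr//; size_lia w.
  case: w wn => [//|x s] [sn]; rewrite tau_algE// /op_even op_S_susp//; congr (_ - _).
  rewrite op_LE// /lie /= sn big_nat_recl//=; congr (_ + _).
    rewrite /apply_at /upd /= drop0 tau_algE//; congr tensor.
    by rewrite /nabla_plus /= ddt0.
  apply: eq_big_nat => p /= pn; rewrite set_nthE sn pn.
  by rewrite -tau_algE// size_cat size_take /= size_drop sn pn; lia.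
rewrite subr0; have [wn|wn] := eqVneq (size w) n; last first.
  rewrite tau_unit0// linear0 /lie big_nat big1 => [//|p pn].
  by rewrite tau_unit0// size_apply_at.
rewrite tau_unitE// /op_even op_S_susp//= suspE_unit0// subr0 op_LE//.
rewrite [tensor _ _ _ _](_ : _ = 0) ?add0r; last first.
  rewrite /nabla_plus /= ddt_one// (linear_fun0 (nabla_linear N)); exact: tensor0l.
rewrite /lie wn; apply: eq_big_nat => p /= pn; rewrite set_nthE wn pn.
by rewrite tau_unitE// size_apply_at wn.
Qed.
End GaussManin.
End Words.

(** * The periodic cyclic complex *)

Section TensorMaps.
Variables (R : realType) (J : open_interval R) (X : tvsType R[i]).
Variable C : forall n, tensor_power J X n.
Notation A := (Cinf J X).
Notation Rg := (Cinf J (R[i]^o)).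
Notation Aplus := (Cinf J X * Cinf J (R[i]^o))%type.
Notation S := R[i].
Hypothesis X_hausdorff : hausdorff_space X.

Lemma pure_tensorE n (a0 : Aplus) (x : 'I_n -> A) :
  pure_tensor (C n) a0 x = tensor C n a0 (codom x).
Proof.
congr pure_tensor; apply/funext => i; rewrite codomE (nth_map i) ?size_enum_ord//.
by rewrite nth_ord_enum.
Qed.

(** In positive degree the balancing relation moves the scalar of g e into the next factor, so words
    with and without e exhaust the elementary tensors. *)
Lemma tensor_unit_part n (g : Rg) s : size s = n.+1 ->
  tensor C n.+1 (0, g) s = tensor C n.+1 (unit_e J X) (upd s 0 (act g s`_0)).
Proof.
move=> sn; have [_ _ _ bal _] := pure_tensor_form (C n.+1).
have := bal (unit_e J X) (fun i => s`_i) ord0 g.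
rewrite /act_plus /= act0r// act1r => Hb; rewrite [LHS]Hb.
by congr pure_tensor; apply/funext => i; rewrite nth_upd ?sn// /update.
Qed.

(** The uniqueness half of the universal property. The first factor is split along A_+ = A (+) R e,
    and [tensor_unit_part] makes its second part a word starting with e. *)
Lemma tensor_ext (Z : tvsType S) n (g1 g2 : {linear C n -> Z}) :
  complete_tvs Z -> hausdorff_space Z -> continuous g1 -> continuous g2 ->
  post g1 (tau C n) = post g2 (tau C n) -> g1 =1 g2.
Proof.
move=> Zc Zh c1 c2 [e1 e2].
have e12 a0 x : g1 (pure_tensor (C n) a0 x) = g2 (pure_tensor (C n) a0 x).
  rewrite pure_tensorE; set s := codom x.
  have sn : size s = n by rewrite size_codom card_ord.
  have -> : a0 = (a0.1, 0) + (0, a0.2).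
    by case: a0 => a g; congr pair; rewrite ?addr0 ?add0r.
  rewrite tensorDl !linearD; congr (_ + _).
    have := congr1 (fun f => f (a0.1 :: s)) e1.
    by rewrite /= tau_algE.
  case: n g1 g2 c1 c2 e1 e2 x @s sn => [|n] h1 h2 c1 c2 e1 e2 x s sn.
    by rewrite tensor00 !linear0.
  rewrite tensor_unit_part//.
  have := congr1 (fun f => f (upd s 0 (act a0.2 s`_0))) e2.
  by rewrite /= tau_unitE// size_upd ?sn.
have [pc pl plu pb p0] := pure_tensor_form (C n).
have bf : balanced_form (fun a0 x => g1 (pure_tensor (C n) a0 x)).
  split.
  - by move=> z; apply: (continuous_comp (pc z)); exact: c1.
  - by move=> x c a b; rewrite pl linearP.
  - by move=> a0 x i c a b; rewrite plu linearP.
  - by move=> a0 x i f; rewrite (pb a0 x i).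
  - by move=> n0 g x; rewrite p0// linear0.
have [g [_ gu]] := tensor_universal (C n) Zc Zh bf.
have g1E : g = g1 by apply: gu; split=> //; exact: linearP.
have g2E : g = g2 by apply: gu; split=> //; exact: linearP.
by rewrite -g1E g2E.
Qed.

Variables (D : deformation J X) (Q : cyclic_operators D C).
Variables (N : connection J X) (G : gauss_manin_operators D C N).
HB.instance Definition _ n :=
  GRing.isLinear.Build S (C n.+1) (C n) *:%R (op_b Q (n:=n)) (@op_b_linear _ _ _ _ _ Q n).
HB.instance Definition _ n :=
  GRing.isLinear.Build S (C n) (C n.+1) *:%R (op_B Q (n:=n)) (@op_B_linear _ _ _ _ _ Q n).
HB.instance Definition _ n :=
  GRing.isLinear.Build S (C n.+2) (C n) *:%R (op_iota G (n:=n)) (@op_iota_linear _ _ _ _ _ _ G n).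
HB.instance Definition _ n :=
  GRing.isLinear.Build S (C n) (C n) *:%R (@op_even _ _ _ _ _ _ G n) (@op_even_linear _ _ _ _ _ _ G n).

Lemma tvs_continuousD (T : topologicalType) (Z : tvsType S) (f g : T -> Z) :
  continuous f -> continuous g -> continuous (fun x => f x + g x).
Proof. by move=> cf cg x; apply: tvs_cvgD; [exact: cf|exact: cg]. Qed.

Lemma tvs_continuousZ (T : topologicalType) (Z : tvsType S) (k : S) (f : T -> Z) :
  continuous f -> continuous (fun x => k *: f x).
Proof.
move=> cf x; apply: (@tvs_cvgZ R Z T (nbhs x) _ (fun=> k : S^o)); last exact: cf.
exact: cvg_cst.
Qed.

Lemma tvs_continuousB (T : topologicalType) (Z : tvsType S) (f g : T -> Z) :
  continuous f -> continuous g -> continuous (fun x => f x - g x).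
Proof.
move=> cf cg; under eq_fun do rewrite -scaleN1r.
by apply: tvs_continuousD => //; exact: tvs_continuousZ.
Qed.

Lemma op_even_continuous n : continuous (@op_even _ _ _ _ _ _ G n).
Proof. by apply: tvs_continuousB; [exact: op_L_continuous|exact: op_S_continuous]. Qed.

Lemma post_comp (V1 V2 V3 : lmodType S) (K : zmodType) (g : {linear V2 -> V3})
  (f : {linear V1 -> V2}) (Phi : @functional S K V1) :
  post g (post f Phi) = post (g \o f) Phi.
Proof. by []. Qed.

Let hochE n : p_hoch (mulJ D) (tau C n) = post (op_b Q (n:=n)) (tau C n.+1).
Proof. exact: hoch_tau. Qed.
Let connesE n : p_connes (tau C n.+1) = post (op_B Q (n:=n)) (tau C n).
Proof. exact: connes_tau. Qed.
Let contrE_E n : p_contrE (mulJ D) N (tau C n) = - post (op_iota G (n:=n)) (tau C n.+2).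
Proof. exact: contrE_tau. Qed.
Let evenE n : p_even (mulJ D) N (tau C n) = post (@op_even _ _ _ _ _ _ G n) (tau C n).
Proof. exact: even_tau. Qed.

Lemma tensor_ext_tau m n (g1 g2 : {linear C n -> C m}) :
  continuous g1 -> continuous g2 ->
  post g1 (tau C n) = post g2 (tau C n) -> g1 =1 g2.
Proof. by apply: tensor_ext; [exact: tensor_complete|exact: tensor_hausdorff]. Qed.

Lemma cts_comp (U V W : topologicalType) (f : U -> V) (g : V -> W) :
  continuous f -> continuous g -> continuous (g \o f).
Proof. by move=> cf cg x; apply: continuous_comp; [exact: cf|exact: cg]. Qed.

Lemma postN (U V : lmodType S) (K : zmodType) (g : {linear U -> V})
  (Phi : @functional S K U) : post g (- Phi) = - post g Phi.
Proof. by congr pair; apply/funext => w; rewrite /= linearN. Qed.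

(** [tensor_ext_tau] reduces this to the identity between functionals of words; the identities below
    are transferred in the same way. *)
Lemma op_bb n (z : C n.+2) : op_b Q (op_b Q z) = 0.
Proof.
apply: (@tensor_ext_tau n n.+2 (op_b Q (n:=n) \o op_b Q (n:=n.+1)) \0).
- by apply: cts_comp; exact: op_b_continuous.
- by move=> x; exact: cvg_cst.
have := p_hochK (mulJA X_hausdorff D) (tau C n).
by rewrite hochE p_hoch_post hochE post_comp => ->.
Qed.

Lemma op_BB n (z : C n) : op_B Q (op_B Q z) = 0.
Proof.
apply: (@tensor_ext_tau n.+2 n (op_B Q (n:=n.+1) \o op_B Q (n:=n)) \0).
- by apply: cts_comp; exact: op_B_continuous.
- by move=> x; exact: cvg_cst.
have := p_connesK (tau C n.+2).
by rewrite connesE p_connes_post connesE post_comp => ->.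
Qed.

Lemma op_bB0 (z : C 0) : op_b Q (op_B Q z) = 0.
Proof.
apply: (@tensor_ext_tau 0 0 (op_b Q (n:=0) \o op_B Q (n:=0)) \0).
- by apply: cts_comp; [exact: op_B_continuous|exact: op_b_continuous].
- by move=> x; exact: cvg_cst.
have := p_hoch_connes (mulJ D) (tau C 0).
rewrite connes_tau0 raddf0 hochE p_connes_post connesE post_comp.
by move/eqP; rewrite eq_sym oppr_eq0 => /eqP.
Qed.

Lemma op_bB n (z : C n.+1) : op_b Q (op_B Q z) + op_B Q (op_b Q z) = 0.
Proof.
apply: (@tensor_ext_tau n.+1 n.+1
  ((op_b Q (n:=n.+1) \o op_B Q (n:=n.+1)) \+ (op_B Q (n:=n) \o op_b Q (n:=n))) \0).
- apply: tvs_continuousD; apply: cts_comp;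
    first [exact: op_B_continuous|exact: op_b_continuous].
- by move=> x; exact: cvg_cst.
have := p_hoch_connes (mulJ D) (tau C n.+1).
rewrite hochE p_connes_post !connesE p_hoch_post hochE => /eqP.
by rewrite -addr_eq0 addrC => /eqP.
Qed.

Lemma op_iota_b n (z : C n.+3) : op_iota G (op_b Q z) = op_b Q (op_iota G z).
Proof.
apply: (@tensor_ext_tau n n.+3 (op_iota G (n:=n) \o op_b Q (n:=n.+2))
  (op_b Q (n:=n) \o op_iota G (n:=n.+1))).
- by apply: cts_comp; [exact: op_b_continuous|exact: op_iota_continuous].
- by apply: cts_comp; [exact: op_iota_continuous|exact: op_b_continuous].
have := p_contrE_hochC N (mulJA X_hausdorff D) (mulJDl X_hausdorff D)
  (mulJDr X_hausdorff D) (multi_tau C n).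
rewrite hochE p_contrE_post !contrE_E (raddfN (p_hoch (mulJ D) (V:=C n))) /=.
rewrite p_hoch_post hochE postN => H; apply/esym; exact: (oppr_inj H).
Qed.

Lemma op_even_B n (z : C n) : @op_even _ _ _ _ _ _ G _ (op_B Q z) = op_B Q (@op_even _ _ _ _ _ _ G _ z).
Proof.
apply: (@tensor_ext_tau n.+1 n (@op_even _ _ _ _ _ _ G n.+1 \o op_B Q (n:=n))
  (op_B Q (n:=n) \o @op_even _ _ _ _ _ _ G n)).
- by apply: cts_comp; [exact: op_B_continuous|exact: op_even_continuous].
- by apply: cts_comp; [exact: op_even_continuous|exact: op_B_continuous].
have := p_even_connes (mulJ D) N (multi_tau C n.+1).
by rewrite connesE p_even_post !evenE p_connes_post connesE.
Qed.

(** Degree 1 is separate because iota_E lowers the degree by two and leaves nothing for B to act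
    on. *)
Lemma op_even_b0 (z : C 1) :
  op_even G (op_b Q z) - op_iota G (op_B Q z) = op_b Q (op_even G z).
Proof.
apply: (@tensor_ext_tau 0 1
  ((@op_even _ _ _ _ _ _ G 0 \o op_b Q (n:=0)) \- (op_iota G (n:=0) \o op_B Q (n:=1)))
  (op_b Q (n:=0) \o @op_even _ _ _ _ _ _ G 1)).
- by apply: tvs_continuousB; apply: cts_comp;
    first [exact: op_B_continuous|exact: op_b_continuous|
           exact: op_iota_continuous|exact: op_even_continuous].
- by apply: cts_comp; [exact: op_even_continuous|exact: op_b_continuous].
have := p_even_hoch N (mulJA X_hausdorff D) (mulJDl X_hausdorff D)
  (mulJDr X_hausdorff D) (multi_tau C 0).
rewrite hochE p_even_post !evenE connes_tau0 contrE_E p_hoch_post hochE.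
rewrite (raddfN (@p_connes S A (C 0%N))) /= p_connes_post connesE.
rewrite [X in _ + X](_ : _ = 0) ?addr0; last first.
  by congr pair; apply/funext => w; rewrite /contrE /contrE0 /=; case: ifP.
exact: esym.
Qed.

Lemma op_even_bS n (z : C n.+2) :
  op_even G (op_b Q z) - op_iota G (op_B Q z) =
  op_b Q (op_even G z) - op_B Q (op_iota G z).
Proof.
apply: (@tensor_ext_tau n.+1 n.+2
  ((@op_even _ _ _ _ _ _ G n.+1 \o op_b Q (n:=n.+1)) \- (op_iota G (n:=n.+1) \o op_B Q (n:=n.+2)))
  ((op_b Q (n:=n.+1) \o @op_even _ _ _ _ _ _ G n.+2) \- (op_B Q (n:=n) \o op_iota G (n:=n)))).
- by apply: tvs_continuousB; apply: cts_comp;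
    first [exact: op_B_continuous|exact: op_b_continuous|
           exact: op_iota_continuous|exact: op_even_continuous].
- by apply: tvs_continuousB; apply: cts_comp;
    first [exact: op_B_continuous|exact: op_b_continuous|
           exact: op_iota_continuous|exact: op_even_continuous].
have := p_even_hoch N (mulJA X_hausdorff D) (mulJDl X_hausdorff D)
  (mulJDr X_hausdorff D) (multi_tau C n.+1).
rewrite hochE p_even_post !evenE connesE !p_contrE_post !contrE_E p_hoch_post hochE.
rewrite (raddfN (@p_connes S A (C n.+1))) /= p_connes_post connesE postN.
exact: esym.
Qed.
End TensorMaps.

(** * The connection as a chain map *)

Section Chains.
Variables (R : realType) (J : open_interval R) (X : tvsType R[i]).
Variable C : forall n, tensor_power J X n.
Hypothesis X_hausdorff : hausdorff_space X.
Variables (D : deformation J X) (Q : cyclic_operators D C).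
Variables (N : connection J X) (G : gauss_manin_operators D C N).
Implicit Types c : chain C.

Lemma op_b0 n : op_b Q (0 : C n.+1) = 0.
Proof. exact: linear_fun0 (@op_b_linear _ _ _ _ _ Q n). Qed.

Lemma op_B0 n : op_B Q (0 : C n) = 0.
Proof. exact: linear_fun0 (@op_B_linear _ _ _ _ _ Q n). Qed.

Lemma op_bD n (x y : C n.+1) : op_b Q (x + y) = op_b Q x + op_b Q y.
Proof. exact: linear_additive (@op_b_linear _ _ _ _ _ Q n) _ _. Qed.

Lemma op_BD n (x y : C n) : op_B Q (x + y) = op_B Q x + op_B Q y.
Proof. exact: linear_additive (@op_B_linear _ _ _ _ _ Q n) _ _. Qed.

Lemma op_bBr n (x y : C n.+1) : op_b Q (x - y) = op_b Q x - op_b Q y.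
Proof. exact: (linear_subZ (@op_b_linear _ _ _ _ _ Q n)).1. Qed.

Lemma op_BBr n (x y : C n) : op_B Q (x - y) = op_B Q x - op_B Q y.
Proof. exact: (linear_subZ (@op_B_linear _ _ _ _ _ Q n)).1. Qed.

Lemma op_evenD n (x y : C n) : op_even G (x + y) = op_even G x + op_even G y.
Proof. exact: linear_additive (@op_even_linear _ _ _ _ _ _ G n) _ _. Qed.

Lemma op_even0 n : op_even G (0 : C n) = 0.
Proof. exact: linear_fun0 (@op_even_linear _ _ _ _ _ _ G n). Qed.

Lemma op_iotaD n (x y : C n.+2) : op_iota G (x + y) = op_iota G x + op_iota G y.
Proof. exact: linear_additive (@op_iota_linear _ _ _ _ _ _ G n) _ _. Qed.

Lemma op_iota0 n : op_iota G (0 : C n.+2) = 0.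
Proof. exact: linear_fun0 (@op_iota_linear _ _ _ _ _ _ G n). Qed.

Lemma bB_bB c n : bB Q (bB Q c) n = 0.
Proof.
rewrite /bB op_bD op_bb// add0r; case: n => [|n].
  by rewrite op_bB0// addr0.
rewrite op_BD addrA op_bB// add0r; case: n => [|n]; first exact: op_B0.
exact: op_BB.
Qed.

Lemma nabla_GM_E c n : nabla_GM G c n = op_even G (c n) - op_iota G (c n.+2).
Proof. by rewrite /nabla_GM /op_even opprD addrA addrAC. Qed.

Lemma bB_nabla_GM c n : bB Q (nabla_GM G c) n = nabla_GM G (bB Q c) n.
Proof.
have h1 (V : zmodType) (x y z w : V) : x + y - (z + w) = (x - w) + (y - z).
  by rewrite opprD [- z - w]addrC addrACA.
have h2 (V : zmodType) (x y z w : V) : (x - y) + (z - w) = (x - w) + (z - y).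
  by rewrite addrACA [- y - w]addrC addrACA.
rewrite nabla_GM_E /bB op_evenD op_iotaD nabla_GM_E op_bBr -op_iota_b// h1.
case: n => [|n]; first by rewrite op_even_b0// op_even0 add0r addr0.
by rewrite nabla_GM_E op_BBr op_even_bS// op_even_B// h2.
Qed.
End Chains.

(** * Flatness of formal cycles *)

Section FormalCycles.
Variables (R : realType) (J : open_interval R) (X : tvsType R[i]).
Variable C : forall n, tensor_power J X n.
Hypothesis X_hausdorff : hausdorff_space X.
Variables (D : deformation J X) (Q : cyclic_operators D C).
Variables (N : connection J X) (G : gauss_manin_operators D C N).
Notation S := R[i].
Variables (K : zmodType) (mul : K -> K -> K) (F : K -> K).
Hypothesis mulA : associative mul.
Hypothesis mulDl : forall a b c, mul (a + b) c = mul a c + mul b c.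
Hypothesis mulDr : forall a b c, mul a (b + c) = mul a b + mul a c.
Hypothesis FD : forall a b, F (a + b) = F a + F b.
(** An abstract copy of [tau] for words over K, later the trace of words of matrices. *)
Variable T : forall n, @functional S K (C n).
Hypothesis T_multi : forall n, multi (T n).
HB.instance Definition _ n :=
  GRing.isLinear.Build S (C n.+1) (C n) *:%R (op_b Q (n:=n)) (@op_b_linear _ _ _ _ _ Q n).
HB.instance Definition _ n :=
  GRing.isLinear.Build S (C n) (C n.+1) *:%R (op_B Q (n:=n)) (@op_B_linear _ _ _ _ _ Q n).
HB.instance Definition _ n :=
  GRing.isLinear.Build S (C n.+2) (C n) *:%R (op_iota G (n:=n)) (@op_iota_linear _ _ _ _ _ _ G n).
HB.instance Definition _ n :=
  GRing.isLinear.Build S (C n) (C n) *:%R (@op_even _ _ _ _ _ _ G n) (@op_even_linear _ _ _ _ _ _ G n).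
Hypothesis T_hoch : forall n, p_hoch mul (T n) = post (op_b Q (n:=n)) (T n.+1).
Hypothesis T_connes : forall n, p_connes (T n.+1) = post (op_B Q (n:=n)) (T n).
Hypothesis T_connes0 : p_connes (T 0) = 0.
Hypothesis T_contrE : forall n, p_contrE mul F (T n) = - post (op_iota G (n:=n)) (T n.+2).
Hypothesis T_even : forall n, p_even mul F (T n) = post (@op_even _ _ _ _ _ _ G n) (T n).

(* A boolean [true] marks the words that start with e, which is not written. *)
Definition formal_sum := seq (S * (bool * seq K)).

Definition ev (V : lmodType S) (Phi : @functional S K V) (l : formal_sum) : V :=
  \sum_(t <- l) t.1 *: (if t.2.1 then Phi.2 t.2.2 else Phi.1 t.2.2).

Lemma ev_post (V V' : lmodType S) (g : {linear V -> V'}) Phi l :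
  ev (post g Phi) l = g (ev Phi l).
Proof.
rewrite /ev linear_sum; apply: eq_bigr => t _; rewrite linearZ /=.
by case: ifP.
Qed.

Lemma evD (V : lmodType S) (Phi Psi : @functional S K V) l :
  ev (Phi + Psi) l = ev Phi l + ev Psi l.
Proof.
rewrite /ev -big_split; apply: eq_bigr => t _ /=; rewrite -scalerDr.
by case: ifP.
Qed.

Lemma evN (V : lmodType S) (Phi : @functional S K V) l : ev (- Phi) l = - ev Phi l.
Proof. by rewrite /ev -sumrN; apply: eq_bigr => t _; rewrite -scalerN; case: ifP. Qed.

Lemma ev0 (V : lmodType S) l : ev (0 : @functional S K V) l = 0.
Proof. by rewrite /ev big1// => t _; case: ifP; rewrite scaler0. Qed.

(** Quantifying over all functionals, and not only those factoring through C_n(A), expresses that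
    the relations hold between words over the ground field. *)
Definition formal_cycle (z : nat -> formal_sum) := forall (V : lmodType S) (Phi : @functional S K V),
  multi Phi -> ev (p_hoch mul Phi) (z 0%N) = 0 /\
  forall n, ev (p_hoch mul Phi) (z n.+1)
            + (if n is m.+1 then ev (p_connes Phi) (z m) else 0) = 0.

Definition realize (z : nat -> formal_sum) : chain C := fun n => ev (T n) (z n).

Lemma realize_cycle z : formal_cycle z -> HP_cycle Q (realize z).
Proof.
move=> zc n; have [_ /(_ n) <-] := zc _ _ (T_multi n).
rewrite /bB /realize T_hoch ev_post; congr (_ + _); case: n => [//|n].
by rewrite T_connes ev_post.
Qed.

(** J_nabla applied to z. It is formed from the formal sums and not from [realize z], since J_nabla
    is not defined on C_n(A). *)
Definition homotopy z : chain C := fun n =>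
  ev (p_contr mul F (T n)) (z n.+1)
  + (if n is m.+1 then ev (p_susp F (T n)) (z m) else 0).

Lemma realize_flat z n : formal_cycle z -> bB Q (homotopy z) n = nabla_GM G (realize z) n.
Proof.
move=> zc; rewrite nabla_GM_E /realize.
have -> : bB Q (homotopy z) n = ev (p_contr mul F (p_hoch mul (T n))) (z n.+2)
   + ev (p_susp F (p_hoch mul (T n)) + p_contr mul F (p_connes (T n))) (z n).
  rewrite /bB /homotopy op_bD -!ev_post -p_contr_post -p_susp_post -T_hoch.
  rewrite -addrA evD; congr (_ + (_ + _)); case: n => [|n].
    by rewrite T_connes0 raddf0 ev0.
  rewrite op_BD -!ev_post -p_contr_post T_connes -[RHS]addr0; congr (_ + _).
  case: n => [|n]; first exact: op_B0.
  by rewrite -ev_post -p_susp_post -T_connes p_susp_connes ev0.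
have -> : op_even G (ev (T n) (z n)) = ev (p_even mul F (T n)) (z n).
  by rewrite T_even ev_post.
have -> : op_iota G (ev (T n.+2) (z n.+2)) = - ev (p_contrE mul F (T n)) (z n.+2).
  by rewrite T_contrE evN ev_post opprK.
rewrite opprK p_evenE// -p_contrE_hoch// !evD.
have mc : multi (p_contr mul F (T n)) by exact: multi_contr.
have ms : multi (p_susp F (T n)) by exact: multi_susp.
(* J_nabla (b + B) z = 0 in two pieces: the cycle relation is tested on [T n] composed with the
   contraction and with the suspension. Then (b + B) J_nabla z equals [b + B, J_nabla] z. *)
have [_ /(_ n.+1) e1] := zc _ _ mc.
have e2 : ev (p_hoch mul (p_susp F (T n))) (z n) = 0.
  have [e0 en] := zc _ _ ms; case: n {e1 mc} ms e0 en => [//|n] ms e0 /(_ n) <-.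
  rewrite -[LHS]addr0; congr (_ + _); case: n {e0} ms => [//|n] ms.
  by rewrite p_connes_susp ev0.
move: e1 => /eqP; rewrite addr_eq0 => /eqP e1.
by rewrite e1 e2 add0r -[RHS]addrA [X in _ = _ + X]addrCA subrr addr0 addrC.
Qed.
End FormalCycles.

(** * Generalized trace *)

Section Trace.
Variables (S : nzRingType) (A : zmodType) (N : nat).
Notation M := 'M[A]_N.
Implicit Types w : seq M.

Section Walk.
Variable V : lmodType S.
Implicit Types phi psi : seq A -> V.

(* The sum of [phi] over the entries of the product of the matrices of [w]
   along all the paths from [i] to [j]. *)
Fixpoint walk w phi (i j : 'I_N) : V :=
  if w is m :: w' then \sum_k walk w' (fun s => phi (m i k :: s)) k j
  else if i == j then phi [::] else 0.

Definition Tr phi w := \sum_i walk w phi i i.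

Lemma walk_ext w phi psi i j : (forall s, size s = size w -> phi s = psi s) ->
  walk w phi i j = walk w psi i j.
Proof.
elim: w phi psi i j => [|m w IH] phi psi i j e /=; first by rewrite e.
by apply: eq_bigr => k _; apply: IH => s sw; rewrite e//= sw.
Qed.

Lemma Tr_ext w phi psi : (forall s, size s = size w -> phi s = psi s) ->
  Tr phi w = Tr psi w.
Proof. by move=> e; apply: eq_bigr => i _; exact: walk_ext. Qed.

Lemma walk_cat w1 w2 phi i j : walk (w1 ++ w2) phi i j =
  \sum_k walk w1 (fun s1 => walk w2 (fun s2 => phi (s1 ++ s2)) k j) i k.
Proof.
elim: w1 phi i j => [|m w1 IH] phi i j /=.
  rewrite (bigD1 i)//= eqxx big1 ?addr0// => k /negbTE ki.
  by rewrite eq_sym ki.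
rewrite exchange_big; apply: eq_bigr => l _; rewrite IH.
by apply: eq_bigr.
Qed.

Lemma walk_sum (I : Type) (r : seq I) (P : pred I) (f : I -> seq A -> V) w i j :
  walk w (fun s => \sum_(x <- r | P x) f x s) i j =
  \sum_(x <- r | P x) walk w (f x) i j.
Proof.
elim: w f i j => [|m w IH] f i j /=.
  by case: eqP => // _; rewrite big1.
by rewrite exchange_big; apply: eq_bigr => k _; rewrite IH.
Qed.

Lemma walkZ c phi w i j : walk w (fun s => c *: phi s) i j = c *: walk w phi i j.
Proof.
elim: w phi i j => [|m w IH] phi i j /=; first by case: eqP => //; rewrite scaler0.
by rewrite scaler_sumr; apply: eq_bigr => k _; rewrite IH.
Qed.

Lemma walkD phi psi w i j :
  walk w (fun s => phi s + psi s) i j = walk w phi i j + walk w psi i j.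
Proof.
elim: w phi psi i j => [|m w IH] phi psi i j /=; first by case: eqP; rewrite ?addr0.
by rewrite -big_split; apply: eq_bigr => k _; rewrite IH.
Qed.

Lemma Tr_sum (I : Type) (r : seq I) (P : pred I) (f : I -> seq A -> V) w :
  Tr (fun s => \sum_(x <- r | P x) f x s) w = \sum_(x <- r | P x) Tr (f x) w.
Proof.
rewrite /Tr exchange_big; apply: eq_bigr => i _; exact: walk_sum.
Qed.

Lemma TrZ c phi w : Tr (fun s => c *: phi s) w = c *: Tr phi w.
Proof. by rewrite /Tr scaler_sumr; apply: eq_bigr => i _; rewrite walkZ. Qed.

Lemma TrD phi psi w : Tr (fun s => phi s + psi s) w = Tr phi w + Tr psi w.
Proof. by rewrite /Tr -big_split; apply: eq_bigr => i _; rewrite walkD. Qed.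

Lemma Tr_sum_nat m n (f : nat -> seq A -> V) w :
  Tr (fun s => \sum_(m <= x < n) f x s) w = \sum_(m <= x < n) Tr (f x) w.
Proof. exact: Tr_sum. Qed.

Lemma Tr0 w : Tr (fun=> 0) w = 0.
Proof.
rewrite -[RHS](scale0r (Tr (fun=> 0) w)) -TrZ.
by apply: Tr_ext => s _; rewrite scaler0.
Qed.

(** A closed path may start at any of its vertices. *)
Lemma Tr_rotr phi w : Tr phi (rotr 1 w) = Tr (fun s => phi (rotr 1 s)) w.
Proof.
case/lastP: w => [//|w m]; rewrite rotr1_rcons -cats1 /Tr /=.
rewrite exchange_big; apply: eq_bigr => k _; rewrite walk_cat.
apply: eq_bigr => i _; apply: walk_ext => s sw /=.
rewrite (bigD1 k)//= eqxx big1 ?addr0; last by move=> l /negbTE ->.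
by rewrite cats1 rotr1_rcons.
Qed.

Lemma Tr_rotrn j phi w : (j <= size w)%N ->
  Tr phi (rotr j w) = Tr (fun s => phi (rotr j s)) w.
Proof.
elim: j phi => [|j IH] phi jw.
  by rewrite rotr0; apply: Tr_ext => s _; rewrite rotr0.
rewrite -(rotrSr 0)// Tr_rotr IH ?(ltnW jw)//; apply: Tr_ext => s sw.
by rewrite (rotrSr 0)// sw.
Qed.

Lemma walk_split w1 m w2 phi i j : walk (w1 ++ m :: w2) phi i j =
  \sum_k \sum_l walk w1 (fun s1 => walk w2 (fun s2 => phi (s1 ++ m k l :: s2)) l j) i k.
Proof.
rewrite walk_cat; apply: eq_bigr => k _ /=.
by rewrite -walk_sum.
Qed.

Lemma Tr_apply f p phi w : (p < size w)%N ->
  Tr phi (apply_at 0 (map_mx f) p w) = Tr (fun s => phi (apply_at 0 f p s)) w.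
Proof.
move=> pw; rewrite -[in RHS](size_upd_id 0 pw) /apply_at /upd.
apply: eq_bigr => i _; rewrite !walk_split; apply: eq_bigr => k _.
apply: eq_bigr => l _; apply: walk_ext => s1 s1w; apply: walk_ext => s2 s2w.
have s1p : size s1 = p by rewrite s1w size_takel// ltnW.
congr phi; rewrite take_cat s1p ltnn subnn take0 cats0 nth_cat s1p ltnn subnn /=.
rewrite mxE; congr (_ ++ _ :: _).
by rewrite drop_cat s1p ltnNge leqnSn /= subSnn /= drop0.
Qed.

Lemma multiadditive_cat_sum n phi s1 s2 (I : Type) (r : seq I) (f : I -> A) :
  multiadditive n phi -> (size s1 + size s2).+1 = n ->
  phi (s1 ++ \sum_(x <- r) f x :: s2) = \sum_(x <- r) phi (s1 ++ f x :: s2).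
Proof.
move=> ma sn; have updE a b : upd (s1 ++ a :: s2) (size s1) b = s1 ++ b :: s2.
  rewrite /upd take_size_cat// drop_cat ltnNge leqnSn /= subSnn /= drop0//.
have sa a : size (s1 ++ a :: s2) = n by rewrite size_cat /= addnS.
have pn : (size s1 < n)%N by rewrite -sn ltnS leq_addr.
elim: r => [|x r IH]; rewrite ?big_nil ?big_cons.
  by rewrite -(updE 0) (multiadditive0 ma).
by rewrite -(updE 0) ma// !updE IH.
Qed.

Definition mx_op (op : A -> A -> A) (m m' : M) : M :=
  \matrix_(i, j) \sum_k op (m i k) (m' k j).

Lemma join_split op x y (s1 s2 : seq A) :
  join_at 0 op (size s1) (s1 ++ x :: y :: s2) = s1 ++ op x y :: s2.
Proof.
rewrite /join_at take_size_cat// !nth_cat ltnn subnn ltnNge leqnSn /= subSnn /=.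
rewrite drop_cat ltnNge (leq_trans (leqnSn _) (leqnSn _))/=.
have -> : ((size s1).+2 - size s1 = 2)%N by lia.
by rewrite /= drop0.
Qed.

(** By additivity the sum inside a matrix product becomes the sum over the vertex of the path that
    the join erases. *)
Lemma Tr_join op q phi w : multiadditive (size w).-1 phi -> (q.+1 < size w)%N ->
  Tr phi (join_at 0 (mx_op op) q w) = Tr (fun s => phi (join_at 0 op q s)) w.
Proof.
move=> ma qw; rewrite -[in RHS](size_upd_id 0 (ltnW qw)) /upd (drop_nth 0 qw) /join_at.
set m := w`_q; set m' := w`_q.+1; set w1 := take q w; set w2 := drop q.+2 w.
have w1q : size w1 = q by rewrite size_takel// ltnW// ltnW.
have w2q : size w2 = (size w - q.+2)%N by rewrite size_drop.
apply: eq_bigr => i _; rewrite !walk_split; apply: eq_bigr => k _.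
transitivity (\sum_l \sum_h walk w1 (fun s1 => walk w2
   (fun s2 => phi (s1 ++ op (m k h) (m' h l) :: s2)) l i) i k).
  apply: eq_bigr => l _; rewrite -walk_sum; apply: walk_ext => s1 s1w.
  rewrite -walk_sum; apply: walk_ext => s2 s2w; rewrite mxE.
  apply: multiadditive_cat_sum ma _.
  by rewrite s1w s2w w1q w2q; lia.
rewrite exchange_big /=; apply: eq_bigr => h _; rewrite -walk_sum.
apply: walk_ext => s1 s1w; apply: eq_bigr => l _.
apply: walk_ext => s2 s2w; congr phi.
by rewrite -[in RHS]w1q -s1w -/(join_at 0 op _ _) join_split.
Qed.

Lemma multiadditive_Tr n phi : multiadditive n phi -> multiadditive n (Tr phi).
Proof.
move=> ma w p a b wn pn; rewrite /upd /Tr -big_split; apply: eq_bigr => i _ /=.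
rewrite !walk_split -big_split; apply: eq_bigr => k _ /=.
rewrite -big_split; apply: eq_bigr => l _ /=.
rewrite -walkD; apply: walk_ext => s1 s1w.
rewrite -walkD; apply: walk_ext => s2 s2w.
have := @multiadditive_cat_sum n phi s1 s2 bool [:: true; false]
  (fun x => if x then a k l else b k l) ma.
rewrite !big_cons !big_nil !addr0 mxE; apply.
by rewrite s1w s2w size_takel ?size_drop wn; lia.
Qed.
End Walk.

Lemma walk_post (V V' : lmodType S) (g : {linear V -> V'}) (phi : seq A -> V) w i j :
  walk w (g \o phi) i j = g (walk w phi i j).
Proof.
elim: w phi i j => [|m w IH] phi i j /=; first by case: eqP => //; rewrite linear0.
rewrite linear_sum; apply: eq_bigr => k _.
by rewrite -IH.
Qed.

Lemma Tr_post (V V' : lmodType S) (g : {linear V -> V'}) (phi : seq A -> V) :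
  Tr (g \o phi) = g \o Tr phi.
Proof.
apply/funext => w; rewrite /Tr /= linear_sum; apply: eq_bigr => i _.
exact: walk_post.
Qed.

Section TracePairs.
Variables (V : lmodType S) (mul : A -> A -> A) (F : A -> A).
Hypothesis mulDl : forall a b c, mul (a + b) c = mul a c + mul b c.
Hypothesis mulDr : forall a b c, mul a (b + c) = mul a b + mul a c.
Hypothesis FD : forall a b, F (a + b) = F a + F b.
Implicit Types (phi : seq A -> V) (Phi : @functional S A V).
Notation mulM := (mx_op mul).
Notation FM := (map_mx F : M -> M).

Definition trace_pair Phi : @functional S M V := (Tr Phi.1, Tr Phi.2).

Lemma multi_trace Phi : multi Phi -> multi (trace_pair Phi).
Proof. by move=> ma n; have [m1 m2] := ma n; split; exact: multiadditive_Tr. Qed.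

(** F acts entrywise and passes through the sum over the middle index. *)
Lemma defect_mx : defect mulM FM = mx_op (defect mul F).
Proof.
have F0 : F 0 = 0 by apply: (addrI (F 0)); rewrite -FD !addr0.
have Fsum (f : 'I_N -> A) : F (\sum_k f k) = \sum_k F (f k).
  by apply: (big_morph F FD F0).
apply/funext => m; apply/funext => m'; apply/matrixP => i j.
rewrite !mxE Fsum -big_split -sumrB; apply: eq_bigr => k _ /=.
by rewrite !mxE.
Qed.

Lemma Tr_cyc phi : cyc (Tr phi) = Tr (cyc phi).
Proof.
apply/funext => w; rewrite /cyc Tr_rotr -TrZ.
by apply: Tr_ext => s ->.
Qed.

Lemma Tr_norm phi : norm (Tr phi) = Tr (norm phi).
Proof.
apply/funext => w; rewrite /norm.
rewrite (@Tr_ext _ w _ (fun s => \sum_(0 <= j < size w)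
   (-1) ^+ (j * (size w).-1) *: phi (rotr j s))); last by move=> s ->.
rewrite Tr_sum; apply: eq_big_nat => j /= jw.
by rewrite TrZ Tr_rotrn// ltnW.
Qed.

Lemma Tr_bar phi : (forall n, multiadditive n phi) -> bar mulM (Tr phi) = Tr (bar mul phi).
Proof.
move=> ma; apply/funext => w; rewrite /bar.
rewrite (@Tr_ext _ w _ (fun s => \sum_(0 <= q < (size w).-1)
   (-1) ^+ q *: phi (join_at 0 mul q s))); last by move=> s ->.
rewrite Tr_sum; apply: eq_big_nat => q /= qw.
by rewrite TrZ Tr_join//; size_lia w.
Qed.

Lemma Tr_hoch phi : (forall n, multiadditive n phi) -> hoch mulM (Tr phi) = Tr (hoch mul phi).
Proof.
move=> ma; apply/funext => w; rewrite /hoch TrD Tr_bar//; congr (_ + _).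
case: ifP => w1; last first.
  by rewrite (@Tr_ext _ w _ (fun=> 0)) ?Tr0// => s ->; rewrite w1.
rewrite (@Tr_ext _ w _ (fun s => (-1) ^+ (size w).-1 *:
   phi (join_at 0 mul 0 (rotr 1 s)))); last by move=> s ->; rewrite w1.
by rewrite TrZ Tr_join ?size_rotr// Tr_rotr.
Qed.

Lemma Tr_lie phi : lie FM (Tr phi) = Tr (lie F phi).
Proof.
apply/funext => w; rewrite /lie.
rewrite (@Tr_ext _ w _ (fun s => \sum_(0 <= p < size w) phi (apply_at 0 F p s))); last first.
  by move=> s ->.
by rewrite Tr_sum; apply: eq_big_nat => p /= pw; rewrite Tr_apply.
Qed.

Lemma Tr_contrE phi : (forall n, multiadditive n phi) ->
  contrE mulM FM (Tr phi) = Tr (contrE mul F phi).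
Proof.
move=> ma; apply/funext => w; rewrite /contrE.
case: ifP => w2; last first.
  by rewrite (@Tr_ext _ w _ (fun=> 0)) ?Tr0// => s ->; rewrite w2.
rewrite (@Tr_ext _ w (fun s => if (2 < size s)%N then _ else _)
  (fun s => phi (join_at 0 mul 0 (join_at 0 (defect mul F) 1 s)))); last first.
  by move=> s ->; rewrite w2.
rewrite defect_mx Tr_join//; last by rewrite size_join_at//; size_lia w.
rewrite (@Tr_join V (defect mul F) 1 (fun s => phi (join_at 0 mul 0 s)))//.
have -> : (size w).-1 = (size w).-2.+1 by size_lia w.
by apply: multiadditive_join => //; size_lia w.
Qed.

Lemma Tr_contrE0 phi : (forall n, multiadditive n phi) ->
  contrE0 mulM FM (Tr phi) = Tr (contrE0 mul F phi).
Proof.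
move=> ma; apply/funext => w; rewrite /contrE0.
case: ifP => w2; last first.
  by rewrite (@Tr_ext _ w _ (fun=> 0)) ?Tr0// => s ->; rewrite w2.
rewrite (@Tr_ext _ w (fun s => if (1 < size s)%N then _ else _)
  (fun s => phi (join_at 0 (defect mul F) 0 s))); last first.
  by move=> s ->; rewrite w2.
by rewrite defect_mx Tr_join.
Qed.

Lemma Tr_suspE phi : (forall n, multiadditive n phi) ->
  suspE mulM FM (Tr phi) = Tr (suspE mul F phi).
Proof.
move=> ma; apply/funext => w; rewrite /suspE.
rewrite (@Tr_ext _ w (fun s => \sum_(0 <= j < (size s).-1) _)
  (fun s => \sum_(0 <= j < (size w).-1) \sum_(j.+1 <= r < (size w).-1)
    (-1) ^+ (r + j * (size w).-1) *: phi (join_at 0 (defect mul F) r (rotr j s)))); last first.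
  by move=> s ->.
rewrite Tr_sum; apply: eq_big_nat => j /= jw; rewrite Tr_sum_nat.
apply: eq_big_nat => r /= jr; rewrite TrZ defect_mx Tr_join ?size_rotr//; last by size_lia w.
by rewrite Tr_rotrn//; size_lia w.
Qed.

Lemma trace_hoch Phi : multi Phi -> p_hoch mulM (trace_pair Phi) = trace_pair (p_hoch mul Phi).
Proof.
move=> ma; have m1 n := (ma n).1; have m2 n := (ma n).2.
congr pair; rewrite /= ?Tr_hoch// Tr_cyc Tr_bar//; apply/funext => w.
rewrite !fctE /= -[in RHS]/(Tr (fun s => Phi.1 s - cyc Phi.1 s - bar mul Phi.2 s) w).
have -> : (fun s => Phi.1 s - cyc Phi.1 s - bar mul Phi.2 s) =
   (fun s => (Phi.1 s + (-1) *: cyc Phi.1 s) + (-1) *: bar mul Phi.2 s).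
  by apply/funext => s; rewrite !scaleN1r.
by rewrite !TrD !TrZ !scaleN1r.
Qed.

Lemma trace_connes Phi : p_connes (trace_pair Phi) = trace_pair (p_connes Phi).
Proof. by congr pair; rewrite /= ?Tr_norm//; apply/funext => w; rewrite Tr0. Qed.

Lemma trace_contrE Phi : multi Phi ->
  p_contrE mulM FM (trace_pair Phi) = trace_pair (p_contrE mul F Phi).
Proof.
move=> ma; have m1 n := (ma n).1.
by congr pair; rewrite /= ?Tr_contrE// Tr_contrE0.
Qed.

Lemma trace_even Phi : multi Phi ->
  p_even mulM FM (trace_pair Phi) = trace_pair (p_even mul F Phi).
Proof.
move=> ma; have m1 n := (ma n).1; have m2 n := (ma n).2.
congr pair; rewrite /= !Tr_lie ?Tr_suspE//; apply/funext => w; rewrite !fctE /=.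
  have -> : Tr (lie F Phi.1 - suspE mul F Phi.2) =
      Tr (fun s => lie F Phi.1 s + (-1) *: suspE mul F Phi.2 s).
    by congr Tr; apply/funext => s; rewrite scaleN1r.
  by rewrite TrD TrZ scaleN1r.
by rewrite subr0; apply: Tr_ext => s _; rewrite subr0.
Qed.
End TracePairs.
End Trace.

(** * Paths as tuples of indices *)

Section IndexSums.
Variable I : finType.

Definition fcons n (x : I) (f : {ffun 'I_n -> I}) : {ffun 'I_n.+1 -> I} :=
  [ffun k => oapp f x (unlift ord0 k)].

Lemma sum_fcons (V : zmodType) n (G : {ffun 'I_n.+1 -> I} -> V) :
  \sum_g G g = \sum_x \sum_(f : {ffun 'I_n -> I}) G (fcons x f).
Proof.
rewrite pair_big (reindex (fun p : I * {ffun 'I_n -> I} => fcons p.1 p.2)) //=.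
exists (fun g : {ffun 'I_n.+1 -> I} => (g ord0, [ffun k => g (lift ord0 k)])) => [[x f]|g] _.
  rewrite /= ffunE unlift_none; congr pair; apply/ffunP => k.
  by rewrite !ffunE liftK.
by apply/ffunP => k; rewrite ffunE; case: unliftP => [j ->|->] //=; rewrite ffunE.
Qed.

(* Indices beyond the domain of [f] are sent to [x]. *)
Definition fext n (f : {ffun 'I_n -> I}) x (t : nat) : I := oapp f x (insub t).

Lemma fext_cons0 n x (f : {ffun 'I_n -> I}) y : fext (fcons x f) y 0 = x.
Proof.
rewrite /fext; case: insubP => //= k _ k0.
by have -> : k = ord0 by [exact: val_inj]; rewrite ffunE unlift_none.
Qed.

Lemma fext_consS n x (f : {ffun 'I_n -> I}) y t :
  fext (fcons x f) y t.+1 = fext f y t.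
Proof.
rewrite /fext; case: insubP => [k kn /= kt|]; last by rewrite ltnS; case: insubP => //= ? ->.
case: insubP => [j jn /= jt|]; last by rewrite -ltnS -kt ltn_ord.
have -> : k = lift ord0 j by apply: val_inj; rewrite /= /bump /= kt jt.
by rewrite ffunE liftK.
Qed.

Lemma fext_ord n (f : {ffun 'I_n -> I}) x (k : 'I_n) : fext f x k = f k.
Proof. by rewrite /fext valK. Qed.

(** The default value g 0 closes the path: the index n + 1 wraps to 0, as it does under [ordS]. *)
Lemma fext_ordS n (g : {ffun 'I_n.+1 -> I}) (k : 'I_n.+1) :
  fext g (g ord0) k.+1 = g (ordS k).
Proof.
rewrite /fext; case: insubP => [j jn /= jk|].
  by congr (g _); apply: val_inj; rewrite /= jk modn_small// -jk.
rewrite -leqNgt => kn /=; congr (g _); apply: val_inj => /=.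
have -> : k.+1 = n.+1 by apply/eqP; rewrite eqn_leq kn ltn_ord.
by rewrite modnn.
Qed.
End IndexSums.

Section TraceTensor.
Variables (S : nzRingType) (A : zmodType) (N : nat) (V : lmodType S).
Implicit Types (w : seq 'M[A]_N).

Lemma mkseqS (T : Type) (f : nat -> T) n : mkseq f n.+1 = f 0%N :: mkseq (f \o succn) n.
Proof. by rewrite /mkseq /= -[1%N]addn0 iotaDl -map_comp. Qed.

(** [psi] depends on the starting vertex because the letter split off in the induction has its
    second index there. The default value j of [fext] supplies the final vertex. *)
Lemma sum_walk n w (psi : 'I_N -> seq A -> V) j : size w = n ->
  \sum_k walk w (psi k) k j = \sum_(f : {ffun 'I_n -> 'I_N})
    psi (fext f j 0) (mkseq (fun t => w`_t (fext f j t) (fext f j t.+1)) n).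
Proof.
elim: w n psi => [|m w IH] n psi /= wn; subst n.
  rewrite (bigD1 j)//= eqxx big1 ?addr0; last by move=> k /negbTE ->.
  rewrite (eq_bigr (fun=> psi j [::])); last by move=> f _; rewrite /fext insubF.
  by rewrite sumr_const card_ffun !card_ord expn0.
rewrite sum_fcons; apply: eq_bigr => k _.
rewrite (IH _ (fun l s => psi k (m k l :: s)) erefl); apply: eq_bigr => f _.
rewrite fext_cons0 mkseqS /= fext_cons0 fext_consS; congr (psi _ (_ :: _)).
by apply: eq_mkseq => t /=; rewrite !fext_consS.
Qed.

Lemma Tr_ffun n w (phi : seq A -> V) : size w = n.+1 ->
  Tr phi w = \sum_(g : {ffun 'I_n.+1 -> 'I_N})
    phi (mkseq (fun t => w`_t (fext g (g ord0) t) (fext g (g ord0) t.+1)) n.+1).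
Proof.
case: w => [//|m w] [wn]; rewrite sum_fcons; apply: eq_bigr => i _ /=.
rewrite (sum_walk (fun k s => phi (m i k :: s)) i wn); apply: eq_bigr => f _.
have -> : fcons i f ord0 = i by rewrite ffunE unlift_none.
rewrite mkseqS /= fext_cons0 fext_consS; congr (phi (_ :: _)).
by apply: eq_mkseq => t /=; rewrite !fext_consS.
Qed.
End TraceTensor.

Section TraceTensorTau.
Variables (R : realType) (J : open_interval R) (X : tvsType R[i]).
Variable C : forall n, tensor_power J X n.
Notation A := (Cinf J X).
Variable N : nat.
Implicit Types (w : seq 'M[A]_N).

Lemma trace_tensor_alg n (M0 : 'M[A]_N) w : size w = n ->
  trace_tensor C n M0 0 w = Tr (tau_alg C n) (M0 :: w).
Proof.
move=> wn; rewrite (@Tr_ffun _ _ _ _ n)/= ?wn//; apply: eq_bigr => g _.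
rewrite mkseqS /= tau_algE ?size_mkseq// if_same /tensor; congr pure_tensor.
  congr pair; rewrite -fext_ordS; congr (M0 _ _).
  by rewrite -[0%N]/(nat_of_ord (@ord0 n)) fext_ord.
apply/funext => k; rewrite nth_mkseq//=; congr (nth 0 w k _ _).
  by rewrite -[k.+1]/(nat_of_ord (lift ord0 k)) fext_ord.
by rewrite -fext_ordS.
Qed.

(** The identity matrix forces the first two indices to agree, which leaves closed paths of length
    n. In degree 0 both sides vanish, as C_0(A) has no unit part. *)
Lemma trace_tensor_unit n w : size w = n ->
  trace_tensor C n 0 (unit_e J X).2 w = Tr (tau_unit C n) w.
Proof.
case: n => [|n] wn.
  have [_ _ _ _ pure0] := pure_tensor_form (C 0%N).
  rewrite /trace_tensor big1 => [|i _]; last by rewrite mxE; exact: pure0.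
  rewrite /Tr big1// => i _; case: w wn => // _ /=; rewrite eqxx tau_unitE//.
  exact: tensor00.
rewrite (Tr_ffun _ wn) /trace_tensor sum_fcons exchange_big; apply: eq_bigr => f _ /=.
have f1 i : fcons i f (ordS ord0) = f ord0.
  rewrite -fext_ordS /= fext_consS -[0%N]/(nat_of_ord (@ord0 n)).
  by rewrite fext_ord.
have f0 i : fcons i f ord0 = i by rewrite ffunE unlift_none.
rewrite (bigD1 (f ord0))//= [X in _ + X]big1 ?addr0; last first.
  move=> i /negbTE ni; rewrite f1 f0 ni mxE.
  have [_ lin _ _ _] := pure_tensor_form (C n.+1).
  exact: linear_fun0 (lin _).
rewrite f1 f0 eqxx mxE tau_unitE ?size_mkseq// /tensor; congr pure_tensor.
apply/funext => k; rewrite nth_mkseq//; congr (nth 0 w k _ _).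
  by rewrite fext_ord ffunE liftK.
by rewrite -fext_ordS f0 /= fext_consS.
Qed.
End TraceTensorTau.

(** * Chern characters as formal cycles *)

Section FormalCharacters.
Variable R : realType.
Notation S := R[i].
Variables (K : zmodType) (mul : K -> K -> K).

Lemma alternating_sum (V : lmodType S) m (x : V) :
  \sum_(0 <= q < m) (-1) ^+ q *: x = if odd m then x else 0.
Proof.
elim: m => [|m IH]; first by rewrite big_geq.
rewrite big_nat_recr//= IH -signr_odd; case: (odd m) => /=.
  by rewrite expr1 scaleN1r subrr.
by rewrite expr0 scale1r add0r.
Qed.

Section Idempotent.
#[local] Arguments nseq : simpl never.
Variable P : K.
Hypothesis PP : mul P P = P.

Lemma nth_nseq_lt n i : (i < n)%N -> (nseq n P)`_i = P.
Proof. by move=> i_n; rewrite nth_nseq i_n. Qed.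

Lemma rotr_nseq j n : (j <= n)%N -> rotr j (nseq n P) = nseq n P.
Proof.
move=> jn; apply: (@eq_from_nth _ 0); first by rewrite size_rotr.
move=> i; rewrite size_rotr size_nseq => i_n.
rewrite nth_rotr ?size_nseq// [RHS]nth_nseq_lt//.
by case: ltnP => ij; rewrite nth_nseq_lt//; lia.
Qed.

Lemma join_nseq q n : (q < n)%N -> join_at 0 mul q (nseq n.+1 P) = nseq n P.
Proof.
move=> qn; apply: (@eq_from_nth _ 0).
  by rewrite size_join_at !size_nseq.
move=> i; rewrite size_join_at ?size_nseq// -[n.+1.-1]/n => i_n.
rewrite nth_join_at ?size_nseq// (nth_nseq_lt i_n).
by case: ltngtP => iq; rewrite !nth_nseq_lt ?PP//; lia.
Qed.

Definition ch_coef n : S := (-1) ^+ n./2 * (n`!%:R / n./2`!%:R).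

Definition formal_ch_idempotent n : formal_sum R K :=
  if odd n then [::] else if n == 0%N then [:: (1, (false, [:: P]))]
  else [:: (ch_coef n, (false, nseq n.+1 P)); (- (ch_coef n / 2), (true, nseq n P))].

(** The recursion by which the words with e in b (ch P) in degree 2k + 2 cancel B (ch P) in degree
    2k. *)
Lemma ch_coefSS k : ch_coef k.*2.+2 / 2 = - (ch_coef k.*2 * k.*2.+1%:R).
Proof.
rewrite /ch_coef /= doubleK !factS !natrM exprS mulN1r !mulNr; congr (- _).
have k1 : (k.+1%:R : S) != 0 by rewrite pnatr_eq0.
have kf : (k`!%:R : S) != 0 by rewrite pnatr_eq0 -lt0n fact_gt0.
have two : (2 : S) != 0 by rewrite pnatr_eq0.
have -> : (k.*2.+2%:R : S) = 2 * k.+1%:R by rewrite -natrM mul2n doubleS.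
rewrite -!mulrA; congr (_ * _).
rewrite invfM !mulrA [2 * _]mulrC -!mulrA.
move: (k.+1%:R : S) k1 (k`!%:R : S) kf => a a0 c c0.
by field; rewrite a0 c0.
Qed.

(** On words in P alone, b leaves one copy of the shorter word and 1 - t doubles it, which explains
    the coefficient 1/2. The remaining - b' on words with e is cancelled by B, where the norm counts
    2k + 1 equal rotations. *)
Lemma formal_ch_idempotent_cycle : formal_cycle mul formal_ch_idempotent.
Proof.
move=> V [phi psi] ma; split=> [|n].
  by rewrite /ev big_seq1 scale1r/= hoch_small.
have bar_odd (chi : seq K -> V) k : bar mul chi (nseq k.*2.+2 P) = chi (nseq k.*2.+1 P).
  transitivity (\sum_(0 <= q < k.*2.+1) (-1) ^+ q *: chi (nseq k.*2.+1 P)).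
    by rewrite /bar size_nseq; apply: eq_big_nat => q /= qk; rewrite join_nseq.
  by rewrite alternating_sum /= odd_double.
case: n => [|n]; first by rewrite /ev !big_nil /= addr0.
rewrite /formal_ch_idempotent /= negbK; case: ifPn => n1.
  by rewrite /ev !big_nil /= addr0.
have [k ->] : exists k, n = k.*2.
  by exists n./2; rewrite -[LHS]odd_double_half; move: n1; case: (odd n).
rewrite {n n1}.
have hochE : hoch mul phi (nseq k.*2.+3 P) = phi (nseq k.*2.+2 P).
  rewrite /hoch size_nseq /= rotr_nseq// join_nseq// /bar size_nseq /=.
  have -> : \sum_(0 <= q < k.*2.+2) (-1) ^+ q *: phi (join_at 0 mul q (nseq k.*2.+3 P)) =
     \sum_(0 <= q < k.*2.+2) (-1) ^+ q *: phi (nseq k.*2.+2 P).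
    by apply: eq_big_nat => q /= qk; rewrite join_nseq.
  rewrite alternating_sum /= odd_double /= add0r -signr_odd /= odd_double.
  by rewrite expr0 scale1r.
have cycE : cyc phi (nseq k.*2.+2 P) = - phi (nseq k.*2.+2 P).
  rewrite /cyc size_nseq rotr_nseq// -signr_odd /= odd_double.
  by rewrite expr1 scaleN1r.
have normE : norm psi (nseq k.*2.+1 P) = k.*2.+1%:R *: psi (nseq k.*2.+1 P).
  rewrite /norm size_nseq -[k.*2.+1 in RHS]subn0 scaler_nat -sumr_const_nat.
  apply: eq_big_nat => j /= jk; rewrite rotr_nseq; last by lia.
  by rewrite -signr_odd oddM odd_double andbF expr0 scale1r.
have -> : ev (p_hoch mul (phi, psi))
  [:: (ch_coef k.*2.+2, (false, nseq k.*2.+3 P)); (- (ch_coef k.*2.+2 / 2), (true, nseq k.*2.+2 P))]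
  = (ch_coef k.*2.+2 / 2) *: psi (nseq k.*2.+1 P).
  rewrite /ev big_cons big_seq1 /= !fctE /= hochE cycE bar_odd opprK.
  set x := phi _; set y := psi _; set c := ch_coef _.
  rewrite scaleNr -scalerN opprB scalerDr scalerN addrCA -[RHS]addr0; congr (_ + _).
  by rewrite scalerDr -scalerDl -splitr subrr.
have -> : ev (p_connes (phi, psi)) (if k.*2 == 0%N
    then [:: (1, (false, [:: P]))] else [:: (ch_coef k.*2, (false, nseq k.*2.+1 P));
      (- (ch_coef k.*2 / 2), (true, nseq k.*2 P))]) = (ch_coef k.*2 * k.*2.+1%:R) *: psi (nseq k.*2.+1 P).
  case: eqP => [k0|_].
    rewrite /ev big_seq1 /=; move: normE; rewrite k0 /= => ->.
    by rewrite /ch_coef /= !mulr1 divr1 scalerA.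
  rewrite /ev big_cons big_seq1 /= normE scalerA.
  by rewrite scaler0 addr0.
by rewrite ch_coefSS scaleNr addNr.
Qed.
End Idempotent.

Section Invertible.
Variables x y : K.
Hypothesis xy : mul x y = - (x + y).
Hypothesis yx : mul y x = - (x + y).
Variable V : lmodType S.
Implicit Types phi psi : seq K -> V.

(** The word starts with x if b is true, and with y otherwise. *)
Definition alt b n := mkseq (fun t => if odd t (+) b then x else y) n.

Lemma size_alt b n : size (alt b n) = n. Proof. exact: size_mkseq. Qed.

Lemma nth_alt b n t : (t < n)%N -> (alt b n)`_t = if odd t (+) b then x else y.
Proof. exact: nth_mkseq. Qed.

Definition delete q (w : seq K) := take q w ++ drop q.+1 w.

Lemma size_delete q w : (q < size w)%N -> size (delete q w) = (size w).-1.
Proof. by move=> qw; rewrite size_cat size_takel ?size_drop; lia. Qed.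

Lemma nth_delete q w t : (q < size w)%N ->
  (delete q w)`_t = if (t < q)%N then w`_t else w`_t.+1.
Proof.
move=> qw; rewrite nth_cat size_takel ?(ltnW qw)//.
case: ltnP => tq; first by rewrite nth_take.
by rewrite nth_drop; congr nth; lia.
Qed.

(** Joining replaces two letters by minus their sum, which is minus the two ways of deleting one of
    them. *)
Lemma join_delete phi q w n : multiadditive n phi -> size w = n.+1 -> (q < n)%N ->
  mul w`_q w`_q.+1 = - (w`_q + w`_q.+1) ->
  phi (join_at 0 mul q w) = - phi (delete q w) - phi (delete q.+1 w).
Proof.
move=> ma wn qn e.
have sd : size (delete q w) = n by rewrite size_delete wn// ltnW.
have -> : join_at 0 mul q w = upd (delete q w) q (- (w`_q + w`_q.+1)).
  apply: (@eq_from_nth _ 0); first by rewrite [RHS]size_upd ?size_join_at ?sd ?wn.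
  move=> i; rewrite size_join_at wn// => i_n.
  rewrite nth_join_at ?wn// nth_upd ?sd// nth_delete ?wn; last by lia.
  by rewrite e; case: ltngtP => //; lia.
have dq : upd (delete q w) q w`_q.+1 = delete q w.
  rewrite -[RHS](@size_upd_id _ 0 _ q) ?sd// nth_delete ?wn; last by lia.
  by rewrite ltnn.
have dqS : upd (delete q w) q w`_q = delete q.+1 w.
  apply: (@eq_from_nth _ 0); first by rewrite size_upd ?sd// size_delete wn.
  move=> i; rewrite size_upd sd// => i_n.
  rewrite nth_upd ?sd// !nth_delete ?wn//; last by lia.
  by rewrite ltnS; case: ltngtP => // ->.
rewrite (multiadditiveN _ ma) ?sd// ma ?sd// dq dqS opprD addrC.
by [].
Qed.

Lemma alternate_mul b n q : (q.+1 < n)%N ->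
  mul (alt b n)`_q (alt b n)`_q.+1 = - ((alt b n)`_q + (alt b n)`_q.+1).
Proof.
move=> qn; rewrite !nth_alt ?(ltnW qn)//=.
by case: (odd q); case: b; rewrite /= ?xy ?yx // addrC.
Qed.

Lemma telescope_delete (D : nat -> V) m :
  \sum_(0 <= q < m.+1) (-1) ^+ q *: (- D q - D q.+1) = - D 0%N - (-1) ^+ m *: D m.+1.
Proof.
elim: m => [|m IH]; first by rewrite big_nat1 expr0 !scale1r.
rewrite big_nat_recr//= IH exprS mulN1r !scaleNr scalerDr !scalerN opprD !opprK.
rewrite -!addrA; congr (_ + _).
by rewrite addrA addNr add0r.
Qed.

Lemma delete0_alt b m : delete 0 (alt b m.+1) = alt (~~ b) m.
Proof.
apply: (@eq_from_nth _ 0); first by rewrite size_delete !size_alt.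
move=> i; rewrite size_delete !size_alt// => im.
rewrite nth_delete ?size_alt// !nth_alt//=; last exact: ltnW.
by case: (odd i); case: b.
Qed.

Lemma delete_last_alt b m : delete m (alt b m.+1) = alt b m.
Proof.
apply: (@eq_from_nth _ 0); first by rewrite size_delete !size_alt.
move=> i; rewrite size_delete !size_alt// => im.
by rewrite nth_delete ?size_alt// im !nth_alt// ltnW.
Qed.

(** The deletions telescope; those of the first and of the last letter survive, and they leave
    alternating words. *)
Lemma bar_alt phi b m : multiadditive m.+1 phi ->
  bar mul phi (alt b m.+2) = - phi (alt (~~ b) m.+1) - (-1) ^+ m *: phi (alt b m.+1).
Proof.
move=> ma; rewrite /bar size_alt /= -delete0_alt -[alt b m.+1]delete_last_alt.
rewrite -(telescope_delete (fun q => phi (delete q (alt b m.+2)))).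
apply: eq_big_nat => q /= qm; congr (_ *: _).
apply: (join_delete ma); rewrite ?size_alt//.
exact: alternate_mul.
Qed.

Lemma rotr_alt_even j b k : (j <= k.*2)%N ->
  rotr j (alt b k.*2) = alt (b (+) odd j) k.*2.
Proof.
move=> jk; apply: (@eq_from_nth _ 0); first by rewrite size_rotr !size_alt.
move=> i; rewrite size_rotr !size_alt => ik.
rewrite nth_rotr ?size_alt//; case: ltnP => ij; rewrite !nth_alt//; try lia.
  rewrite oddD oddB// odd_double.
  by case: (odd i); case: (odd j); case: b.
by rewrite oddB//; case: (odd i); case: (odd j); case: b.
Qed.

(** Both sides are x x y x ... y x y, which is not alternating; this is the rotated word that 1 - t
    requires. *)
Lemma delete1_alt k : delete 1 (alt true k.+1.*2) = rotr 1 (alt true k.*2.+1).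
Proof.
apply: (@eq_from_nth _ 0); first by rewrite size_delete ?size_rotr !size_alt// doubleS.
move=> i; rewrite size_delete !size_alt doubleS// => ik.
rewrite nth_delete ?size_alt// nth_rotr ?size_alt//.
case: i ik => [|i] ik.
  by rewrite addn0 subn1 !nth_alt//= odd_double.
by rewrite ltnS ltn0 subn1 !nth_alt ?(ltnW ik)//= ?negbK//.
Qed.

(** The cyclic face cancels one of the two words of [bar_alt] and supplies the rotation of the
    other. The result is - (1 - t) of a word that the component with e cancels. *)
Lemma hoch_alt phi k : (forall n, multiadditive n phi) ->
  hoch mul phi (alt false k.*2.+2) = - (phi (alt true k.*2.+1) - cyc phi (alt true k.*2.+1)).
Proof.
move=> ma; rewrite /hoch size_alt /= bar_alt//.
have e : mul (alt true k.+1.*2)`_0 (alt true k.+1.*2)`_1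
    = - ((alt true k.+1.*2)`_0 + (alt true k.+1.*2)`_1).
  by apply: alternate_mul; rewrite doubleS.
rewrite -doubleS rotr_alt_even//= (join_delete (ma k.*2.+1) _ _ e) ?size_alt//.
rewrite [in delete 0 _]doubleS delete0_alt delete1_alt /cyc size_alt /=.
have s1 : ((-1) ^+ k.*2 : S) = 1 by rewrite -signr_odd odd_double.
rewrite exprS s1 mulr1 scaleN1r !scale1r.
by rewrite [RHS]opprB opprD !opprK addrA subrK addrC.
Qed.

(** The length is even, so the signs alternate: k even rotations fix the word and k odd ones
    exchange x and y. *)
Lemma norm_alt psi k :
  norm psi (alt false k.*2) = k%:R *: (psi (alt false k.*2) - psi (alt true k.*2)).
Proof.
rewrite /norm size_alt.
have -> : \sum_(0 <= j < k.*2) (-1) ^+ (j * k.*2.-1) *: psi (rotr j (alt false k.*2)) =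
   \sum_(0 <= j < k.*2) (-1) ^+ j *: psi (alt (odd j) k.*2).
  apply: eq_big_nat => j /= jk; rewrite rotr_alt_even ?(ltnW jk)//=; congr (_ *: _).
  apply: sign_parity; rewrite oddM -subn1 oddB ?odd_double ?andbT//.
  exact: leq_ltn_trans jk.
rewrite scaler_nat; pose f b := psi (alt b k.*2).
rewrite -[LHS]/(\sum_(0 <= j < k.*2) (-1) ^+ j *: f (odd j)) -/(f _) -/(f _).
elim: k f => [|k IH] f; first by rewrite big_geq// mulr0n.
rewrite doubleS !big_nat_recr//= IH mulrSr odd_double /= -addrA; congr (_ + _).
rewrite exprS -signr_odd odd_double expr0 mulr1 scale1r.
by rewrite scaleN1r.
Qed.
End Invertible.

Definition formal_ch_invertible (x y : K) n : formal_sum R K :=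
  if odd n then
    [:: ((-1) ^+ n./2 * n./2`!%:R, (false, alt x y false n.+1));
        ((-1) ^+ n./2 * n./2`!%:R, (true, alt x y true n))]
  else [::].

(** The factorials come from [norm_alt]: B of the component with 2k + 2 letters has the factor k +
    1, so consecutive coefficients must have the ratio - (k + 1). *)
Lemma formal_ch_invertible_cycle (x y : K) :
  mul x y = - (x + y) -> mul y x = - (x + y) ->
  formal_cycle mul (formal_ch_invertible x y).
Proof.
move=> xy yx V [phi psi] ma; split=> [|n]; first by rewrite /ev big_nil.
have m1 n' := (ma n').1; have m2 n' := (ma n').2.
rewrite /formal_ch_invertible; case: (boolP (odd n.+1)) => n1; last first.
  case: n n1 => [//|n] /=; rewrite negbK => /negbTE ->.
  by rewrite /ev !big_nil addr0.
have [k ->] : exists k, n = k.*2.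
  by exists n./2; rewrite -[LHS]odd_double_half; move: n1 => /= /negbTE ->.
have -> : (k.*2.+1./2 = k)%N by rewrite -[k.*2.+1]/(true + k.*2)%N half_bit_double.
set c := _ * _.
have -> : ev (p_hoch mul (phi, psi)) [:: (c, (false, alt x y false k.*2.+2)); (c, (true, alt x y true k.*2.+1))]
   = - c *: bar mul psi (alt x y true k.*2.+1).
  rewrite /ev big_cons big_seq1 /= !fctE /= hoch_alt// -scalerDr addrA addNr add0r.
  by rewrite scalerN scaleNr.
case: k @c => [|k] c.
  by rewrite /bar size_alt big_geq// scaler0 addr0.
rewrite doubleS /= odd_double /= bar_alt//.
rewrite uphalf_double [~~ true]/=.
rewrite /ev big_cons big_seq1 /= -doubleS norm_alt scaler0 addr0.
rewrite exprS -signr_odd odd_double mulr1 scaleN1r opprK scalerA.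
rewrite addrC [- psi _ + _]addrC -[psi (alt _ _ true _) - _]opprB scalerN scaleNr opprK.
have -> : c = - ((-1) ^+ k * k`!%:R * k.+1%:R).
  by rewrite /c exprS factS natrM; ring.
by rewrite scaleNr subrr.
Qed.
End FormalCharacters.

(** * Degenerate chains *)

Section Span.
Variables (R : realType).
Notation S := R[i].

(** [degenerate] unfolds to the closure of such a span. *)
Definition span (V : lmodType S) (G : V -> Prop) : set V :=
  [set z | exists (m : nat) (c : 'I_m -> S) (g : 'I_m -> V),
    (forall i, G (g i)) /\ z = \sum_(i < m) c i *: g i].

Lemma span0 (V : lmodType S) (G : V -> Prop) : span G 0.
Proof. by exists 0%N, (fun=> 0), (fun=> 0); split=> [[]//|]; rewrite big_ord0. Qed.

Lemma span_gen (V : lmodType S) (G : V -> Prop) v : G v -> span G v.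
Proof.
by move=> Gv; exists 1%N, (fun=> 1), (fun=> v); split=> //; rewrite big_ord1 scale1r.
Qed.

Lemma spanZ (V : lmodType S) (G : V -> Prop) c v : span G v -> span G (c *: v).
Proof.
move=> [m [d [g [Gg ->]]]]; exists m, (fun i => c * d i), g; split=> //.
by rewrite scaler_sumr; apply: eq_bigr => i _; rewrite scalerA.
Qed.

Lemma spanD (V : lmodType S) (G : V -> Prop) u v : span G u -> span G v -> span G (u + v).
Proof.
move=> [m [c [g [Gg ->]]]] [m' [c' [g' [Gg' ->]]]].
exists (m + m')%N, (fun i => match fintype.split i with inl j => c j | inr j => c' j end),
  (fun i => match fintype.split i with inl j => g j | inr j => g' j end); split.
  by move=> i; case: fintype.split.
rewrite big_split_ord; congr (_ + _); apply: eq_bigr => i _.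
  by rewrite -[lshift _ _]/(unsplit (inl i)) unsplitK.
by rewrite -[rshift _ _]/(unsplit (inr i)) unsplitK.
Qed.

Lemma spanN (V : lmodType S) (G : V -> Prop) v : span G v -> span G (- v).
Proof. by rewrite -scaleN1r; exact: spanZ. Qed.

Lemma spanB (V : lmodType S) (G : V -> Prop) u v : span G u -> span G v -> span G (u - v).
Proof. by move=> Gu Gv; apply: spanD => //; exact: spanN. Qed.

Lemma span_sum (V : lmodType S) (G : V -> Prop) (I : Type) (r : seq I) (P : pred I) (f : I -> V) :
  (forall i, P i -> span G (f i)) -> span G (\sum_(i <- r | P i) f i).
Proof. by move=> Gf; apply: big_ind => //; [exact: span0|exact: spanD]. Qed.

Lemma span_sum_nat (V : lmodType S) (G : V -> Prop) m n (f : nat -> V) :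
  (forall i, (m <= i < n)%N -> span G (f i)) -> span G (\sum_(m <= i < n) f i).
Proof.
by move=> Gf; rewrite big_nat; apply: span_sum.
Qed.

Lemma span_linear (V W : lmodType S) (G : V -> Prop) (H : W -> Prop) (f : V -> W) :
  linear f -> (forall v, G v -> span H (f v)) -> forall v, span G v -> span H (f v).
Proof.
move=> fl GH v [m [c [g [Gg ->]]]].
have [_ fZ] := linear_subZ fl; have fD := linear_additive fl.
have -> : f (\sum_(i < m) c i *: g i) = \sum_(i < m) c i *: f (g i).
  rewrite (big_morph f fD (linear_fun0 fl)); apply: eq_bigr => i _; exact: fZ.
by apply: span_sum => i _; apply: spanZ; exact: GH.
Qed.

Lemma closure_span_linear (V W : tvsType S) (G : V -> Prop) (H : W -> Prop) (f : V -> W) :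
  linear f -> continuous f -> (forall v, G v -> span H (f v)) ->
  forall v, closure (span G) v -> closure (span H) (f v).
Proof.
move=> fl fc GH v Gv U fU; have [u [Gu Uu]] := Gv _ (fc v U fU).
by exists (f u); split=> //; exact: span_linear Gu.
Qed.

Lemma closure_span0 (V : tvsType S) (G : V -> Prop) :
  hausdorff_space V -> (forall v, ~ G v) -> closure (span G) `<=` [set 0].
Proof.
move=> hV nG; rewrite [X in _ `<=` X](_ : _ = closure [set 0]).
  apply: closure_subset => v [m [c [g [Gg ->]]]] /=; rewrite big1// => i _.
  by have := nG _ (Gg i).
by apply/closure_id; exact: accessible_closed_set1 (hausdorff_accessible hV) _.
Qed.

Lemma closure_spanD (V : tvsType S) (G : V -> Prop) u v :
  closure (span G) u -> closure (span G) v -> closure (span G) (u + v).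
Proof.
move=> Gu Gv U; have := @add_continuous V (u, v) U.
rewrite /= => H /H [[U1 U2] /= [nU1 nU2] sub].
have [u' [Gu' Uu']] := Gu _ nU1; have [v' [Gv' Uv']] := Gv _ nU2.
exists (u' + v'); split; first exact: spanD.
exact: (sub (u', v')).
Qed.

Lemma closure_spanZ (V : tvsType S) (G : V -> Prop) c v :
  closure (span G) v -> closure (span G) (c *: v).
Proof.
apply: (closure_span_linear (f := fun v => c *: v)).
- by move=> a x y; rewrite scalerDr !scalerA mulrC.
- by apply: tvs_continuousZ => x; exact: cvg_id.
by move=> w Gw; apply: spanZ; exact: span_gen.
Qed.

Lemma closure_spanB (V : tvsType S) (G : V -> Prop) u v :
  closure (span G) u -> closure (span G) v -> closure (span G) (u - v).
Proof.
by move=> Gu Gv; apply: closure_spanD => //; rewrite -scaleN1r; exact: closure_spanZ.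
Qed.
End Span.

(** * Insertion of the unit as an operator on tensors *)

Section Insertion.
Variables (R : realType) (J : open_interval R) (X : tvsType R[i]).
Hypothesis X_hausdorff : hausdorff_space X.
Variable C : forall n, tensor_power J X n.
Notation A := (Cinf J X).
Notation Rg := (Cinf J (R[i]^o)).
Notation Aplus := (Cinf J X * Cinf J (R[i]^o))%type.
Variable one : A.

Definition insx n (q : 'I_n.+1) (x : 'I_n -> A) : 'I_n.+1 -> A :=
  fun i => oapp x one (unlift q i).

Definition ins (T : Type) (u : T) p (s : seq T) := take p s ++ u :: drop p s.

Lemma size_ins (T : Type) (u : T) p s : (p <= size s)%N -> size (ins u p s) = (size s).+1.
Proof. by move=> ps; rewrite size_cat size_takel//= size_drop; lia. Qed.

Lemma nth_ins (T : Type) (u x0 : T) p s i : (p <= size s)%N ->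
  nth x0 (ins u p s) i =
  if (i < p)%N then nth x0 s i else if i == p then u else nth x0 s i.-1.
Proof.
move=> ps; rewrite nth_cat size_takel//; case: ltngtP => ip.
- by rewrite nth_take.
- have -> : (i - p = (i.-1 - p).+1)%N by lia.
  by rewrite /= nth_drop; congr nth; lia.
- by rewrite ip subnn.
Qed.

Lemma continuous_ptws (T : topologicalType) (I : eqType) (Y : topologicalType)
    (f : T -> {ptws I -> Y}) :
  (forall i, continuous (fun x => f x i)) -> continuous f.
Proof.
move=> fi x; apply/cvg_sup => i U /= [B [[W oW <-] Wx] WU].
have : nbhs x ((fun x => f x i) @^-1` W) by apply: fi; apply: open_nbhs_nbhs.
by apply: filterS => y Wy; exact: WU.
Qed.

Lemma continuous_pair (T U V : topologicalType) (f : T -> U) (g : T -> V) :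
  continuous f -> continuous g -> continuous (fun x => (f x, g x)).
Proof. by move=> cf cg x; exact: cvg_pair (cf x) (cg x). Qed.

Lemma insx_continuous n (q : 'I_n.+1) :
  continuous (insx q : {ptws 'I_n -> A} -> {ptws 'I_n.+1 -> A}).
Proof.
apply: continuous_ptws => i; rewrite /insx.
case: (unlift q i) => [j|] /=; last exact: (@cst_continuous _ A one).
exact: (@proj_continuous _ (fun=> A) j).
Qed.

Lemma insx_update n (q : 'I_n.+1) (x : 'I_n -> A) i u :
  insx q (update x i u) = update (insx q x) (lift q i) u.
Proof.
apply/funext => k; rewrite /insx /update; case: unliftP => [j ->|->] /=.
  by rewrite (inj_eq lift_inj).
by rewrite (negbTE (neq_lift q i)).
Qed.

Lemma tensor_ins n p (a0 : Aplus) s (pn : (p < n.+1)%N) : size s = n ->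
  tensor C n.+1 a0 (ins one p s) =
  pure_tensor (C n.+1) a0 (insx (Ordinal pn) (fun i : 'I_n => s`_i)).
Proof.
move=> sn; congr pure_tensor; apply/funext => k; rewrite nth_ins ?sn// /insx.
case: unliftP => [j ->|->] /=; last by rewrite ltnn eqxx.
have bE : bump p j = if (p <= j)%N then j.+1 else j by rewrite /bump; case: leqP.
rewrite bE; case: (leqP p j) => pj; last by rewrite pj.
by rewrite ltnNge leqW//= gtn_eqF.
Qed.

(* C_0 has no unit part, which forces the case distinction. *)
Definition ins_head n (a0 : Aplus) : Aplus := if n == 0%N then (a0.1, 0) else a0.

(** The existence half of the universal property: unlike J_nabla, the insertion of [one] respects
    scalars from C^oo(J). *)
Lemma insertion_operator n p : (p <= n)%N -> exists H : C n -> C n.+1,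
  [/\ linear H, continuous H & forall a0 s, size s = n ->
    H (tensor C n a0 s) = tensor C n.+1 (ins_head n a0) (ins one p s)].
Proof.
rewrite -ltnS => pn; pose q := Ordinal pn.
have [pc pl plu pb _] := pure_tensor_form (C n.+1).
have bf : balanced_form (fun a0 (x : 'I_n -> A) =>
    pure_tensor (C n.+1) (ins_head n a0) (insx q x)).
  split.
  - have hc : continuous (fun z : Aplus * {ptws 'I_n -> A} =>
        (ins_head n z.1, insx q z.2) : Aplus * {ptws 'I_n.+1 -> A}).
      apply: (@continuous_pair _ Aplus {ptws 'I_n.+1 -> A}).
        rewrite /ins_head; case: (n == 0%N) => z; last exact: cvg_fst.
        apply: (@continuous_pair _ A Rg _ (fun=> 0)); last by move=> ?; exact: cvg_cst.
        by move=> y; apply: (@cts_comp _ Aplus A fst fst) => w; exact: cvg_fst.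
      apply: (@cts_comp _ {ptws 'I_n -> A} {ptws 'I_n.+1 -> A} snd (insx q)).
        by move=> z; exact: cvg_snd.
      exact: insx_continuous.
    exact: (@cts_comp _ (Aplus * {ptws 'I_n.+1 -> A})%type (C n.+1) _
      (fun z => pure_tensor (C n.+1) z.1 z.2) hc pc).
  - move=> x c a b; rewrite -pl; congr pure_tensor; rewrite /ins_head.
    by case: ifP => // _; congr pair; rewrite /= scaler0 addr0.
  - by move=> a0 x i c a b; rewrite !insx_update plu.
  - move=> a0 x i f; have n0 : (n == 0)%N = false by case: (n) i => [[]|].
    rewrite /ins_head n0 (pb _ _ (lift q i)) insx_update /insx liftK.
    by [].
  - move=> n0 g x; have {}n0 : (n == 0%N) = true by apply/eqP.
    rewrite /ins_head n0 /=; exact: linear_fun0 (pl _).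
have [H [[Hl Hc HE] _]] := tensor_universal (C n)
  (@tensor_complete _ _ _ _ (C n.+1)) (@tensor_hausdorff _ _ _ _ (C n.+1)) bf.
exists H; split=> // a0 s sn; rewrite (tensor_ins _ pn sn).
exact: HE.
Qed.
End Insertion.

Ltac ins_size :=
  first [ lia | rewrite (size_rotr, size_upd, size_join_at, size_ins); ins_size ].

Ltac ins_eq x0 :=
  apply: (@eq_from_nth _ x0);
  [ ins_size
  | let i := fresh "i" in move=> i;
    rewrite ?(size_rotr, size_upd, size_join_at, size_ins); try ins_size;
    let iw := fresh "iw" in move=> iw;
    repeat first
      [ rewrite nth_upd; try ins_size; []
      | rewrite nth_join_at; try ins_size; []
      | rewrite nth_rotr; try ins_size; []
      | rewrite nth_ins; try ins_size; []
      | rewrite (size_rotr, size_upd, size_join_at, size_ins); try ins_size; []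
      | case: ifP => ?; try lia ];
    try solve [ repeat (f_equal; try lia) | reflexivity ] ].

Section InsertWords.
Variables (T : Type) (x0 : T) (op : T -> T -> T) (u : T).
Implicit Types w : seq T.

Lemma join_ins_lt q k w : (q.+1 < k)%N -> (k <= size w)%N ->
  join_at x0 op q (ins u k w) = ins u k.-1 (join_at x0 op q w).
Proof. by move=> qk kw; ins_eq x0. Qed.

Lemma join_ins_l q w : (q < size w)%N ->
  join_at x0 op q (ins u q.+1 w) = upd w q (op (nth x0 w q) u).
Proof. by move=> qw; ins_eq x0. Qed.

Lemma join_ins_r q w : (q < size w)%N ->
  join_at x0 op q (ins u q w) = upd w q (op u (nth x0 w q)).
Proof. by move=> qw; ins_eq x0. Qed.

Lemma join_ins_gt q k w : (k < q)%N -> (q < size w)%N ->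
  join_at x0 op q (ins u k w) = ins u k (join_at x0 op q.-1 w).
Proof. by move=> kq qw; ins_eq x0. Qed.

Lemma rotr_ins k w : (k < size w)%N -> rotr 1 (ins u k w) = ins u k.+1 (rotr 1 w).
Proof. by move=> kw; ins_eq x0. Qed.

(** The product absorbs u and the insertion restores it. *)
Lemma ins_join_id k w : (k.+1 < size w)%N -> nth x0 w k.+1 = u ->
  (forall a, op a u = a) -> ins u k.+1 (join_at x0 op k w) = w.
Proof.
move=> kw wk opu; ins_eq x0.
- have -> : i = k by lia.
  by rewrite wk opu.
- have -> : i = k.+1 by lia.
  by rewrite wk.
Qed.

(** The letter u is absorbed by either neighbour. *)
Lemma join_at_unit j w : (j.+2 < size w)%N -> nth x0 w j.+1 = u ->
  (forall a, op a u = a) -> (forall a, op u a = a) ->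
  join_at x0 op j w = join_at x0 op j.+1 w.
Proof.
move=> jw wj opu uop; ins_eq x0.
- have -> : i = j by lia.
  by rewrite wj opu.
- have -> : i = j.+1 by lia.
  by rewrite wj uop.
Qed.
End InsertWords.

Section InsertHoch.
Variables (S : nzRingType) (K : zmodType) (mul : K -> K -> K) (one : K).
Hypothesis mul1 : forall a, mul one a = a /\ mul a one = a.
Variable V : lmodType S.
Implicit Types (phi : seq K -> V) (w : seq K).
Notation mulat := (join_at 0 mul).

Lemma hoch_ext phi psi w : (forall v, size v = (size w).-1 -> phi v = psi v) ->
  hoch mul phi w = hoch mul psi w.
Proof.
move=> e; rewrite /hoch; congr (_ + _).
  apply: eq_big_nat => q /= qw; rewrite e// size_join_at//.
  by rewrite -ltnS; case: (size w) qw.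
by case: ifP => // w1; rewrite e// size_join_at size_rotr.
Qed.

(** The two faces that absorb the inserted letter cancel each other. The faces to its right and the
    cyclic ones cancel against those of the second term; the faces to its left remain. *)
Lemma hoch_ins phi w k n : size w = n.+2 -> (k < n.+1)%N ->
  hoch mul phi (ins one k.+1 w) + hoch mul (fun v => phi (ins one k.+1 v)) w =
  \sum_(0 <= q < k) (-1) ^+ q *: phi (ins one k (mulat q w)) +
  \sum_(0 <= q < k.+1) (-1) ^+ q *: phi (ins one k.+1 (mulat q w)).
Proof.
move=> wn kn.
have kw : (k.+1 <= size w)%N by rewrite wn ltnW.
rewrite /hoch /bar size_ins// wn /=.
have -> : mulat 0 (rotr 1 (ins one k.+1 w)) = ins one k.+1 (mulat 0 (rotr 1 w)).
  by rewrite (rotr_ins 0) ?wn// join_ins_lt ?size_rotr ?wn.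
rewrite addrACA [X in _ + X](_ : _ = 0) ?addr0; last first.
  by rewrite [X in X *: _ + _]exprS mulN1r scaleNr addNr.
rewrite (@big_cat_nat _ _ _ k)//=; last by rewrite ltnW// ltnW.
rewrite [X in _ + X + _]big_ltn; last by rewrite ltnW.
rewrite [X in _ + (_ + X) + _]big_ltn//.
have kw0 : (k < size w)%N by rewrite wn; lia.
have kw1 : (k.+1 < size w)%N by rewrite wn.
rewrite join_ins_l// join_ins_r// (mul1 _).1 (mul1 _).2 !size_upd_id//.
rewrite [X in _ + (_ + (X *: _ + _))]exprS mulN1r scaleNr.
rewrite [X in _ + X + _](_ : _ = \sum_(k.+2 <= q < n.+2) (-1) ^+ q *: phi (mulat q (ins one k.+1 w))); last first.
  by rewrite addrA subrr add0r.
rewrite [X in _ + _ + X](@big_cat_nat _ _ _ k.+1)//=.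
have -> : \sum_(k.+2 <= q < n.+2) (-1) ^+ q *: phi (mulat q (ins one k.+1 w)) =
   - \sum_(k.+1 <= q < n.+1) (-1) ^+ q *: phi (ins one k.+1 (mulat q w)).
  rewrite big_add1 -sumrN; apply: eq_big_nat => q /andP[kq qn] /=.
  by rewrite exprS mulN1r scaleNr join_ins_gt// wn; lia.
rewrite [X in _ + X = _]addrC subrKA; congr (_ + _).
by apply: eq_big_nat => q /= qk; rewrite join_ins_lt.
Qed.
End InsertHoch.

(** * Acyclicity of the degenerate complex *)

Section DegenerateAcyclic.
Variables (R : realType) (J : open_interval R) (X : tvsType R[i]).
Hypothesis X_hausdorff : hausdorff_space X.
Variable C : forall n, tensor_power J X n.
Variables (D : deformation J X) (Q : cyclic_operators D C).
Notation A := (Cinf J X).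
Notation S := R[i].
Variable one : A.
Hypothesis one_unit : is_unit D one.
Notation mulat := (join_at 0 (mulJ D)).
Notation Deg n := (@degenerate R J X C one n).

(** A filtration by k of the words without e, according to how far to the right a factor [one] may
    stand. *)
Definition inner n k (z : C n) : Prop := exists w j,
  [/\ size w = n.+1, (0 < j <= k)%N, (j < size w)%N, w`_j = one & z = tau_alg C n w].

Lemma op_b_tau n w : op_b Q (tau_alg C n.+1 w) = hoch (mulJ D) (tau_alg C n) w.
Proof.
by have := congr1 (fun f => f.1 w) (hoch_tau X_hausdorff Q n) => /= ->.
Qed.

Lemma insertion_tau n k (H : C n -> C n.+1) : linear H ->
  (forall a0 s, size s = n -> H (tensor C n a0 s) = tensor C n.+1 (ins_head n a0) (ins one k s)) ->
  (k <= n)%N -> forall w, size w = n.+1 -> H (tau_alg C n w) = tau_alg C n.+1 (ins one k.+1 w).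
Proof.
move=> Hl HE kn [//|a s] [sn]; rewrite tau_algE// HE// /ins_head.
rewrite -[ins one k.+1 (a :: s)]/(a :: ins one k s) tau_algE ?size_ins ?sn//.
by case: (n == 0%N).
Qed.

(** On a cycle, 1 - c (b H + H' b) reduces to d - b (c H d); by linearity and continuity its range
    can be controlled on generators. *)
Lemma homotopy_step n (c : S) (H : C n.+1 -> C n.+2) (H' : C n -> C n.+1)
    (G G' : C n.+1 -> Prop) (d : C n.+1) :
  linear H -> continuous H -> linear H' -> continuous H' ->
  (forall v, G v -> degenerate_generator one (H v)) ->
  (forall v, G v -> span G' (v - c *: (op_b Q (H v) + H' (op_b Q v)))) ->
  closure (span G) d -> op_b Q d = 0 ->
  exists d' d1, [/\ Deg n.+2 d', closure (span G') d1 & d = op_b Q d' + d1].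
Proof.
move=> Hl Hc Hl' Hc' HG fG Gd bd; have bl := @op_b_linear _ _ _ _ _ Q.
pose f z := z - c *: (op_b Q (H z) + H' (op_b Q z)).
have fl : linear f.
  move=> a x y; rewrite /f Hl !bl Hl'.
  set bx := op_b Q (H x); set hx := H' _; set b_y := op_b Q (H y); set hy := H' _.
  have -> : a *: bx + b_y + (a *: hx + hy) = a *: (bx + hx) + (b_y + hy).
    by rewrite addrACA -scalerDr.
  by rewrite scalerDr scalerBr scalerA mulrC -scalerA opprD addrACA.
have fc : continuous f.
  apply: tvs_continuousB; first by move=> x; exact: cvg_id.
  apply: tvs_continuousZ; apply: tvs_continuousD.
    by apply: (@cts_comp _ _ _ H); [exact: Hc|exact: op_b_continuous].
  by apply: (@cts_comp _ _ _ (op_b Q (n:=n))); [exact: op_b_continuous|exact: Hc'].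
exists (c *: H d), (f d); split.
- apply: closure_spanZ; move: Gd; apply: closure_span_linear => // v Gv.
  by apply: span_gen; exact: HG.
- by move: Gd; apply: closure_span_linear.
- have -> : op_b Q (c *: H d) = c *: op_b Q (H d).
    exact: (linear_subZ (bl n.+1)).2.
  by rewrite /f bd (linear_fun0 Hl') addr0 addrC subrK.
Qed.

(* The homotopies inserting [one] at a fixed position contract the degenerate
   chains: successively the words with a factor [one - e] and those with a
   factor [one] in the last, the last but one, ... positions are removed. *)
Lemma inner_step n k (d : C n.+1) : (k < n.+1)%N ->
  closure (span (inner (n:=n.+1) k.+1)) d -> op_b Q d = 0 ->
  exists d' d1, [/\ Deg n.+2 d', closure (span (inner (n:=n.+1) k)) d1 & d = op_b Q d' + d1].
Proof.
move=> kn; have kn' := ltnW kn : (k <= n.+1)%N.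
have [H [Hl Hc HE]] := insertion_operator C one kn'.
have [H' [Hl' Hc' HE']] := insertion_operator C one (kn : k <= n)%N.
(* If [one] stands at k + 1, then [hoch_ins] contains the word w itself with sign (-1)^k, and this
   constant removes it. *)
apply: (homotopy_step (c := (-1) ^+ k) Hl Hc Hl' Hc') => _ [w [j [wn /andP[j0 jk] jw wj ->]]].
  rewrite (insertion_tau Hl HE)//.
  case: w wn jw wj => [//|a s] [sn] jw wj; rewrite -[ins one _ _]/(a :: ins one k s).
  rewrite tau_algE ?size_ins ?sn//.
  by apply: Degenerate_inner; rewrite ?size_ins ?sn ?mem_cat ?in_cons ?eqxx ?orbT.
rewrite (insertion_tau Hl HE)// !op_b_tau.
pose h : {linear C n -> C n.+1} := HB.pack H' (GRing.isLinear.Build _ _ _ _ H' Hl').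
have -> : H' (hoch (mulJ D) (tau_alg C n) w) =
    hoch (mulJ D) (fun v => tau_alg C n.+1 (ins one k.+1 v)) w.
  have := congr1 (fun g => g w) (hoch_post (mulJ D) h (tau_alg C n)) => /= <-.
  apply: hoch_ext => v; rewrite wn => vn; exact: (insertion_tau Hl' HE').
rewrite (hoch_ins one_unit _ wn kn); set phi := tau_alg C n.+1.
have mem v i : size v = n.+2 -> v`_i = one -> (0 < i <= k)%N -> span (inner (n:=n.+1) k) (phi v).
  move=> vn vi ik; apply: span_gen; exists v, i; split=> //.
  by rewrite vn; move: ik kn => /andP[_ ik] kn; lia.
have sj q : (q < k.+1)%N -> size (mulat q w) = n.+1 by move=> qk; rewrite size_join_at wn//; lia.
have si q : (q < k.+1)%N -> size (ins one k.+1 (mulat q w)) = n.+2.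
  by move=> qk; rewrite size_ins sj.
rewrite scalerDr opprD addrA addrAC; apply: spanB; last first.
  apply: spanZ; apply: span_sum_nat => q /= qk; apply: spanZ.
  have qk' : (q < k.+1)%N by exact: ltnW.
  apply: (mem _ k).
  - by rewrite size_ins sj.
  - by rewrite nth_ins ?sj// ltnn eqxx.
  - by rewrite leqnn andbT; lia.
move: jk; rewrite leq_eqVlt => /predU1P[jE|jk].
  subst j; rewrite big_nat_recr//= (ins_join_id (x0 := 0)) ?wn//; last by move=> a; exact: (one_unit a).2.
  rewrite scalerDr opprD addrA addrAC scalerA -exprD (@sign_parity _ (k + k) 0) ?addnn ?odd_double// scale1r.
  rewrite subrr sub0r; apply: spanN; apply: spanZ; apply: span_sum_nat => q /= qk; apply: spanZ.
  have qk' : (q < k.+1)%N by exact: ltnW.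
  apply: (mem _ k); rewrite ?si//.
    rewrite nth_ins ?sj// ltnSn nth_join_at ?wn; last by lia.
    by rewrite ltnNge (ltnW qk)/= gtn_eqF.
  by rewrite leqnn andbT; lia.
(* Now [one] stands at a position j <= k, so w is in the smaller span already. The two faces of w
   that absorb this [one] cancel, and the others keep it. *)
apply: spanB; first by apply: (mem _ j) => //; rewrite j0.
apply: spanZ; case: j j0 jk jw wj => // j _ jk jw wj.
have jk2 : (j.+2 <= k.+1)%N by [].
rewrite (@big_cat_nat _ _ _ j)//=; last by rewrite ltnW// ltnW.
rewrite [X in _ + X]big_ltn; last exact: ltnW.
rewrite [X in _ + (_ + X)]big_ltn// [mulat j w](join_at_unit (u := one))//; last first.
- by move=> a; exact: (one_unit a).1.
- by move=> a; exact: (one_unit a).2.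
- by rewrite wn; lia.
rewrite exprS mulN1r scaleNr [X in _ + X]addrA subrr add0r.
apply: spanD; apply: span_sum_nat => q /andP[q0 qj]; apply: spanZ.
  have qk : (q < k.+1)%N by lia.
  apply: (mem _ j); rewrite ?si//; last by lia.
  rewrite nth_ins ?sj// ifT; last by lia.
  rewrite nth_join_at ?wn; last by lia.
  by rewrite ltnNge (ltnW qj)/= gtn_eqF.
have qk : (q < k.+1)%N by lia.
apply: (mem _ j.+1); rewrite ?si//.
rewrite nth_ins ?sj// ifT; last by lia.
rewrite nth_join_at ?wn; last by lia.
by rewrite ifT.
Qed.

Lemma inner_acyclic n k (d : C n.+1) : (k <= n.+1)%N ->
  closure (span (inner (n:=n.+1) k)) d -> op_b Q d = 0 ->
  exists2 d', Deg n.+2 d' & op_b Q d' = d.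
Proof.
elim: k d => [|k IH] d kn dF bd.
  have -> : d = 0.
    apply: (closure_span0 _ _ dF); first exact: tensor_hausdorff.
    by move=> v [w [j [_ j0 _ _ _]]]; lia.
  exists 0; last exact: op_b0.
  by apply: subset_closure; exact: span0.
have [d' [d1 [Dd' Fd1 dE]]] := inner_step kn dF bd.
have bd1 : op_b Q d1 = 0.
  by move: bd; rewrite dE op_bD op_bb// add0r.
have [d'' Dd'' bd''] := IH d1 (ltnW kn) Fd1 bd1.
exists (d' + d''); first exact: closure_spanD.
by rewrite op_bD bd'' -dE.
Qed.

(** With [one] inserted right after a_0, the map 1 + b H + H' b turns the first factor into a_0 1 or
    a_0 s_0, which lie in A. If a_0 = 1 - e, both are 0. *)
Lemma sigmaE n H H' (a0 : Cinf J X * Cinf J (S^o)) s : size s = n.+1 ->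
  linear H' ->
  (forall a0 s, size s = n.+1 -> H (tensor C n.+1 a0 s) = tensor C n.+2 (ins_head n.+1 a0) (ins one 0 s)) ->
  (forall a0 s, size s = n -> H' (tensor C n a0 s) = tensor C n.+1 (ins_head n a0) (ins one 0 s)) ->
  tensor C n.+1 a0 s + (op_b Q (H (tensor C n.+1 a0 s)) + H' (op_b Q (tensor C n.+1 a0 s))) =
  tensor C n.+1 (lmul_plus D a0 one, 0) s +
  tensor C n.+1 (lmul_plus D a0 s`_0, 0) (one :: drop 1 s).
Proof.
move=> sn Hl' HE HE'.
have H'E x t : size t = n -> H' (tensor C n (x, 0) t) = tensor C n.+1 (x, 0) (one :: t).
  by move=> tn; rewrite HE' /ins_head /ins ?take0 ?drop0//=; case: (n == 0%N).
have H'Z := (linear_subZ Hl').2; have H'D := linear_additive Hl'.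
rewrite HE// -[ins_head n.+1 a0]/a0 /ins take0 drop0 /= !op_bE /= ?sn// drop0 !H'D H'Z.
rewrite (H'E _ (drop 1 s)) ?size_drop ?sn ?subn1// (H'E _ (take n s)) ?size_takel ?sn//.
rewrite (big_morph H' H'D (linear_fun0 Hl')) (@big_ltn _ _ _ 1)//= (big_add1 _ _ 1 n.+2) /=.
have -> : sgn R 1 *: tensor C n.+1 a0 (mulJ D one s`_0 :: drop 1 s) = - tensor C n.+1 a0 s.
  rewrite /sgn expr1 scaleN1r (one_unit _).1.
  by case: s sn => //= a s _; rewrite drop0.
have -> : \sum_(1 <= i < n.+1) sgn R i.+1 *: tensor C n.+1 a0
      (take i (one :: s) ++ mulJ D (one :: s)`_i s`_i :: drop i.+1 s)
   = - \sum_(1 <= i < n.+1) H' (sgn R i *: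
        tensor C n a0 (take i.-1 s ++ mulJ D s`_i.-1 s`_i :: drop i.+1 s)).
  rewrite -sumrN; apply: eq_big_nat => -[//|j] /= jn.
  rewrite H'Z HE' ?size_cat /= ?size_drop ?size_takel ?sn; [|lia..].
  rewrite /ins take0 drop0 /= /ins_head.
  have -> : (n == 0%N) = false by lia.
  by rewrite /sgn exprS mulN1r scaleNr.
have regroup (V : zmodType) (t l r u m : V) :
    t + (l + (- t - r) - u + (m + r + u)) = l + m.
  rewrite -!addrA (addrCA t) (addrA t) subrr add0r; congr (_ + _).
  by rewrite addrA -opprD addrC addrK.
rewrite [in sgn R n.+2 *: _]/sgn exprS mulN1r scaleNr; exact: regroup.
Qed.

Lemma tau_inner n w j : size w = n.+1 -> (0 < j < size w)%N -> w`_j = one ->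
  inner (n:=n) n (tau_alg C n w).
Proof.
move=> wn /andP[j0 jw] wj; exists w, j; split=> //.
by rewrite j0 -ltnS -wn.
Qed.

(** Eliminates e and 1 - e from the first factor, after which the filtration [inner] applies. *)
Lemma degenerate_step n (d : C n.+1) : Deg n.+1 d -> op_b Q d = 0 ->
  exists d' d1, [/\ Deg n.+2 d', closure (span (inner (n:=n.+1) n.+1)) d1 & d = op_b Q d' + d1].
Proof.
have [H [Hl Hc HE]] := insertion_operator C one (leq0n n.+1).
have [H' [Hl' Hc' HE']] := insertion_operator C one (leq0n n).
apply: (homotopy_step (c := -1) Hl Hc Hl' Hc') => _ [a0 s sn os|s sn _].
- rewrite HE// /ins take0 drop0; apply: Degenerate_inner; first by rewrite /= sn.
  by rewrite in_cons eqxx.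
- rewrite HE// /ins take0 drop0; apply: Degenerate_inner; first by rewrite /= sn.
  by rewrite in_cons eqxx.
- rewrite scaleN1r opprK (sigmaE a0 sn Hl' HE HE'); apply: spanD; apply: span_gen.
    rewrite -tau_algE//; apply: (@tau_inner _ _ (index one s).+1); rewrite /= ?sn//.
      by rewrite ltnS -sn index_mem.
    exact: nth_index.
  rewrite -tau_algE/= ?size_drop ?sn ?subn1//; apply: (@tau_inner _ _ 1) => //=.
  by rewrite size_drop sn subn1.
- rewrite scaleN1r opprK (sigmaE _ sn Hl' HE HE').
  have l0 x : lmul_plus D ((one, 0) - unit_e J X) x = 0.
    rewrite /lmul_plus /= subr0 (one_unit _).1.
    apply: (Cinf_ext X_hausdorff) => t Jt; rewrite jetD actE.
    rewrite -[jet (0 - _) 0 t]/(0 - jet (one_smooth J) 0 t) jet_one// sub0r scaleN1r.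
    by rewrite subrr.
  rewrite !l0 -[(0, 0)]/(0 : Cinf J X * Cinf J (S^o))%type !tensor0l addr0.
  exact: span0.
Qed.

Lemma degenerate_acyclic n (d : C n.+1) : Deg n.+1 d -> op_b Q d = 0 ->
  exists2 d', Deg n.+2 d' & op_b Q d' = d.
Proof.
move=> Dd bd; have [d' [d1 [Dd' Fd1 dE]]] := degenerate_step Dd bd.
have bd1 : op_b Q d1 = 0 by move: bd; rewrite dE op_bD op_bb// add0r.
have [d'' Dd'' bd''] := inner_acyclic (leqnn _) Fd1 bd1.
exists (d' + d''); first exact: closure_spanD.
by rewrite op_bD bd'' -dE.
Qed.

Lemma degenerate_B n (d : C n) : Deg n d -> Deg n.+1 (op_B Q d).
Proof.
apply: closure_span_linear; [exact: op_B_linear|exact: op_B_continuous|].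
have BE (a0 : Cinf J X * Cinf J (S^o)) s : size s = n -> one \in a0.1 :: s ->
    span (@degenerate_generator R J X C one n.+1) (op_B Q (tensor C n a0 s)).
  move=> sn os; rewrite op_BE//; apply: span_sum_nat => j _; apply: spanZ.
  apply: span_gen; apply: Degenerate_inner; first by rewrite size_rot /= sn.
  by rewrite mem_rot.
move=> _ [a0 s sn os|s sn n0]; apply: BE => //.
  by rewrite in_cons os orbT.
(* B sees the component [one] of [one - e] and puts it in a positive position. *)
by rewrite /= subr0 in_cons eqxx.
Qed.

(** (b + B) h = d is solved degree by degree, with h_(n+2) a degenerate b-primitive of d_(n+1) - B
    h_n. This is a b-cycle because d is a cycle and the equation already holds two degrees below. *)
Lemma degenerate_cycle_boundary (d : chain C) : has_parity true d -> HP_cycle Q d ->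
  (forall n, Deg n (d n)) -> HP_zero Q true d.
Proof.
move=> dp dc Dd.
have [sg sgP] : exists sg : forall n, C n.+1 -> C n.+2, (forall n, sg n 0 = 0) /\
    forall n z, Deg n.+1 z -> op_b Q z = 0 -> Deg n.+2 (sg n z) /\ op_b Q (sg n z) = z.
  pose sg n (z : C n.+1) : C n.+2 :=
    match pselect (exists2 d', Deg n.+2 d' & op_b Q d' = z) with
    (* Choosing 0 as the primitive of 0 keeps the odd components of h zero. *)
    | left e => if z == 0 then 0 else s2val (cid2 e)
    | right _ => 0
    end.
  exists sg; split=> [n|n z Dz bz]; rewrite /sg; case: pselect => //.
    by move=> ?; rewrite eqxx.
  move=> e; case: eqP => [->|_].
    by split; [apply: subset_closure; exact: span0|exact: op_b0].
  by case: (cid2 e).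
  by move=> ne; case: ne; exact: degenerate_acyclic.
have [sg0 sgD] := sgP.
(* The recursion goes back two degrees, so two consecutive components are carried. *)
pose fix h n : C n * C n.+1 := match n with
  | 0 => (0, 0)
  | m.+1 => ((h m).2, sg m (d m.+1 - op_B Q (h m).1))
  end.
pose hc : chain C := fun n => (h n).1.
have hS n : (h n).2 = hc n.+1 by [].
have hSS n : hc n.+2 = sg n (d n.+1 - op_B Q (hc n)) by [].
have bDh n : op_b Q (d n.+1) + (if n is m.+1 then op_B Q (d m) else 0) = 0.
  exact: dc.
pose bound n := op_b Q (hc n.+1) + (if n is m.+1 then op_B Q (hc m) else 0) = d n.
have main n : [/\ Deg n (hc n), Deg n.+1 (hc n.+1), bound n
    & if n is m.+1 then bound m else True].
  elim: n => [|n [IH1 IH2 IH3 IH4]].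
    split=> //; try by apply: subset_closure; exact: span0.
    by rewrite /bound op_b0 add0r; apply/esym/dp.
  have De : Deg n.+1 (d n.+1 - op_B Q (hc n)).
    by apply: closure_spanB; [exact: Dd|exact: degenerate_B].
  have be : op_b Q (d n.+1 - op_B Q (hc n)) = 0.
    rewrite op_bBr; move: (bDh n) => /eqP; rewrite addr_eq0 => /eqP ->.
    case: n IH1 IH2 IH3 IH4 De => [|n] IH1 IH2 IH3 IH4 De.
      by rewrite op_bB0// oppr0 addr0.
    rewrite -IH4 op_BD; move: (op_bB X_hausdorff Q (hc n.+1)) => /eqP.
    rewrite addr_eq0 => /eqP ->; rewrite opprK addrC opprD addrA subrr sub0r.
    by case: n {IH1 IH2 IH3 IH4 De} => [|n]; rewrite ?op_B0 ?op_BB// oppr0.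
  have [Ds bs] := sgD _ _ De be.
  by split=> //; rewrite /bound hSS bs subrK.
exists hc; last by move=> n; have [_ _ H _] := main n.
have hodd m : hc m.*2.+1 = 0.
  elim: m => [//|m IH]; rewrite doubleS hSS IH op_B0 dp ?subr0 ?sg0//=.
  by rewrite odd_double.
move=> n n_odd; have -> : n = n./2.*2.+1.
  by rewrite -[LHS]odd_double_half; case: (odd n) n_odd.
exact: hodd.
Qed.
End DegenerateAcyclic.

(** * Characters of matrices *)

Section MatrixProduct.
Variables (A : zmodType) (mul : A -> A -> A) (N : nat).
Hypothesis mulA : associative mul.
Hypothesis mulDl : forall a b c, mul (a + b) c = mul a c + mul b c.
Hypothesis mulDr : forall a b c, mul a (b + c) = mul a b + mul a c.
Notation mulM := (@mx_op A N mul).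

Lemma biadditive0l a : mul 0 a = 0.
Proof. by apply: (addrI (mul 0 a)); rewrite -mulDl !addr0. Qed.

Lemma biadditive0r a : mul a 0 = 0.
Proof. by apply: (addrI (mul a 0)); rewrite -mulDr !addr0. Qed.

Lemma mx_opDl M1 M2 M3 : mulM (M1 + M2) M3 = mulM M1 M3 + mulM M2 M3.
Proof.
apply/matrixP => i j; rewrite !mxE -big_split; apply: eq_bigr => k _ /=.
by rewrite mxE mulDl.
Qed.

Lemma mx_opDr M1 M2 M3 : mulM M1 (M2 + M3) = mulM M1 M2 + mulM M1 M3.
Proof.
apply/matrixP => i j; rewrite !mxE -big_split; apply: eq_bigr => k _ /=.
by rewrite mxE mulDr.
Qed.

Lemma mx_opA : associative mulM.
Proof.
move=> M1 M2 M3; apply/matrixP => i j; rewrite !mxE.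
transitivity (\sum_k \sum_l mul (M1 i k) (mul (M2 k l) (M3 l j))).
  apply: eq_bigr => k _; rewrite mxE.
  exact: (big_morph (mul (M1 i k)) (mulDr _) (biadditive0r _)).
rewrite exchange_big; apply: eq_bigr => l _; rewrite mxE /=.
rewrite (big_morph (mul^~ (M3 l j)) (fun a b => mulDl a b _) (biadditive0l _)).
by apply: eq_bigr => k _; exact: mulA.
Qed.

Lemma mx_op_scalarl one (M : 'M[A]_N) : (forall a, mul one a = a) ->
  mulM (\matrix_(i, j) if i == j then one else 0) M = M.
Proof.
move=> one1; apply/matrixP => i j; rewrite mxE (bigD1 i)//= mxE eqxx one1.
rewrite big1 ?addr0// => k /negbTE ki.
by rewrite mxE eq_sym ki biadditive0l.
Qed.

Lemma mx_op_scalarr one (M : 'M[A]_N) : (forall a, mul a one = a) ->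
  mulM M (\matrix_(i, j) if i == j then one else 0) = M.
Proof.
move=> one1; apply/matrixP => i j; rewrite mxE (bigD1 j)//= mxE eqxx one1.
rewrite big1 ?addr0// => k /negbTE kj.
by rewrite mxE kj biadditive0r.
Qed.
End MatrixProduct.

Section SpanTrace.
Variables (R : realType) (A : zmodType) (N : nat) (V : lmodType R[i]).
Variable G : V -> Prop.

Lemma walk_span (w : seq 'M[A]_N) (phi : seq A -> V) i j :
  (forall s, size s = size w -> span G (phi s)) -> span G (walk w phi i j).
Proof.
elim: w phi i j => [|m w IH] phi i j Gphi /=.
  by case: ifP => _; [exact: Gphi|exact: span0].
by apply: span_sum => k _; apply: IH => s sw; apply: Gphi; rewrite /= sw.
Qed.

Lemma Tr_scalar_head one (w : seq 'M[A]_N) (phi : seq A -> V) :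
  multiadditive (size w).+1 phi ->
  Tr phi ((\matrix_(i, j) if i == j then one else 0) :: w) =
  Tr (fun s => phi (one :: s)) w.
Proof.
move=> ma; apply: eq_bigr => i _ /=; rewrite (bigD1 i)//= mxE eqxx big1 ?addr0// => k ki.
rewrite (@walk_ext _ _ _ _ _ _ (fun s => 0 *: phi s)).
  by rewrite walkZ scale0r.
move=> s sw; rewrite mxE eq_sym (negbTE ki) scale0r.
have := @multiadditive0 _ _ _ _ phi (0 :: s) 0%N ma.
by rewrite /upd /= drop0 sw; exact.
Qed.
End SpanTrace.

Section MatrixFunctionals.
Variables (R : realType) (J : open_interval R) (X : tvsType R[i]).
Hypothesis X_hausdorff : hausdorff_space X.
Variables (D : deformation J X) (C : forall n, tensor_power J X n).
Variables (Q : cyclic_operators D C) (conn : connection J X).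
Variables (G : gauss_manin_operators D C conn) (N : nat).
Notation A := (Cinf J X).
Notation S := R[i].
HB.instance Definition _ n :=
  GRing.isLinear.Build S (C n.+1) (C n) *:%R (op_b Q (n:=n)) (@op_b_linear _ _ _ _ _ Q n).
HB.instance Definition _ n :=
  GRing.isLinear.Build S (C n) (C n.+1) *:%R (op_B Q (n:=n)) (@op_B_linear _ _ _ _ _ Q n).
HB.instance Definition _ n :=
  GRing.isLinear.Build S (C n.+2) (C n) *:%R (op_iota G (n:=n)) (@op_iota_linear _ _ _ _ _ _ G n).
HB.instance Definition _ n :=
  GRing.isLinear.Build S (C n) (C n) *:%R (@op_even _ _ _ _ _ _ G n) (@op_even_linear _ _ _ _ _ _ G n).

Definition matrix_tau n : @functional S 'M[A]_N (C n) := trace_pair N (tau C n).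

Lemma trace_pair_post (V V' : lmodType S) (g : {linear V -> V'}) (Phi : @functional S A V) :
  trace_pair N (post g Phi) = post g (trace_pair N Phi).
Proof. by congr pair; rewrite /= Tr_post. Qed.

Lemma trace_pairN (V : lmodType S) (Phi : @functional S A V) :
  trace_pair N (- Phi) = - trace_pair N Phi.
Proof.
have TrN (phi : seq A -> V) (w : seq 'M[A]_N) : Tr (- phi) w = - Tr phi w.
  by rewrite -scaleN1r -TrZ; apply: Tr_ext => s _; rewrite scaleN1r.
by congr pair; apply/funext => w; exact: TrN.
Qed.

Lemma trace_pair0 (V : lmodType S) : trace_pair N (0 : @functional S A V) = 0.
Proof. by congr pair; apply/funext => w; exact: Tr0. Qed.

Lemma multi_matrix_tau n : multi (matrix_tau n).
Proof. by apply: multi_trace; exact: multi_tau. Qed.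

Lemma hoch_matrix_tau n :
  p_hoch (matrix_mul D (N:=N)) (matrix_tau n) = post (op_b Q (n:=n)) (matrix_tau n.+1).
Proof. by rewrite -trace_pair_post -hoch_tau// -trace_hoch//; exact: multi_tau. Qed.

Lemma connes_matrix_tau n : p_connes (matrix_tau n.+1) = post (op_B Q (n:=n)) (matrix_tau n).
Proof. by rewrite -trace_pair_post -connes_tau// -trace_connes. Qed.

Lemma connes_matrix_tau0 : p_connes (matrix_tau 0) = 0.
Proof. by rewrite trace_connes connes_tau0// trace_pair0. Qed.

Lemma contrE_matrix_tau n : p_contrE (matrix_mul D (N:=N)) (map_mx conn) (matrix_tau n) =
  - post (op_iota G (n:=n)) (matrix_tau n.+2).
Proof.
rewrite -trace_pair_post -trace_pairN -contrE_tau//.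
exact: (@trace_contrE _ _ N _ _ _ (mulJDl X_hausdorff D) (mulJDr X_hausdorff D) (@connectionD _ _ _ conn) _ (multi_tau C n)).
Qed.

Lemma even_matrix_tau n : p_even (matrix_mul D (N:=N)) (map_mx conn) (matrix_tau n) =
  post (@op_even _ _ _ _ _ _ G n) (matrix_tau n).
Proof.
rewrite -trace_pair_post -even_tau//.
exact: (@trace_even _ _ N _ (mulJ D) _ (@connectionD _ _ _ conn) _ (multi_tau C n)).
Qed.

Lemma matrix_mulA : associative (matrix_mul D (N:=N)).
Proof. exact: mx_opA (mulJA X_hausdorff D) (mulJDl X_hausdorff D) (mulJDr X_hausdorff D). Qed.

Lemma matrix_mulDl (M1 M2 M3 : 'M[A]_N) :
  matrix_mul D (M1 + M2) M3 = matrix_mul D M1 M3 + matrix_mul D M2 M3.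
Proof. exact: (mx_opDl (mulJDl X_hausdorff D) M1 M2 M3). Qed.

Lemma matrix_mulDr (M1 M2 M3 : 'M[A]_N) :
  matrix_mul D M1 (M2 + M3) = matrix_mul D M1 M2 + matrix_mul D M1 M3.
Proof. exact: (mx_opDr (mulJDr X_hausdorff D) M1 M2 M3). Qed.

Notation chain_of z := (realize matrix_tau z).

Lemma matrix_cycle z : formal_cycle (matrix_mul D (N:=N)) z -> HP_cycle Q (chain_of z).
Proof.
apply: realize_cycle; [exact: multi_matrix_tau|exact: hoch_matrix_tau|exact: connes_matrix_tau].
Qed.

Lemma matrix_flat p z : formal_cycle (matrix_mul D (N:=N)) z ->
  (forall n, odd n != p -> z n = [::]) -> HP_zero Q p (nabla_GM G (chain_of z)).
Proof.
move=> zc zp; exists (homotopy (matrix_mul D (N:=N)) (map_mx conn) matrix_tau z).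
  move=> n np; rewrite /homotopy zp ?/ev ?big_nil ?add0r; last first.
    by move: np => /=; case: (odd n); case: (p).
  case: n np => [//|n] np; rewrite zp ?big_nil//.
  by move: np => /=; case: (odd n); case: (p).
move=> n; apply: realize_flat => //.
- exact: matrix_mulA.
- exact: matrix_mulDl.
- exact: matrix_mulDr.
- by move=> M M'; apply/matrixP => i j; rewrite !mxE connectionD.
- exact: multi_matrix_tau.
- exact: hoch_matrix_tau.
- exact: connes_matrix_tau.
- exact: connes_matrix_tau0.
- exact: contrE_matrix_tau.
- exact: even_matrix_tau.
Qed.

Lemma ch_idempotent_realize (P : 'M[A]_N) :
  ch_idempotent C P = chain_of (formal_ch_idempotent R P).
Proof.
apply: functional_extensionality_dep => n.
rewrite /ch_idempotent /realize /formal_ch_idempotent.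
case: ifP => [_|_]; first by rewrite /ev big_nil.
case: eqP => [->|_]; first by rewrite /ev big_seq1 scale1r trace_tensor_alg.
rewrite trace_tensor_alg ?size_nseq// trace_tensor_unit ?size_nseq//.
rewrite /ev big_cons big_seq1 scalerBr scalerA scaleNr.
by [].
Qed.
End MatrixFunctionals.

(** * The character of an invertible modulo degenerate chains *)

Section NormalizedInvertible.
Variables (R : realType) (J : open_interval R) (X : tvsType R[i]).
Variables (C : forall n, tensor_power J X n) (N : nat).
Notation A := (Cinf J X).
Variable one : A.
Notation Gen n := (@degenerate_generator R J X C one n).
Notation oneM := (matrix_one N one).
Implicit Types w : seq 'M[A]_N.

(** A diagonal entry of the unit matrix is an inner factor [one], and an off-diagonal one is a
    letter 0. *)
Lemma Tr_one_inner n w1 m w2 : size (w1 ++ m :: w2) = n ->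
  span (Gen n) (Tr (tau_alg C n) ((m :: w1) ++ oneM :: w2)).
Proof.
move=> wn; apply: span_sum => i _; rewrite walk_split.
apply: span_sum => k _; apply: span_sum => l _.
apply: walk_span => -[//|a s1] [s1w]; apply: walk_span => s2 s2w.
have sn x : size (s1 ++ x :: s2) = n.
  by rewrite size_cat /= s1w s2w -wn size_cat.
rewrite mxE; case: eqP => _.
  rewrite /= tau_algE//; apply/span_gen/Degenerate_inner => //.
  by rewrite mem_cat in_cons eqxx orbT.
have ma : multiadditive n.+1 (tau_alg C n) by exact: (multi_tau C n _).1.
have := multiadditive_cat_sum (@nil A) id ma (s1 := a :: s1) (s2 := s2).
rewrite !big_nil => ->; first exact: span0.
by rewrite -(sn 0) size_cat /= addnS addSn.
Qed.

(** Letters are treated one at a time, each at the cost of a word with an inner unit matrix; [w1]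
    collects the letters already done. *)
Lemma Tr_shift_inner n w1 m w2 : size (w1 ++ w2) = n ->
  span (Gen n) (Tr (tau_alg C n) ((m :: w1) ++ map (+%R^~ oneM) w2)
    - Tr (tau_alg C n) ((m :: w1) ++ w2)).
Proof.
elim: w2 w1 => [|x w2 IH] w1 wn; first by rewrite /= subrr; exact: span0.
rewrite map_cons.
have ma : multiadditive n.+1 (Tr (N:=N) (tau_alg C n)).
  by apply: multiadditive_Tr; exact: (multi_tau C n _).1.
have := multiadditive_cat_sum [:: x; oneM] id ma (s1 := m :: w1)
  (s2 := map (+%R^~ oneM) w2).
rewrite !big_cons !big_nil !addr0 => ->; last first.
  by rewrite /= size_map -wn size_cat /= addSn addnS.
rewrite addrAC; apply: spanD; last first.
  apply: Tr_one_inner; rewrite -wn !size_cat /= size_map; lia.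
by rewrite -!cat_rcons rcons_cons; apply: IH; rewrite cat_rcons.
Qed.

(** Taking the diagonal of the unit matrix leaves tensors with first factor [one - e]. *)
Lemma Tr_one_head n w : size w = n -> (0 < n)%N ->
  span (Gen n) (Tr (tau_alg C n) (oneM :: w) - Tr (tau_unit C n) w).
Proof.
move=> wn n0; have ma : multiadditive (size w).+1 (tau_alg C n) by exact: (multi_tau C n _).1.
rewrite (Tr_scalar_head one ma) -scaleN1r -TrZ -TrD.
apply: span_sum => i _; apply: walk_span => s sw; rewrite scaleN1r.
have sn : size s = n by rewrite sw.
rewrite tau_algE// tau_unitE//.
have -> : tensor C n (one, 0) s - tensor C n (unit_e J X) s = tensor C n ((one, 0) - unit_e J X) s.
  by apply/eqP; rewrite subr_eq -tensorDl subrK.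
by apply/span_gen/Degenerate_first.
Qed.

(* Every letter of the word in 1 + x, 1 + y, but the first, may be replaced by
   the corresponding x or y; the first factor 1 + y becomes y + e. *)
Lemma Tr_alt_shift n (x y : 'M[A]_N) : (0 < n)%N ->
  span (Gen n) (Tr (tau_alg C n) (alt x y false n.+1) + Tr (tau_unit C n) (alt x y true n)
    - Tr (tau_alg C n) (alt (x + oneM) (y + oneM) false n.+1)).
Proof.
move=> n0.
have altS (a b : 'M[A]_N) : alt a b false n.+1 = b :: alt a b true n.
  by rewrite /alt mkseqS; congr (_ :: _); apply: eq_mkseq => t /=; case: (odd t).
have -> : alt (x + oneM) (y + oneM) false n.+1 = (y + oneM) :: map (+%R^~ oneM) (alt x y true n).
  rewrite altS /alt [in RHS]/mkseq -map_comp; congr (_ :: _); apply: eq_mkseq => t /=.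
  by case: ifP.
rewrite altS; set w := alt x y true n.
have wn : size w = n by rewrite size_alt.
have ma : multiadditive n.+1 (Tr (N:=N) (tau_alg C n)).
  by apply: multiadditive_Tr; exact: (multi_tau C n _).1.
have := multiadditive_cat_sum [:: y; oneM] id ma (s1 := [::])
  (s2 := map (+%R^~ oneM) w).
rewrite !big_cons !big_nil !addr0 /= size_map wn => -> //.
rewrite opprD addrACA -opprB -[X in _ + X]opprB; apply: spanD; apply: spanN.
  by apply: (@Tr_shift_inner n [::]); rewrite wn.
rewrite -(subrK (Tr (tau_alg C n) (oneM :: w)) (Tr (tau_alg C n) (oneM :: map _ w))) -addrA.
apply: spanD; first by apply: (@Tr_shift_inner n [::]); rewrite wn.
exact: Tr_one_head.
Qed.
End NormalizedInvertible.

(** * Independence of the representing cycle *)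

Section InvertibleClass.
Variables (R : realType) (J : open_interval R) (X : tvsType R[i]).
Hypothesis X_hausdorff : hausdorff_space X.
Variables (D : deformation J X) (C : forall n, tensor_power J X n).
Variables (Q : cyclic_operators D C) (conn : connection J X).
Variables (G : gauss_manin_operators D C conn) (N : nat).
Notation A := (Cinf J X).
Variable one : A.
Hypothesis one_unit : is_unit D one.
Notation oneM := (matrix_one N one).

Lemma bBD (c d : chain C) n : bB Q (fun k => c k + d k) n = bB Q c n + bB Q d n.
Proof.
rewrite /bB op_bD; case: n => [|n]; first by rewrite !addr0.
by rewrite op_BD addrACA.
Qed.

Lemma bBB (c d : chain C) n : bB Q (fun k => c k - d k) n = bB Q c n - bB Q d n.
Proof.
rewrite /bB op_bBr; case: n => [|n]; first by rewrite !addr0.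
by rewrite op_BBr opprD addrACA.
Qed.

Lemma bB0 n : bB Q (fun=> 0) n = 0.
Proof. by rewrite /bB op_b0 add0r; case: n => // n; rewrite op_B0. Qed.

Lemma nabla_GMD (c d : chain C) n :
  nabla_GM G (fun k => c k + d k) n = nabla_GM G c n + nabla_GM G d n.
Proof. by rewrite !nabla_GM_E op_evenD op_iotaD opprD addrACA. Qed.

Lemma nabla_GM_parity p (c : chain C) : has_parity p c -> has_parity p (nabla_GM G c).
Proof.
move=> cp n np; rewrite nabla_GM_E !cp ?op_even0 ?op_iota0 ?subr0//.
by rewrite /= negbK.
Qed.

Lemma has_parityD p (c d : chain C) : has_parity p c -> has_parity p d ->
  has_parity p (fun n => c n + d n).
Proof. by move=> cp dp n np; rewrite cp// dp// addr0. Qed.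

Lemma bB_parity p (h : chain C) : has_parity (~~ p) h -> has_parity p (bB Q h).
Proof.
move=> hp n np; rewrite /bB hp; last by move: np => /=; case: (odd n); case: (p).
rewrite op_b0 add0r; case: n np => // n np.
by rewrite hp ?op_B0//; move: np => /=; case: (odd n); case: (p).
Qed.

Lemma nabla_GM_homologous p (c c0 h : chain C) : has_parity (~~ p) h ->
  (forall n, c n = c0 n + bB Q h n) ->
  HP_zero Q p (nabla_GM G c0) -> HP_zero Q p (nabla_GM G c).
Proof.
move=> hp cE [g gp gE]; exists (fun n => g n + nabla_GM G h n).
  by apply: has_parityD => //; exact: nabla_GM_parity.
move=> n; rewrite bBD gE bB_nabla_GM// -nabla_GMD; congr (nabla_GM G _ n).
by apply: functional_extensionality_dep => k; rewrite cE.
Qed.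

(** Subtracting the boundary of the difference of the two normalized homotopies from z - z0 leaves a
    degenerate cycle, which is a boundary by acyclicity. *)
Lemma represents_homologous (c z z0 : chain C) :
  represents Q one true c z -> represents Q one true c z0 ->
  exists2 h, has_parity false h & forall n, z n = z0 n + bB Q h n.
Proof.
move=> [zp zc [h hp hE]] [z0p z0c [h0 h0p h0E]].
pose d : chain C := fun n => (z n - z0 n) - bB Q (fun k => h k - h0 k) n.
have hh0 : has_parity false (fun k => h k - h0 k).
  by move=> n np; rewrite hp// h0p// subr0.
have [g gp gE] : HP_zero Q true d.
  apply: (degenerate_cycle_boundary X_hausdorff one_unit).
  - by move=> n np; rewrite /d zp// z0p// subrr (bB_parity (p := true) hh0 np) subr0.
  - move=> n; rewrite /d (@bBB (fun k => z k - z0 k)) bB_bB// subr0 bBB zc z0c subr0.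
    by [].
  - move=> n; rewrite /d bBB.
    have -> : z n - z0 n - (bB Q h n - bB Q h0 n) =
      (z n - c n - bB Q h n) - (z0 n - c n - bB Q h0 n).
      by rewrite [RHS]subrBB [z n - c n - _]subrBB subrr subr0.
    exact: closure_spanB (hE n) (h0E n).
exists (fun n => g n + (h n - h0 n)); first exact: has_parityD.
by move=> n; rewrite bBD gE /d subrK addrC subrK.
Qed.

Section Matrix.
Variables U V : 'M[A]_N.
Hypothesis UV : matrix_mul D U V = oneM.
Hypothesis VU : matrix_mul D V U = oneM.

Lemma shifted_inverse (M M' : 'M[A]_N) : matrix_mul D M M' = oneM ->
  matrix_mul D (M - oneM) (M' - oneM) = - ((M - oneM) + (M' - oneM)).
Proof.
have oneMl (L : 'M[A]_N) : matrix_mul D oneM L = L.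
  exact: (mx_op_scalarl (mulJDl X_hausdorff D) L (fun a => (one_unit a).1)).
have oneMr (L : 'M[A]_N) : matrix_mul D L oneM = L.
  exact: (mx_op_scalarr (mulJDr X_hausdorff D) L (fun a => (one_unit a).2)).
rewrite -{1}[M](subrK oneM) -{1}[M'](subrK oneM).
move: (M - oneM) (M' - oneM) => x y.
rewrite matrix_mulDl// !matrix_mulDr// oneMr !oneMl => /eqP.
rewrite addrA -subr_eq0 addrK => /eqP; rewrite -addrA => /eqP.
by rewrite addr_eq0 => /eqP.
Qed.

Definition normalized_ch : chain C :=
  realize (matrix_tau C N) (formal_ch_invertible R (U - oneM) (V - oneM)).

Lemma normalized_ch_cycle :
  formal_cycle (matrix_mul D (N:=N)) (formal_ch_invertible R (U - oneM) (V - oneM)).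
Proof.
apply: formal_ch_invertible_cycle; first exact: shifted_inverse.
by rewrite [in RHS]addrC; exact: shifted_inverse.
Qed.

Lemma normalized_ch_represents :
  represents Q one true (ch_invertible C U V) normalized_ch.
Proof.
split.
- move=> n; rewrite /normalized_ch /realize /formal_ch_invertible.
  by case: (odd n) => //= _; rewrite /ev big_nil.
- exact: matrix_cycle normalized_ch_cycle.
(* The cycle differs from ch U by degenerate chains in each degree, so the homotopy is 0. *)
exists (fun=> 0); first by [].
move=> n; rewrite bB0 subr0; apply: subset_closure.
rewrite /normalized_ch /realize /formal_ch_invertible /ch_invertible.
case: ifP => n_odd; last by rewrite /ev big_nil subr0; exact: span0.
rewrite trace_tensor_alg ?size_mkseq// /ev big_cons big_seq1 -scalerDr -scalerBr.
apply: spanZ; have n0 : (0 < n)%N by case: (n) n_odd.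
have := Tr_alt_shift C one (U - oneM) (V - oneM) n0; rewrite !subrK.
rewrite [X in _ - Tr _ X](_ : _ = V :: mkseq (fun k => if odd k then V else U) n)//.
rewrite /alt mkseqS; congr (_ :: _).
by apply: eq_mkseq => t /=; case: (odd t).
Qed.

Lemma normalized_ch_flat : HP_zero Q true (nabla_GM G normalized_ch).
Proof.
apply: (matrix_flat X_hausdorff Q G normalized_ch_cycle) => n.
by rewrite /formal_ch_invertible; case: (odd n).
Qed.
End Matrix.
End InvertibleClass.

Theorem theorem7p6 (R : realType) (J : open_interval R) (X : tvsType R[i])
    (X_complete : complete_tvs X) (X_hausdorff : hausdorff_space X)
    (D : deformation J X)
    (C : forall n, tensor_power J X n) (Q : cyclic_operators D C)
    (conn : connection J X) (G : gauss_manin_operators D C conn) (N : nat) :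
  (forall P : 'M[Cinf J X]_N,
     matrix_mul D P P = P ->
     HP_cycle Q (ch_idempotent C P) /\
     HP_zero Q false (nabla_GM G (ch_idempotent C P))) /\
  (forall (one : Cinf J X) (U V : 'M[Cinf J X]_N),
     is_unit D one ->
     matrix_mul D U V = matrix_one N one ->
     matrix_mul D V U = matrix_one N one ->
     (exists z, represents Q one true (ch_invertible C U V) z) /\
     (forall z, represents Q one true (ch_invertible C U V) z ->
        HP_zero Q true (nabla_GM G z))).
Proof.
split=> [P PP|one U V one_unit UV VU].
  have zc := formal_ch_idempotent_cycle (R:=R) PP.
  rewrite ch_idempotent_realize; split; first exact: matrix_cycle zc.
  apply: (matrix_flat X_hausdorff Q G zc) => n.
  by rewrite /formal_ch_idempotent; case: (odd n).
have z0P := normalized_ch_represents X_hausdorff Q one_unit UV VU.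
split=> [|z zP]; first by eexists; exact: z0P.
have [h hp zE] := represents_homologous X_hausdorff one_unit zP z0P.
apply: (@nabla_GM_homologous _ _ _ X_hausdorff _ _ _ _ G true _ _ _ hp zE).
exact: normalized_ch_flat.
Qed.
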